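(* Let $(\mathcal K,\mathrm d)$ be a metric tame Kuranishi atlas with nested reduction $\mathcal C\sqsubset\mathcal V$ and additive norms $\|\cdot\|$. Then for any $0<\delta<\delta_{\mathcal V}$ and $0<\sigma\le\sigma(\mathcal V,\mathcal C,\|\cdot\|,\delta)$ there exists a $(\mathcal V,\mathcal C,\|\cdot\|,\delta,\sigma)$-adapted perturbation $\nu$ of $\mathfrak s_{\mathcal K}|_{\mathcal V}$. In particular, $\nu$ is admissible, precompact, and transverse, and its perturbed zero set $|\mathbf Z^\nu|=|(\mathfrak s_{\mathcal K}|_{\mathcal V}+\nu)^{-1}(0)|$ is compact with $\pi_{\mathcal K}\big((\mathfrak s_{\mathcal K}|_{\mathcal V}+\nu)^{-1}(0)\big)$ contained in $\pi_{\mathcal K}(\mathcal C)$.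
   Context: \textbf{Charts and atlases.} $X$ is a compact metrizable space. A Kuranishi chart (trivial isotropy) for $X$ with footprint a nonempty open $F\subset X$ is $\mathbf K=(U,E,s,\psi)$ with $U$ a finite-dimensional smooth manifold (without boundary), $E$ a finite-dimensional real vector space, $s:U\to E$ smooth, $\psi:s^{-1}(0)\to X$ a homeomorphism onto $F$; $\dim\mathbf K=\dim U-\dim E$. A coordinate change $\widehat\Phi_{IJ}:\mathbf K_I\to\mathbf K_J$ ($F_I\cap F_J\neq\emptyset$) consists of an open $U_{IJ}\subset U_I$ with $U_{IJ}\cap s_I^{-1}(0)=\psi_I^{-1}(F_I\cap F_J)$, a smooth embedding $\phi_{IJ}:U_{IJ}\to U_J$ and a linear injection $\widehat\phi_{IJ}:E_I\to E_J$ with $s_J\circ\phi_{IJ}=\widehat\phi_{IJ}\circ s_I$, $\phi_{IJ}=\psi_J^{-1}\circ\psi_I$ on $U_{IJ}\cap s_I^{-1}(0)$, and the index condition: for all $u\in U_{IJ}$, $d_u\phi_{IJ}(\ker d_us_I)=\ker d_{\phi_{IJ}(u)}s_J$, and $E_I=\operatorname{im}d_us_I\oplus C$ implies $E_J=\operatorname{im}d_{\phi_{IJ}(u)}s_J\oplus\widehat\phi_{IJ}(C)$. A Kuranishi atlas $\mathcal K$ of dimension $d$ on $X$ consists of basic charts $\mathbf K_1,\dots,\mathbf K_N$ with footprints covering $X$; with $\mathcal I_{\mathcal K}=\{\emptyset\neq I\subset\{1,\dots,N\}:F_I:=\bigcap_{i\in I}F_i\neq\emptyset\}$, charts $\mathbf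 K_I$ with footprint $F_I$ for $I\in\mathcal I_{\mathcal K}$ ($\mathbf K_{\{i\}}=\mathbf K_i$), all of dimension $d$; and coordinate changes $\widehat\Phi_{IJ}$ for $I\subsetneq J$, such that for $I\subsetneq J\subsetneq L$: $\widehat\phi_{JL}\widehat\phi_{IJ}=\widehat\phi_{IL}$, $\phi_{IJ}^{-1}(U_{JL})\subset U_{IL}$, and $\phi_{JL}\phi_{IJ}=\phi_{IL}$ on $\phi_{IJ}^{-1}(U_{JL})$. Conventions: $U_{II}=U_I$, $\phi_{II}=\mathrm{id}$, $s_J^{-1}(E_I)=s_J^{-1}(\widehat\phi_{IJ}(E_I))$. It is tame if it is additive (each map $\prod_{i\in I}E_i\to E_I$, $(e_i)\mapsto\sum\widehat\phi_{iI}(e_i)$ is an isomorphism) and, for all indices (equalities allowed), $U_{IJ}\cap U_{IL}=U_{I(J\cup L)}$ for $I\subset J,L$ (with $U_{IH}=\emptyset$ for $H\notin\mathcal I_{\mathcal K}$) and $\phi_{IJ}(U_{IL})=U_{JL}\cap s_J^{-1}(E_I)$ for $I\subset J\subset L$. $|\mathcal K|=\bigsqcup_IU_I/\!\sim$, with $\sim$ generated by $(I,x)\sim(J,\phi_{IJ}(x))$ and quotient topology, has projection $\pi_{\mathcal K}$; $\iota_{\mathcal K}:X\to|\mathcal K|$, $p\mapsto[I,\psi_I^{-1}(p)]$. A metric atlas carries an admissible metric: a bounded metric $\mathrm d$ on the set $|\mathcal K|$ whose pullback $\mathrm d_I$ to each $U_I$ is a metric inducing the topology of $U_I$. $B_\delta^I$,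 $B_\delta$ denote $\delta$-neighbourhoods in $(U_I,\mathrm d_I)$, $(|\mathcal K|,\mathrm d)$; $A\sqsubset B$ means precompact inclusion. \textbf{Reductions and perturbations.} A reduction is $\mathcal V=\bigsqcup V_I$ with open $V_I\sqsubset U_I$, $V_I\cap s_I^{-1}(0)\neq\emptyset$ if $V_I\neq\emptyset$; $\pi_{\mathcal K}(\overline{V_I})\cap\pi_{\mathcal K}(\overline{V_J})\neq\emptyset$ only if $I\subset J$ or $J\subset I$; $\iota_{\mathcal K}(X)\subset\pi_{\mathcal K}(\mathcal V)$. A nested reduction $\mathcal C\sqsubset\mathcal V$ is a pair of reductions with precompact inclusion. A perturbation of $\mathfrak s_{\mathcal K}|_{\mathcal V}=(s_I|_{V_I})$ is a family of smooth $\nu_I:V_I\to E_I$ with $\nu_J\circ\phi_{IJ}=\widehat\phi_{IJ}\circ\nu_I$ on $V_I\cap\phi_{IJ}^{-1}(V_J)$. It is admissible if $d_y\nu_J(T_yV_J)\subset\operatorname{im}\widehat\phi_{IJ}$ for all $I\subsetneq J$, $y\in V_J\cap\phi_{IJ}(V_I\cap U_{IJ})$; transverse if $s_I|_{V_I}+\nu_I\pitchfork0$ for all $I$; precompact if, with $(\mathfrak s_{\mathcal K}|_{\mathcal V}+\nu)^{-1}(0):=\bigsqcup_I(s_I|_{V_I}+\nu_I)^{-1}(0)$, one has $\pi_{\mathcal K}((\mathfrak s_{\mathcal K}|_{\mathcal V}+\nu)^{-1}(0))\subset\pi_{\mathcal K}(\mathcal C')$ for some nested reduction $\mathcal C'\sqsubset\mathcal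 V$. $|\mathbf Z^\nu|$ is the quotient of this zero set by the relation generated by $(I,x)\sim(J,\phi_{IJ}(x))$, with quotient topology. \textbf{Adapted perturbations.} Additive norms: norms on the $E_i$, extended by $\|\sum_{i\in I}\widehat\phi_{iI}(e_i)\|=\max_i\|e_i\|$. $\delta_{\mathcal V}\in(0,\frac14]$ is the maximal constant such that every $\delta<\delta_{\mathcal V}$ satisfies $B^I_{2\delta}(V_I)\sqsubset U_I$ and $B_{2\delta}(\pi_{\mathcal K}(V_I))\cap B_{2\delta}(\pi_{\mathcal K}(V_J))\neq\emptyset\Rightarrow I\subset J$ or $J\subset I$. Given $0<\delta<\delta_{\mathcal V}$ put $V^k_I=B^I_{2^{-k}\delta}(V_I)$ (real $k\ge0$), $N^k_{JI}=V_J^k\cap\phi_{IJ}(V_I^k\cap U_{IJ})$, $\eta_k=2^{-k}(1-2^{-1/4})\delta$, $\widetilde C_J=\bigcup_{L\supset J}\phi_{JL}^{-1}(C_L)$ and $$\sigma(\mathcal V,\mathcal C,\|\cdot\|,\delta)=\min_{J}\inf\Big\{\|s_J(x)\|:x\in\overline{V_J^{|J|}}\setminus\big(\widetilde C_J\cup\textstyle\bigcup_{I\subsetneq J}B^J_{\eta_{|J|-1/2}}(N_{JI}^{|J|-1/4})\big)\Big\}.$$ $\nu$ is $(\mathcal V,\mathcal C,\|\cdot\|,\delta,\sigma)$-adapted if the $\nu_I$ extend smoothly to $V_I^{|I|}$ so that for every $k=1,\dots,\max_{I}|I|$ and all $|I|\le k$: (a) $\nu_I\circ\phi_{HI}=\widehat\phi_{HI}\circ\nu_H$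 on $V_H^k\cap\phi_{HI}^{-1}(V_I^k)$ for $H\subsetneq I$; (b) $(s_I+\nu_I)|_{V_I^k}\pitchfork0$; (c) $\nu_I(B^I_{\eta_k}(N^k_{IH}))\subset\widehat\phi_{HI}(E_H)$ for $H\subsetneq I$ (evaluated at the points of this neighbourhood in the domain of $\nu_I$); (d) $(s_I|_{V_I^k}+\nu_I)^{-1}(0)\subset\pi_{\mathcal K}^{-1}(\pi_{\mathcal K}(\mathcal C))$; (e) $\sup_{V_I^k}\|\nu_I\|<\sigma$. *)

(* Defs.v *)
From HB Require Import structures.
From Stdlib Require Import Relation_Operators.
From mathcomp Require Import all_boot all_order all_algebra.
From mathcomp Require Import generic_quotient.
From mathcomp Require Import all_classical all_reals all_analysis.

Set Implicit Arguments.
Unset Strict Implicit.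
Unset Printing Implicit Defensive.

Import Order.TTheory GRing.Theory Num.Theory.
Import numFieldNormedType.Exports VectorInternalTheory.

Local Open Scope classical_set_scope.
Local Open Scope ring_scope.

(* A partially defined map is a total function together with the set on which
   it is meaningful; its values elsewhere are never used. *)

Definition is_metric (R : realType) (T : Type) (d : T -> T -> R) : Prop :=
  [/\ forall x y, 0 <= d x y,
      forall x y, d x y = 0 <-> x = y,
      forall x y, d x y = d y x &
      forall x y z, d x z <= d x y + d y z].

Definition induces_topology (R : realType) (T : topologicalType)
    (d : T -> T -> R) : Prop :=
  forall (x : T) (A : set T),
    nbhs x A <-> exists2 e : R, 0 < e & [set y | d x y < e] `<=` A.

Definition metrizable (R : realType) (T : topologicalType) : Prop :=
  exists d : T -> T -> R, is_metric d /\ induces_topology d.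

Definition neighbourhood (R : realType) (T : Type) (d : T -> T -> R) (e : R)
    (A : set T) : set T :=
  [set x | exists2 y, A y & d x y < e].

Definition precompact_in (T : topologicalType) (A B : set T) : Prop :=
  compact (closure A) /\ closure A `<=` B.

(* f restricts to a homeomorphism from A onto its image f @` A. *)
Definition homeo_onto_image (T S : topologicalType) (A : set T) (f : T -> S)
    : Prop :=
  [/\ forall x y, A x -> A y -> f x = f y -> x = y,
      {within A, continuous f} &
      forall O, open O ->
        exists2 O', open O' & f @` (A `&` O) = (f @` A) `&` O'].

Definition is_norm (R : realType) (E : vectType R) (n : E -> R) : Prop :=
  [/\ forall e, n e = 0 -> e = 0,
      forall a e, n (a *: e) = `|a| * n e &
      forall e f, n (e + f) <= n e + n f].

Section QuotientSpace.
Context (T : topologicalType) (r : T -> T -> Prop).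

Definition generated_rel : rel T :=
  fun x y => `[< clos_refl_sym_trans T r x y >].

Lemma generated_rel_refl : reflexive generated_rel.
Proof. by move=> x; apply/asboolP; exact: rst_refl. Qed.

Lemma generated_rel_sym : symmetric generated_rel.
Proof. by move=> x y; apply/asboolP/asboolP; exact: rst_sym. Qed.

Lemma generated_rel_trans : transitive generated_rel.
Proof.
move=> y x z /asboolP xy /asboolP yz; apply/asboolP; exact: rst_trans xy yz.
Qed.

Definition generated_equiv :=
  EquivRel generated_rel generated_rel_refl generated_rel_sym
    generated_rel_trans.

Definition quotient_space : topologicalType :=
  quotient_topology {eq_quot generated_equiv}%qT.

Definition quotient_proj : T -> quotient_space :=
  (\pi_{eq_quot generated_equiv})%qT.

End QuotientSpace.

Section Smooth.
Context (R : realType).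

(* C^k regularity on an open set A. *)
Fixpoint Ck_on (k m n : nat) (A : set 'rV[R]_m) (f : 'rV[R]_m -> 'rV[R]_n)
    : Prop :=
  match k with
  | 0 => forall x, A x -> {for x, continuous f}
  | k'.+1 => (forall x, A x -> differentiable f x) /\
             (forall v, Ck_on k' A (fun x => 'd f x v))
  end.

Definition smooth_on (m n : nat) (A : set 'rV[R]_m)
    (f : 'rV[R]_m -> 'rV[R]_n) : Prop :=
  forall k, Ck_on k A f.

(* A smooth atlas is given as a family of charts indexed by the points of the
   manifold, the chart at x having x in its domain; [mchartV x] is the inverse
   of [mchart x] on [mchart x @` mdom x]. The tangent space at x is identified
   with R^n by the chart at x. *)
Record manifold : Type := Manifold {
  mcarrier :> topologicalType;
  mdim : nat;
  mdom : mcarrier -> set mcarrier;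
  mchart : mcarrier -> mcarrier -> 'rV[R]_mdim;
  mchartV : mcarrier -> 'rV[R]_mdim -> mcarrier;
  m_hausdorff : hausdorff_space mcarrier;
  m_second_countable : @second_countable mcarrier;
  mdom_open : forall x, open (mdom x);
  mdom_mem : forall x, mdom x x;
  mimage_open : forall x, open (mchart x @` mdom x);
  mchartK : forall x y, mdom x y -> mchartV x (mchart x y) = y;
  mchart_continuous : forall x, {within mdom x, continuous (mchart x)};
  mchartV_continuous :
    forall x, {within mchart x @` mdom x, continuous (mchartV x)};
  mtransition_smooth : forall x y,
    smooth_on (mchart x @` (mdom x `&` mdom y)) (mchart y \o mchartV x) }.

(* The representative, in the charts at x and f x, of a map of manifolds, and
   its differential T_x M -> T_(f x) N. *)
Definition local_rep (M N : manifold) (f : M -> N) (x : M)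
    : 'rV[R]_(mdim M) -> 'rV[R]_(mdim N) :=
  mchart (f x) \o f \o mchartV x.

Definition tangent_map (M N : manifold) (f : M -> N) (x : M)
    : 'Hom('rV[R]_(mdim M), 'rV[R]_(mdim N)) :=
  linfun ('d (local_rep f x) (mchart x x)).

(* A is meant to be open. *)
Definition smooth_map (M N : manifold) (A : set M) (f : M -> N) : Prop :=
  forall x, A x -> {for x, continuous f} /\
    exists B, [/\ open B, B (mchart x x), B `<=` mchart x @` mdom x &
                  smooth_on B (local_rep f x)].

(* The same for maps with values in a finite-dimensional vector space E, which
   is identified with R^(dim E) by the coordinates [v2r]. *)
Definition local_vrep (M : manifold) (E : vectType R) (f : M -> E) (x : M) :=
  v2r \o f \o mchartV x.

Definition vdiff (M : manifold) (E : vectType R) (f : M -> E) (x : M)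
    : 'Hom('rV[R]_(mdim M), E) :=
  linfun (r2v \o 'd (local_vrep f x) (mchart x x)).

Definition smooth_vmap (M : manifold) (E : vectType R) (A : set M) (f : M -> E)
    : Prop :=
  forall x, A x ->
    exists B, [/\ open B, B (mchart x x), B `<=` mchart x @` mdom x &
                  smooth_on B (local_vrep f x)].

Definition smooth_embedding (M N : manifold) (A : set M) (f : M -> N) : Prop :=
  [/\ smooth_map A f,
      forall x, A x -> lker (tangent_map f x) = 0%VS &
      homeo_onto_image A f].

Definition transverse_to_zero (M : manifold) (E : vectType R) (A : set M)
    (f : M -> E) : Prop :=
  forall x, A x -> f x = 0 -> limg (vdiff f x) = fullv.

Definition zero_set (T : Type) (E : vectType R) (s : T -> E) : set T :=
  [set x | s x = 0].

Record kchart (X : topologicalType) : Type := KChart {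
  kU : manifold;
  kE : vectType R;
  ks : kU -> kE;
  kpsi : kU -> X;
  ks_smooth : smooth_vmap setT ks;
  kpsi_homeo : homeo_onto_image (zero_set ks) kpsi;
  kfootprint_open : open (kpsi @` zero_set ks);
  kfootprint_neq0 : (kpsi @` zero_set ks) !=set0 }.

Definition footprint (X : topologicalType) (K : kchart X) : set X :=
  @kpsi X K @` zero_set (@ks X K).

Definition is_direct_sum (E : vectType R) (A B : {vspace E}) : Prop :=
  (A + B)%VS = fullv /\ (A :&: B)%VS = 0%VS.

Definition is_coordinate_change (X : topologicalType) (KI KJ : kchart X)
    (D : set (kU KI)) (phi : kU KI -> kU KJ) (phihat : 'Hom(kE KI, kE KJ))
    : Prop :=
  [/\ open D,
      D `&` zero_set (@ks _ KI) =
        zero_set (@ks _ KI) `&`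
          @kpsi _ KI @^-1` (footprint KI `&` footprint KJ),
      smooth_embedding D phi &
      lker phihat = 0%VS] /\
  [/\ forall u, D u -> ks (phi u) = phihat (ks u),
      (* phi = psi_J^-1 o psi_I on the zero set *)
      forall u, D u -> ks u = 0 -> kpsi (phi u) = kpsi u,
      forall u, D u ->
        (tangent_map phi u @: lker (vdiff (@ks _ KI) u))%VS =
        lker (vdiff (@ks _ KJ) (phi u)) &
      forall u, D u -> forall C : {vspace kE KI},
        is_direct_sum (limg (vdiff (@ks _ KI) u)) C ->
        is_direct_sum (limg (vdiff (@ks _ KJ) (phi u))) (phihat @: C)%VS].

End Smooth.

Arguments ks {R X k}.
Arguments kpsi {R X k}.

(* The index set of the atlas: nonempty I in {1..N} such that the footprints
   F i, i in I, have a common point. *)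
Definition indices (X : Type) (N : nat) (F : 'I_N -> set X) : Type :=
  {I : {set 'I_N} |
    (0 < #|I|)%N && `[< exists p, forall i, i \in I -> F i p >]}.

HB.instance Definition _ (X : Type) (N : nat) (F : 'I_N -> set X) :=
  Finite.on (indices F).

Section Singleton.
Context (X : Type) (N : nat) (F : 'I_N -> set X) (F0 : forall i, F i !=set0).

Lemma singleton_indices (i : 'I_N) :
  (0 < #|[set i]%SET|)%N &&
    `[< exists p, forall j, j \in [set i]%SET -> F j p >].
Proof.
rewrite cards1 /=; apply/asboolP; have [p Fp] := F0 i.
by exists p => j; rewrite inE => /eqP ->.
Qed.

Definition singleton_index (i : 'I_N) : indices F :=
  exist _ [set i]%SET (singleton_indices i).

End Singleton.

(* The basic charts are the charts with singleton index, and [aF i] is the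
   footprint of the i-th one. The fields aU, aphi, aphihat are meaningful
   only for I \subset J. *)
Unset Implicit Arguments.

Record atlas (R : realType) (X : topologicalType) : Type := Atlas {
  aN : nat;
  aF : 'I_aN -> set X;
  aF_neq0 : forall i, aF i !=set0;
  aF_cover : forall p, exists i, aF i p;
  adim : int;
  achart : indices aF -> kchart R X;
  achart_footprint : forall I,
    footprint (achart I) = [set p | forall i, i \in val I -> aF i p];
  achart_dim : forall I,
    (mdim (kU (achart I)))%:Z - (\dim (@fullv _ (kE (achart I))))%:Z = adim;
  aU : forall I J : indices aF, set (kU (achart I));
  aphi : forall I J : indices aF, kU (achart I) -> kU (achart J);
  aphihat : forall I J : indices aF, 'Hom(kE (achart I), kE (achart J));
  aU_id : forall I, aU I I = setT;
  aphi_id : forall I x, aphi I I x = x;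
  aphihat_id : forall I e, aphihat I I e = e;
  a_change : forall I J : indices aF, val I \proper val J ->
    is_coordinate_change (aU I J) (aphi I J) (aphihat I J);
  a_cocycle : forall I J L : indices aF,
    val I \proper val J -> val J \proper val L ->
    [/\ forall e, aphihat J L (aphihat I J e) = aphihat I L e,
        aU I J `&` aphi I J @^-1` aU J L `<=` aU I L &
        forall x, aU I J x -> aU J L (aphi I J x) ->
          aphi J L (aphi I J x) = aphi I L x] }.

Arguments aN {R X}.
Arguments aF {R X}.
Arguments aF_neq0 {R X}.
Arguments achart {R X}.
Arguments aU {R X}.
Arguments aphi {R X}.
Arguments aphihat {R X}.

Section Atlas.
Context (R : realType) (X : topologicalType) (K : atlas R X).

Definition aidx : finType := indices (aF K).
Definition dom (I : aidx) : manifold R := kU (achart K I).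
Definition obs (I : aidx) : vectType R := kE (achart K I).
Definition sec (I : aidx) : dom I -> obs I := @ks _ _ (achart K I).
Definition single (i : 'I_(aN K)) : aidx := singleton_index (aF_neq0 K) i.

Definition idx_sub (I J : aidx) : bool := val I \subset val J.
Definition idx_psub (I J : aidx) : bool := val I \proper val J.
Definition size_idx (I : aidx) : nat := #|val I|.

(* The map \prod_(i in I) E_i -> E_I. *)
Definition sum_map (I : aidx)
    (e : forall i : {i : 'I_(aN K) | i \in val I}, obs (single (val i)))
    : obs I :=
  \sum_(i : {i : 'I_(aN K) | i \in val I}) aphihat K (single (val i)) I (e i).

Definition additive_atlas : Prop := forall I, bijective (sum_map I).

(* U_(I (J \cup L)), which is empty if J \cup L is not an index. *)
Definition aU_union (I J L : aidx) : set (dom I) :=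
  [set x | exists H : aidx, val H = val J :|: val L /\ aU K I H x].

Definition tame : Prop :=
  [/\ additive_atlas,
      forall I J L, idx_sub I J -> idx_sub I L ->
        aU K I J `&` aU K I L = aU_union I J L &
      forall I J L, idx_sub I J -> idx_sub J L ->
        aphi K I J @` aU K I L =
        aU K J L `&` [set y | sec J y \in limg (aphihat K I J)]].

Definition disjoint_union : topologicalType := {I : aidx & dom I}.

Definition step (p q : disjoint_union) : Prop :=
  [/\ idx_psub (projT1 p) (projT1 q),
      aU K (projT1 p) (projT1 q) (projT2 p) &
      aphi K (projT1 p) (projT1 q) (projT2 p) = projT2 q].

Definition realization : topologicalType := quotient_space step.

Definition piK (I : aidx) (x : dom I) : realization :=
  quotient_proj step (existT dom I x).

(* The graph of the map iota_K : X -> |K|. *)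
Definition iotaK (p : X) (q : realization) : Prop :=
  exists (I : aidx) (x : dom I), [/\ sec I x = 0, kpsi x = p & piK I x = q].

Definition pull (d : realization -> realization -> R) (I : aidx)
    (x y : dom I) : R :=
  d (piK I x) (piK I y).

Definition admissible_metric (d : realization -> realization -> R) : Prop :=
  [/\ is_metric d,
      exists M : R, forall p q, d p q <= M &
      forall I, is_metric (pull d I) /\ induces_topology (pull d I)].

Definition chart_sets : Type := forall I : aidx, set (dom I).

Definition pi_family (V : chart_sets) : set realization :=
  [set q | exists I, exists2 x, V I x & piK I x = q].

Definition reduction (V : chart_sets) : Prop :=
  [/\ forall I, open (V I) /\ precompact_in (V I) setT,
      forall I, V I !=set0 -> (V I `&` zero_set (sec I)) !=set0,
      forall I J,
        ((piK I @` closure (V I)) `&` (piK J @` closure (V J))) !=set0 ->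
        idx_sub I J || idx_sub J I &
      [set q | exists p, iotaK p q] `<=` pi_family V].

Definition nested_reduction (C V : chart_sets) : Prop :=
  [/\ reduction C, reduction V & forall I, precompact_in (C I) (V I)].

Definition section_family : Type := forall I : aidx, dom I -> obs I.

Definition is_perturbation (V : chart_sets) (nu : section_family) : Prop :=
  (forall I, smooth_vmap (V I) (nu I)) /\
  (forall I J, idx_psub I J -> forall x, V I x -> aU K I J x ->
     V J (aphi K I J x) -> nu J (aphi K I J x) = aphihat K I J (nu I x)).

Definition admissible (V : chart_sets) (nu : section_family) : Prop :=
  forall I J, idx_psub I J -> forall y,
    (V J `&` aphi K I J @` (V I `&` aU K I J)) y ->
    (limg (vdiff (nu J) y) <= limg (aphihat K I J))%VS.

Definition perturbed (nu : section_family) (I : aidx) (x : dom I) : obs I :=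
  sec I x + nu I x.

Definition transverse (V : chart_sets) (nu : section_family) : Prop :=
  forall I, transverse_to_zero (V I) (perturbed nu I).

Definition perturbed_zeros (V : chart_sets) (nu : section_family)
    : chart_sets :=
  fun I => V I `&` zero_set (perturbed nu I).

Definition precompact_perturbation (V : chart_sets) (nu : section_family)
    : Prop :=
  exists C' : chart_sets, nested_reduction C' V /\
    pi_family (perturbed_zeros V nu) `<=` pi_family C'.

(* The disjoint union of the zero sets, with the subspace topology, and its
   quotient |Z^nu| by the relation generated inside it. *)
Definition zeros_union (V : chart_sets) (nu : section_family)
    : topologicalType :=
  set_type
    [set p : disjoint_union | perturbed_zeros V nu (projT1 p) (projT2 p)].

Definition perturbed_zero_space (V : chart_sets) (nu : section_family)
    : topologicalType :=
  @quotient_space (zeros_union V nu) (fun p q => step (set_val p) (set_val q)).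

(* Norms on the E_i, together with their extensions to the E_I. *)
Definition additive_norms (nrm : forall I, obs I -> R) : Prop :=
  (forall i, is_norm (nrm (single i))) /\
  (forall (I : aidx) (e : forall i : {i : 'I_(aN K) | i \in val I},
                   obs (single (val i))),
     nrm I (sum_map I e) =
     \big[Num.max/0]_(i : {i : 'I_(aN K) | i \in val I})
       nrm (single (val i)) (e i)).

Section Adapted.
Context (d : realization -> realization -> R) (V C : chart_sets)
  (nrm : forall I, obs I -> R).

Definition nbhdU (I : aidx) (e : R) (A : set (dom I)) : set (dom I) :=
  neighbourhood (pull d I) e A.

Definition delta_condition (e : R) : Prop :=
  (forall I, precompact_in (nbhdU I (2 * e) (V I)) setT) /\
  (forall I J,
     (neighbourhood d (2 * e) (piK I @` V I) `&`
      neighbourhood d (2 * e) (piK J @` V J)) !=set0 ->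
     idx_sub I J || idx_sub J I).

(* The supremum is attained, so this is the maximal such constant. *)
Definition delta_max : R :=
  sup [set c : R | 0 < c <= 4^-1 /\
                   forall e, 0 < e < c -> delta_condition e].

Context (delta : R).

Definition Vk (k : R) (I : aidx) : set (dom I) :=
  nbhdU I (2 `^ (- k) * delta) (V I).

(* N^k_(JI), for I \subset J; the indices are in the order (I, J). *)
Definition Nk (k : R) (I J : aidx) : set (dom J) :=
  Vk k J `&` aphi K I J @` (Vk k I `&` aU K I J).

Definition eta (k : R) : R := 2 `^ (- k) * (1 - 2 `^ (- 4^-1)) * delta.

Definition Ctilde (J : aidx) : set (dom J) :=
  [set x | exists L, [/\ idx_sub J L, aU K J L x & C L (aphi K J L x)]].

Definition sigma_max : \bar R :=
  \big[Order.min/+oo%E]_(J : aidx)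
    ereal_inf [set (nrm J (sec J x))%:E | x in
      closure (Vk (size_idx J)%:R J) `\`
      (Ctilde J `|`
       [set x | exists2 I, idx_psub I J &
          nbhdU J (eta ((size_idx J)%:R - 2^-1))
                (Nk ((size_idx J)%:R - 4^-1) I J) x])].

Definition adapted (sigma : R) (nu : section_family) : Prop :=
  exists mu : section_family,
  [/\ forall I, smooth_vmap (Vk (size_idx I)%:R I) (mu I),
      forall I x, V I x -> mu I x = nu I x &
      forall k, (1 <= k <= \max_(I : aidx) size_idx I)%N ->
      forall I, (size_idx I <= k)%N ->
      [/\ forall H, idx_psub H I -> forall x, Vk k%:R H x -> aU K H I x ->
            Vk k%:R I (aphi K H I x) ->
            mu I (aphi K H I x) = aphihat K H I (mu H x),
          transverse_to_zero (Vk k%:R I) (perturbed mu I),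
          (* [mu I] is only meaningful on V_I^|I| *)
          forall H, idx_psub H I -> forall x, Vk (size_idx I)%:R I x ->
            nbhdU I (eta k%:R) (Nk k%:R H I) x ->
            mu I x \in limg (aphihat K H I),
          forall x, Vk k%:R I x -> perturbed mu I x = 0 ->
            pi_family C (piK I x) &
          (ereal_sup [set (nrm I (mu I x))%:E | x in Vk k%:R I] < sigma%:E)%E]].

End Adapted.
End Atlas.

Arguments aidx {R X}.
Arguments dom {R X}.
Arguments obs {R X}.
Arguments tame {R X}.
Arguments realization {R X}.
Arguments chart_sets {R X}.
Arguments section_family {R X}.
Arguments admissible_metric {R X K}.
Arguments pi_family {R X K}.
Arguments reduction {R X K}.
Arguments nested_reduction {R X K}.
Arguments is_perturbation {R X K}.
Arguments admissible {R X K}.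
Arguments transverse {R X K}.
Arguments perturbed_zeros {R X K}.
Arguments precompact_perturbation {R X K}.
Arguments perturbed_zero_space {R X K}.
Arguments additive_norms {R X K}.
Arguments delta_max {R X K}.
Arguments sigma_max {R X K}.
Arguments adapted {R X K}.

(* Main.v *)
From HB Require Import structures.
From Stdlib Require Import Relation_Operators.
Require Import Defs.
From mathcomp Require Import all_boot all_order all_algebra.
From mathcomp Require Import all_classical all_reals all_analysis.
From mathcomp Require Import generic_quotient ring lra.

Set Implicit Arguments.
Unset Strict Implicit.
Unset Printing Implicit Defensive.

Import Order.TTheory GRing.Theory Num.Theory.
Import numFieldNormedType.Exports VectorInternalTheory.

Local Open Scope classical_set_scope.
Local Open Scope ring_scope.

(* The sections mu_J are constructed by induction on |J|, each on V_J^|J|. For a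
   given J, the sections constructed before prescribe mu_J on the images of the
   maps phi_IJ, and ask it to take values in E_I near these images. These
   conditions and the bound on the norm are convex in the value of mu_J at a
   point, so that local solutions can be glued by a partition of unity. At a
   point in the closure of some image, phihat_IJ o mu_I o r is a local solution,
   where I is the largest index whose image comes close to the point and r is a
   smooth local left inverse of phi_IJ.
   Where mu_J is asked to take values in E_I, a zero of s_J + mu_J is the image
   of a zero of s_I + mu_I, and is regular by the index condition. By the choice
   of sigma, all other zeros lie in the open set Ctilde_J, where a small
   perturbation makes the section transverse.
   This perturbation is found without Sard's theorem: the affine maps
   x |-> p + x P for which f + p + x P has a degenerate zero form a Lipschitz
   image of a space of lower dimension than that of the pairs (p, P). *)

(** * Differentiable maps between Euclidean spaces *)

(** The difficulty in the inductive step is loss of room. Gluing takes place over the closure of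
    V_J^|J|, so the conditions on mu_J must be met near every point of that closure, on sets larger
    than those required in the end, and the sections of smaller index must be known on larger sets
    still. They are known at level |J|-1; the levels |J|-1/2 and |J|-1/4 lie in between for this
    reason. Taking the largest index works because the condition on delta makes indices comparable
    as soon as their sets come close to a common point: every prescription near that point then
    factors through the largest index, or is implied by it. The perturbation for transversality must
    not spoil the prescribed values. Two collars around the images serve for this: the glued section
    has only regular zeros in the larger one, and the perturbation vanishes on the closure of the
    smaller one. Distances are measured in |K|, across charts. This is effective because tameness
    reduces equality in |K| of points with comparable indices to a single map phi_IJ. *)

Section Calculus.
Context (R : realType).
Implicit Types U V W : normedModType R.

Lemma diff_near_le V W (f : V -> W) (x : V) (e : R) :
  differentiable f x -> 0 < e ->
  \forall y \near x, `|f y - f x - 'd f x (y - x)| <= e * `|y - x|.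
Proof.
move=> df e0.
have /eqaddoP/(_ e e0) := diff_locally df.
rewrite /= [X in X -> _]near_simpl => H.
rewrite (near_shift 0 x) /=.
apply: filterS H => h /=.
rewrite subr0 addrK.
by rewrite -[X in `|X|]/(f (h + x) - (f x + 'd f x h)) opprD addrA.
Qed.

Lemma diff_from_le V W (f : V -> W) (L : {linear V -> W}) (x : V) :
  continuous L ->
  (forall e : R, 0 < e ->
    \forall y \near x, `|f y - f x - L (y - x)| <= e * `|y - x|) ->
  is_diff x f L.
Proof.
move=> Lc H.
have E : f \o shift x = cst (f x) + L +o_ 0 id.
  apply/eqaddoP => e e0; rewrite /= near_simpl.
  have := H e e0; rewrite (near_shift 0 x) /=.
  apply: filterS => h /=; rewrite subr0 addrK.
  by rewrite -[X in _ -> `|X| <= _]/(f (h + x) - (f x + L h)) opprD addrA.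
have LE := diff_unique Lc E.
apply: DiffDef => //.
by apply/diff_locallyP; rewrite LE.
Qed.

Lemma is_diff_near_eq V W (f g : V -> W) (x : V) :
  (\forall y \near x, f y = g y) -> differentiable f x ->
  differentiable g x /\ 'd g x = 'd f x :> (V -> W).
Proof.
move=> fg df.
have H : is_diff x g ('d f x).
  apply: diff_from_le => [|e e0]; first exact: diff_continuous.

  near=> y.
  have <- : f y = g y by near: y.
  have <- : f x = g x by apply: nbhs_singleton fg.
  by near: y; exact: diff_near_le.
by case: H.
Unshelve. all: by end_near. Qed.

End Calculus.

Section CK.
Context (R : realType).
Implicit Types U V W : normedModType R.

Section Def.
Context (V W : normedModType R).

(* [Ck_on] for maps between arbitrary normed modules, in particular for scalar and
   matrix-valued maps. *)
Fixpoint CK (k : nat) (A : set V) (f : V -> W) : Prop :=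
  match k with
  | 0 => forall x, A x -> {for x, continuous f}
  | k'.+1 => (forall x, A x -> differentiable f x) /\
             (forall v, CK k' A (fun x => 'd f x v))
  end.

End Def.

Lemma Ck_onE (m n k : nat) (A : set 'rV[R]_m) (f : 'rV[R]_m -> 'rV[R]_n) :
  Ck_on k A f = CK k A f.
Proof.
elim: k f => [//|k IH] f /=; congr (_ /\ _).
by apply/propext; split => H v; have := H v; rewrite IH.
Qed.

Lemma CK_subset V W k (A B : set V) (f : V -> W) :
  B `<=` A -> CK k A f -> CK k B f.
Proof.
move=> BA; elim: k f => [|k IH] f /=; first by move=> H x /BA /H.
by move=> [df H]; split => [x /BA /df|v]//; exact/IH.
Qed.

Lemma CK_continuous V W k (A : set V) (f : V -> W) :
  CK k A f -> forall x, A x -> {for x, continuous f}.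
Proof.
case: k => [//|k] [df _] x Ax; exact/differentiable_continuous/df.
Qed.

Lemma CK_pred V W k (A : set V) (f : V -> W) : CK k.+1 A f -> CK k A f.
Proof.
elim: k f => [|k IH] f; first by move=> H x; exact: CK_continuous H x.
by move=> [df H]; split => // v; exact/IH/H.
Qed.

(** At every order [CK] is a condition on the points of the set one by one, so that arbitrary
    unions, not only of open sets, are allowed. With singletons this turns smoothness near each
    point of a set into smoothness on the set. *)
Lemma CK_bigcup V W I k (A : I -> set V) (f : V -> W) :
  (forall i, CK k (A i) f) -> CK k [set x | exists i, A i x] f.
Proof.
elim: k f => [|k IH] f /= H; first by move=> x [i Ai]; exact: H Ai.
split => [x [i Ai]|v]; first exact: (H i).1.
by apply: IH => i; exact: (H i).2.
Qed.

Lemma CK_ext V W k (A : set V) (f g : V -> W) :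
  open A -> {in A, f =1 g} -> CK k A f -> CK k A g.
Proof.
move=> oA; have near_A x (h l : V -> W) : {in A, h =1 l} -> A x ->
    \forall y \near x, h y = l y.
  move=> hl Ax; have := open_nbhs_nbhs (conj oA Ax).
  by apply: filterS => y Ay; exact/hl/mem_set.
elim: k f g => [|k IH] f g fg /=.
  move=> fc x Ax; have := near_A x f g fg Ax => fgx.
  have := fc x Ax; rewrite /prop_for /continuous_at (nbhs_singleton fgx) => H.
  by apply: cvg_trans H; apply: near_eq_cvg; exact: filterS fgx.
move=> [df H]; split=> [x Ax|v].
  exact: (is_diff_near_eq (near_A x f g fg Ax) (df x Ax)).1.
apply: IH (H v) => x /set_mem Ax.
by rewrite (is_diff_near_eq (near_A x f g fg Ax) (df x Ax)).2.
Qed.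

Lemma CK_cst V W k (A : set V) (w : W) : CK k A (cst w).
Proof.
elim: k w => [|k IH] w /=; first by move=> x _; exact: cst_continuous.
split=> [x _|v]; first exact: differentiable_cst.
have -> : (fun x => 'd (cst w) x v) = cst (0 : W); last exact: IH.
by apply/funext => x; rewrite diff_cst.
Qed.

Lemma CK_lin V W k (A : set V) (L : {linear V -> W}) :
  continuous L -> CK k A L.
Proof.
move=> Lc; case: k => [|k] /=; first by move=> x _; exact: Lc.
split=> [x _|v]; first exact: linear_differentiable.
have -> : (fun x => 'd L x v) = cst (L v) by apply/funext => x; rewrite diff_lin.
exact: CK_cst.
Qed.

Lemma CK_id V k (A : set V) : CK k A (@idfun V).
Proof. by apply: CK_lin => x; exact: id. Qed.

Lemma CK_linl U V W k (A : set U) (f : U -> V) (L : {linear V -> W}) :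
  open A -> continuous L -> CK k A f -> CK k A (L \o f).
Proof.
move=> oA Lc; elim: k f => [|k IH] f /=.
  by move=> fc x Ax; apply: continuous_comp; [exact: fc|exact: Lc].
have dL y : differentiable L y by exact: linear_differentiable.
move=> [df H]; split=> [x Ax|v].
  by apply: differentiable_comp => //; exact: df.
apply: (@CK_ext _ _ _ _ (L \o (fun x => 'd f x v))) (IH _ (H v)) => //.
move=> x /set_mem Ax /=; rewrite (@diff_comp _ _ _ _ f L x) //=; last exact: df.
by rewrite diff_lin.
Qed.

Lemma CK_add V W k (A : set V) (f g : V -> W) :
  open A -> CK k A f -> CK k A g -> CK k A (fun x => f x + g x).
Proof.
move=> oA; elim: k f g => [|k IH] f g /=.
  by move=> fc gc x Ax; apply: continuousD; [exact: fc|exact: gc].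
move=> [df Hf] [dg Hg]; split=> [x Ax|v].
  by apply: (@differentiableD _ _ _ f g); [exact: df|exact: dg].
apply: (@CK_ext _ _ _ _ (fun x => 'd f x v + 'd g x v)) => //; last exact: IH.
move=> x /set_mem Ax /=.
by rewrite (@diffD _ _ _ f g)//; [exact: df|exact: dg].
Qed.

Lemma scale_bilinear W :
  bilinear_for
    (GRing.Scale.Law.clone _ _ *:%R _) (GRing.Scale.Law.clone _ _ *:%R _)
    (fun (a : R) (w : W) => a *: w).
Proof.
split=> [w|a] b x y /=; first by rewrite scalerDl scalerA.
by rewrite scalerDr !scalerA mulrC.
Qed.

Lemma is_diff_scale V W (c : V -> R) (f : V -> W) x :
  differentiable c x -> differentiable f x ->
  is_diff x (fun y => c y *: f y) (fun v => c x *: 'd f x v + 'd c x v *: f x).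
Proof.
move=> dc df.
pose bil := bilinear_isBilinear.Build R R W W _ _ _ (scale_bilinear W).
pose B : {bilinear R -> W -> W} := HB.pack (fun (a : R) (w : W) => a *: w) bil.
have Bc : continuous (fun p : R * W => B p.1 p.2).
  by move=> p; exact: scale_continuous.
have dcf : differentiable (fun y => (c y, f y)) x by exact: differentiable_pair.
have dB : differentiable (fun p : R * W => B p.1 p.2) (c x, f x).
  exact: differentiable_bilin.
apply: DiffDef.
  exact: (@differentiable_comp _ _ _ _ (fun y => (c y, f y))
           (fun p : R * W => B p.1 p.2)).
rewrite -[fun y => c y *: f y]/((fun p : R * W => B p.1 p.2) \o
  (fun y => (c y, f y))) diff_comp// diff_bilin// diff_pair//.
Qed.

Lemma CK_scale V W k (A : set V) (c : V -> R) (f : V -> W) :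
  open A -> CK k A c -> CK k A f -> CK k A (fun x => c x *: f x).
Proof.
move=> oA; elim: k c f => [|k IH] c f.
  by move=> cc fc x Ax; apply: continuousZ; [exact: cc|exact: fc].
move=> Ac Af; have [[dc Hc] [df Hf]] := (Ac, Af).
split=> [x Ax|v]; first by have [] := is_diff_scale (dc x Ax) (df x Ax).
apply: (@CK_ext _ _ _ _ (fun x => c x *: 'd f x v + 'd c x v *: f x)) => //.
  move=> x /set_mem Ax; have [_ ->//] := is_diff_scale (dc x Ax) (df x Ax).
apply: CK_add => //; first exact: IH (CK_pred Ac) (Hf v).
exact: IH (Hc v) (CK_pred Af).
Qed.

Lemma CK_sum V W k (A : set V) (I : Type) (r : seq I) (P : pred I)
    (F : I -> V -> W) :
  open A -> (forall i, P i -> CK k A (F i)) ->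
  CK k A (fun x => \sum_(i <- r | P i) F i x).
Proof.
move=> oA HF; elim: r => [|i r IH].
  rewrite (_ : (fun _ => _) = cst 0); first exact: CK_cst.
  by apply/funext => x; rewrite big_nil.
case: (boolP (P i)) => Pi; last first.
  rewrite (_ : (fun _ => _) = fun x => \sum_(i <- r | P i) F i x)//.
  by apply/funext => x; rewrite big_cons (negbTE Pi).
rewrite (_ : (fun _ => _) = fun x => F i x + \sum_(i <- r | P i) F i x).
  by apply: CK_add => //; exact: HF.
by apply/funext => x; rewrite big_cons Pi.
Qed.

Lemma CK_opp V W k (A : set V) (f : V -> W) :
  open A -> CK k A f -> CK k A (fun x => - f x).
Proof.
move=> oA Af; rewrite (_ : (fun _ => _) = fun x => cst (-1 : R) x *: f x).
  by apply: CK_scale => //; exact: CK_cst.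
by apply/funext => x; rewrite scaleN1r.
Qed.

Lemma CK_prod V k (A : set V) (I : Type) (r : seq I) (P : pred I)
    (F : I -> V -> R) :
  open A -> (forall i, P i -> CK k A (F i)) ->
  CK k A (fun x => \prod_(i <- r | P i) F i x).
Proof.
move=> oA HF; elim: r => [|i r IH].
  rewrite (_ : (fun _ => _) = cst 1); first exact: CK_cst.
  by apply/funext => x; rewrite big_nil.
case: (boolP (P i)) => Pi; last first.
  rewrite (_ : (fun _ => _) = fun x => \prod_(i <- r | P i) F i x)//.
  by apply/funext => x; rewrite big_cons (negbTE Pi).
rewrite (_ : (fun _ => _) = fun x => F i x *: \prod_(i <- r | P i) F i x).
  by apply: CK_scale => //; exact: HF.
by apply/funext => x; rewrite big_cons Pi.
Qed.

(** [CK] differentiates in fixed directions, whereas the chain rule applies ['d g (f x)] to the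
    moving vector ['d f x v]. Expanding that vector in a finite basis leaves products of scalar
    functions with ['d g (f x) (e i)], compositions to which the induction applies. *)
Lemma CK_comp_basis U V W k n (e : 'I_n -> V) (c : 'I_n -> {linear V -> R})
    (A : set U) (B : set V) (f : U -> V) (g : V -> W) :
  (forall i, continuous (c i)) -> (forall v, v = \sum_i c i v *: e i) ->
  open A -> open B -> (forall x, A x -> B (f x)) ->
  CK k A f -> CK k B g -> CK k A (g \o f).
Proof.
move=> cc ce oA oB AB; elim: k f AB g => [|k IH] f AB g.
  by move=> fc gc x Ax; apply: continuous_comp; [exact: fc|exact/gc/AB].
move=> Af Bg; have [[df Hf] [dg Hg]] := (Af, Bg).
split=> [x Ax|v].
  by apply: differentiable_comp; [exact: df|exact/dg/AB].
apply: (@CK_ext _ _ _ _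
    (fun x => \sum_i c i ('d f x v) *: 'd g (f x) (e i))) => //.
  move=> x /set_mem Ax; rewrite (@diff_comp _ _ _ _ f g x) /=.
  - rewrite {2}(ce ('d f x v)) linear_sum; apply: eq_bigr => i _.
    by rewrite linearZ.
  - exact: df.
  - exact/dg/AB.
apply: CK_sum => // i _; apply: CK_scale => //.
  exact: (CK_linl oA (cc i) (Hf v)).
by apply: IH (Hg (e i)) => //; exact: CK_pred.
Qed.

Lemma CK_comp_rV m U W k (A : set U) (B : set 'rV[R]_m) (f : U -> 'rV[R]_m)
    (g : 'rV[R]_m -> W) :
  open A -> open B -> (forall x, A x -> B (f x)) ->
  CK k A f -> CK k B g -> CK k A (g \o f).
Proof.
have lc i : linear (fun v : 'rV[R]_m => v 0 i : R^o).
  by move=> a x y; rewrite !mxE.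
pose ci i : {linear 'rV[R]_m -> R} :=
  HB.pack (fun v : 'rV[R]_m => v 0 i : R) (GRing.isLinear.Build _ _ _ _ _ (lc i)).
apply: (@CK_comp_basis _ _ _ _ m (fun i => delta_mx 0 i) ci).
  by move=> i; exact: coord_continuous.
by move=> v; rewrite {1}(row_sum_delta v).
Qed.

Lemma CK_comp_R U W k (A : set U) (B : set R) (f : U -> R) (g : R -> W) :
  open A -> open B -> (forall x, A x -> B (f x)) ->
  CK k A f -> CK k B g -> CK k A (g \o f).
Proof.
apply: (@CK_comp_basis _ R _ _ 1 (fun=> 1) (fun=> idfun)).
  by move=> i x; exact: cvg_id.
by move=> v; rewrite big_ord1 /= [RHS]mulr1.
Qed.

Lemma CK_mul V k (A : set V) (f g : V -> R) :
  open A -> CK k A f -> CK k A g -> CK k A (fun x => f x * g x).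
Proof. by move=> oA; exact: (@CK_scale V R). Qed.

Lemma CK_inv V k (A : set V) (f : V -> R) :
  open A -> (forall x, A x -> f x != 0) -> CK k A f ->
  CK k A (fun x => (f x)^-1).
Proof.
move=> oA; elim: k f => [|k IH] f f0.
  by move=> fc x Ax; apply: continuousV; [exact: f0|exact: fc].
move=> Af; have [df H] := Af; split=> [x Ax|v].
  by apply: differentiableV; [exact: df|exact: f0].
apply: (@CK_ext _ _ _ _ (fun x => - ((f x)^-1 * (f x)^-1) * 'd f x v)) => //.
  move=> x /set_mem Ax; rewrite diffV ?f0//; last exact: df.
  by rewrite /= expr2 invfM.
apply: CK_mul (H v) => //; apply: CK_opp => //.
by apply: CK_mul => //; apply: IH => //; exact: CK_pred.
Qed.

Lemma CK_matrix V m n k (A : set V) (f : V -> 'M[R]_(m, n)) :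
  open A -> (forall i j, CK k A (fun x => f x i j : R)) -> CK k A f.
Proof.
move=> oA H; rewrite (_ : f = fun x => \sum_i \sum_j f x i j *: delta_mx i j).
  apply: CK_sum => // i _; apply: CK_sum => // j _; apply: CK_scale => //.
  exact: CK_cst.
by apply/funext => x; rewrite -matrix_sum_delta.
Qed.

Lemma CK_coord V m n k (A : set V) (f : V -> 'M[R]_(m, n)) i j :
  open A -> CK k A f -> CK k A (fun x => f x i j : R).
Proof.
move=> oA Af.
have lc : linear (fun v : 'M[R]_(m, n) => v i j : R^o).
  by move=> a x y; rewrite !mxE.
pose ci : {linear 'M[R]_(m, n) -> R} :=
  HB.pack (fun v : 'M[R]_(m, n) => v i j : R) (GRing.isLinear.Build _ _ _ _ _ lc).
by apply: (@CK_linl _ _ _ _ _ f ci oA) => //; exact: coord_continuous.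
Qed.

Lemma CK_det V n k (A : set V) (f : V -> 'M[R]_n) :
  open A -> CK k A f -> CK k A (fun x => \det (f x)).
Proof.
move=> oA Af; apply: CK_sum => // s _; apply: CK_mul => //.
  exact: CK_cst.
by apply: CK_prod => // i _; exact: CK_coord.
Qed.

Lemma CK_mulmx V m n p k (A : set V) (f : V -> 'M[R]_(m, n))
    (g : V -> 'M[R]_(n, p)) :
  open A -> CK k A f -> CK k A g -> CK k A (fun x => f x *m g x).
Proof.
move=> oA Af Ag; apply: CK_matrix => // i j.
rewrite (_ : (fun _ => _) = fun x => \sum_k f x i k * g x k j).
  by apply: CK_sum => // l _; apply: CK_mul => //; exact: CK_coord.
by apply/funext => x; rewrite mxE.
Qed.

(** Cramer's formula: the inverse is the adjugate, whose entries are signed minors, divided by the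
    determinant. *)
Lemma CK_invmx V n k (A : set V) (f : V -> 'M[R]_n) :
  open A -> (forall x, A x -> f x \in unitmx) -> CK k A f ->
  CK k A (fun x => invmx (f x)).
Proof.
move=> oA fu Af.
apply: (@CK_ext _ _ _ _ (fun x => (\det (f x))^-1 *: \adj (f x))) => //.
  by move=> x /set_mem Ax; rewrite /invmx (fu x Ax).
apply: CK_scale => //.
  apply: CK_inv; [by []|by move=> x /fu; rewrite unitmxE unitfE|exact: CK_det].
apply: CK_matrix => // i j.
rewrite (_ : (fun _ => _) = fun x => (-1) ^+ (j + i) *
   \det (row' j (col' i (f x)))); last by apply/funext => x; rewrite mxE.
apply: CK_mul => //; first exact: CK_cst.
apply: CK_det => //; apply: CK_matrix => // a b.
rewrite (_ : (fun _ => _) = fun x => f x (lift j a) (lift i b)).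
  exact: CK_coord.
by apply/funext => x; rewrite !mxE.
Qed.

End CK.

(** * Row vectors, Jacobian matrices and the mean value inequality *)

Section RowVectors.
Context (R : realType).

Lemma mx_entry_le m n (A : 'M[R]_(m, n)) i j : `|A i j| <= `|A|.
Proof.
rewrite [leRHS]/Num.Def.normr /= mx_normrE.
exact: (le_bigmax (0 : R) (fun ij : 'I_m * 'I_n => `|A ij.1 ij.2|) (i, j)).
Qed.

Lemma mx_norm_le m n (A : 'M[R]_(m, n)) (c : R) :
  0 <= c -> (forall i j, `|A i j| <= c) -> `|A| <= c.
Proof.
move=> c0 H; rewrite [leLHS]/Num.Def.normr /= mx_normrE.
by apply/bigmax_leP; split => // ij _; exact: H.
Qed.

Lemma rV_linear_le m (W : normedModType R) (L : {linear 'rV[R]_m -> W}) (c : R) :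
  (forall j, `|L (delta_mx 0 j)| <= c) -> forall v, `|L v| <= m%:R * c * `|v|.
Proof.
move=> Hc v; rewrite {1}(row_sum_delta v) linear_sum.
rewrite (le_trans (ler_norm_sum _ _ _))//.
rewrite mulrAC -mulrA mulr_natl -[X in _ *+ X]card_ord -sumr_const ler_sum// => i _.
by rewrite linearZ/= normrZ ler_pM ?mx_entry_le ?Hc.
Qed.

Lemma rV_linear_continuous m (W : normedModType R) (L : {linear 'rV[R]_m -> W}) :
  continuous L.
Proof.
apply/linear_bounded_continuous/bounded_funP => r.
pose c := \big[Num.max/0]_j `|L (delta_mx 0 j)|.
have Lc j : `|L (delta_mx 0 j)| <= c by exact: le_bigmax.
exists (m%:R * c * r) => x xr; rewrite (le_trans (rV_linear_le Lc x))//.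
rewrite ler_wpM2l// mulr_ge0//.
by rewrite /c; elim/big_rec: _ => // j a _ a0; rewrite le_max a0 orbT.
Qed.

Lemma jacobian_entry m n (f : 'rV[R]_m -> 'rV[R]_n) x i j :
  jacobian f x i j = 'd f x (delta_mx 0 i) 0 j.
Proof. by rewrite /jacobian /lin1_mx mxE. Qed.

Lemma jacobian_mul m n (f : 'rV[R]_m -> 'rV[R]_n) x v :
  'd f x v = v *m jacobian f x.
Proof. by rewrite /jacobian mul_rV_lin1. Qed.

Lemma CK_jacobian m n k (A : set 'rV[R]_m) (f : 'rV[R]_m -> 'rV[R]_n) :
  open A -> CK k.+1 A f -> CK k A (jacobian f).
Proof.
move=> oA [df H]; apply: CK_matrix => // i j.
rewrite (_ : (fun _ => _) = fun x => 'd f x (delta_mx 0 i) 0 j).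
  exact: (@CK_coord _ _ _ _ _ _ (fun x => 'd f x (delta_mx 0 i)) 0 j oA (H _)).
by apply/funext => x; rewrite jacobian_entry.
Qed.

(** The one-dimensional mean value theorem on the segment from [x] to [y] is applied to each
    coordinate of [f]. The norm being the maximum of the entries, the intermediate point may depend
    on the coordinate. *)
Lemma rV_mean_value m n (f : 'rV[R]_m -> 'rV[R]_n) a (r c : R) :
  0 <= c ->
  (forall x, ball a r x -> differentiable f x) ->
  (forall x v, ball a r x -> `|'d f x v| <= c * `|v|) ->
  forall x y, ball a r x -> ball a r y -> `|f y - f x| <= c * `|y - x|.
Proof.
move=> c0 df dfc x y ax ay.
apply: mx_norm_le => [|i j]; first by rewrite mulr_ge0.
rewrite ord1 {i}.
pose g t := x + t *: (y - x).
have gball t : 0 <= t <= 1 -> ball a r (g t).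
  move=> /andP[t0 t1]; move: ax ay.
  rewrite -ball_normE /ball_/= => ax ay.
  have -> : a - g t = (1 - t) *: (a - x) + t *: (a - y).
    by apply/rowP => i; rewrite !mxE; ring.
  rewrite (le_lt_trans (ler_normD _ _))// !normrZ ger0_norm ?subr_ge0//.
  rewrite (ger0_norm t0).
  have [->|tn0] := eqVneq t 0; first by rewrite subr0 mul1r mul0r addr0.
  have : (1 - t) * `|a - x| + t * `|a - y| < (1 - t) * r + t * r.
    by rewrite ler_ltD// ?ler_wpM2l ?subr_ge0// ?(ltW ax)// ltr_pM2l// lt_neqAle eq_sym tn0.
  by rewrite -mulrDl subrK mul1r.
have dg t : is_diff t g (fun h : R => h *: (y - x)).
  rewrite (_ : (fun h : R => _) = cst (0 : 'rV[R]_m) + (fun h : R => h *: (y - x))).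
    rewrite [g]/(cst x + (fun t : R => t *: (y - x))); exact: is_diffD.
  by apply/funext => h; rewrite /= [RHS]add0r.
pose h (t : R) : R := (f (g t)) 0 j.
have dh t : 0 <= t <= 1 -> is_derive (t : R) (1 : R) h ('d f (g t) (y - x) 0 j).
  move=> /gball gt.
  have dfg : is_diff t (f \o g) ('d f (g t) \o (fun h : R => h *: (y - x))).
    by apply: is_diff_comp; exact/differentiableP/df.
  have lc : linear (fun v : 'rV[R]_n => v 0 j : R^o).
    by move=> b u v; rewrite !mxE.
  pose cj : {linear 'rV[R]_n -> R} :=
    HB.pack (fun v : 'rV[R]_n => v 0 j : R) (GRing.isLinear.Build _ _ _ _ _ lc).
  have dhh : is_diff t h (cj \o ('d f (g t) \o (fun h : R => h *: (y - x)))).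
    rewrite [h]/(cj \o (f \o g)); apply: is_diff_comp.
    apply: DiffDef; first exact/linear_differentiable/coord_continuous.
    exact/diff_lin/coord_continuous.
  have dt : differentiable h t by case: dhh.
  apply: DeriveDef; first exact/diff_derivable.
  by rewrite deriveE//; case: dhh => _ -> /=; rewrite scale1r.
have [| |t t01] := @MVT_segment R h (fun t => 'd f (g t) (y - x) 0 j) 0 1 ler01.
- by move=> t; rewrite in_itv/= => /andP[/ltW t0 /ltW t1]; apply: dh; rewrite t0.
- apply: derivable_within_continuous => t; rewrite in_itv/= => t01.
  by have [] := dh t t01.
move: t01; rewrite in_itv/= => t01.
rewrite subr0 mulr1 /h /g scale1r scale0r addr0 (addrC x) subrK => E.
rewrite !mxE E (le_trans (mx_entry_le _ _ _))//.
exact/dfc/gball.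
Qed.

End RowVectors.

Lemma diff_sub_id (R : realType) (V : normedModType R) (f : V -> V) x v :
  differentiable f x -> 'd (fun y => f y - y) x v = 'd f x v - v.
Proof.
move=> df.
have idc : continuous (@idfun V) by move=> y; exact: cvg_id.
have E : (fun y => f y - y) = f - idfun by apply/funext.
rewrite E.
apply: (etrans (congr1 (@^~ v)
  (@diffB R _ _ f idfun x df (linear_differentiable x idc)))) => /=.
by congr (_ - _); exact: (congr1 (@^~ v) (@diff_lin R V V idfun x idc)).
Qed.

(** * The inverse function theorem and left inverses of immersions *)

Section InverseFunction.
Context (R : realType).

(** Since the differential at [a] is the identity, [u = F - id] is Lipschitz with constant 1/2 near
    [a]. Hence F y = z is solved by Banach's fixed point theorem, and the solution [G] is Lipschitz
    with constant 2. Its differential is the inverse of that of [F], which raises the regularity of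
    [G] one order at a time. *)
Lemma inverse_function_id q (F : 'rV[R]_q -> 'rV[R]_q) (A : set 'rV[R]_q) a :
  open A -> A a -> (forall k, CK k A F) -> (forall v, 'd F a v = v) ->
  exists (B : set 'rV[R]_q) (G : 'rV[R]_q -> 'rV[R]_q),
    [/\ open B, B (F a), forall k, CK k B G &
        \forall x \near a, G (F x) = x].
Proof.
move=> oA Aa AF Fa.
pose u y := F y + - y.
have Au k : CK k A u by apply: CK_add => //; apply: CK_opp => //; exact: CK_id.
have dF x : A x -> differentiable F x by exact: (AF 1).1.
have du x : A x -> differentiable u x by exact: (Au 1).1.
have duE x v : A x -> 'd u x v = 'd F x v - v.
  by move=> Ax; exact/diff_sub_id/dF.
(* A Jacobian of [u] with entries at most [c] multiplies norms by at most q c <= 1/2. *)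
pose c : R := (2 * (q%:R + 1))^-1.
have c0 : 0 < c by rewrite invr_gt0 mulr_gt0// ltr_wpDl.
have Ju : jacobian u @ a --> (0 : 'M[R]_q).
  have := CK_continuous (CK_jacobian oA (Au 1)) Aa.
  rewrite /prop_for /continuous_at (_ : jacobian u a = 0)//.
  by apply/matrixP => i j; rewrite jacobian_entry duE// Fa subrr !mxE.
have JF : (fun x => \det (jacobian F x)) @ a --> (1 : R).
  have := CK_continuous (CK_det oA (CK_jacobian oA (AF 1))) Aa.
  rewrite /prop_for /continuous_at (_ : jacobian F a = 1%:M) ?det1//.
  by apply/matrixP => i j; rewrite jacobian_entry Fa !mxE eqxx eq_sym.
have [r r0 Hr] : exists2 r : R, 0 < r & forall x, ball a r x ->
    [/\ A x, jacobian F x \in unitmx & forall v, `|'d u x v| <= 2^-1 * `|v|].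
  have : \forall x \near a, [/\ A x, jacobian F x \in unitmx &
      forall v, `|'d u x v| <= 2^-1 * `|v|].
    near=> x; split.
    - by near: x; exact: open_nbhs_nbhs.
    - rewrite unitmxE unitfE; near: x.
      by move/cvgr_neq0 : JF; apply; exact: oner_neq0.
    - move=> v; have Jc : `|jacobian u x| <= c.
        by near: x; exact: cvgr0_norm_le Ju c c0.
      have := @rV_linear_le R q _ ('d u x) c _ v.
      move=> /(_ _)/le_trans -> //.
        move=> j; apply: mx_norm_le => [|i l]; first exact: ltW.
        by rewrite ord1 -jacobian_entry (le_trans (mx_entry_le _ _ _)).
      rewrite ler_wpM2r// /c invfM mulrCA ler_piMr// ler_pdivrMr ?mul1r ?lerDl//.
  by move/nbhs_ballP => [r r0 Hr]; exists r.
have lip x y : ball a r x -> ball a r y -> `|u y - u x| <= 2^-1 * `|y - x|.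
  apply: rV_mean_value => // z; first by move=> /Hr[/du].
  by move=> v /Hr[].
have Flow x y : ball a r x -> ball a r y -> `|y - x| <= 2 * `|F y - F x|.
  move=> ax ay; have := lip _ _ ax ay.
  have -> : F y - F x = (u y - u x) + (y - x).
    by rewrite /u !opprD !opprK; apply/rowP => i; rewrite !mxE; ring.
  have := ler_normB ((u y - u x) + (y - x)) (u y - u x).
  by rewrite addrC addKr => h1 h2; lra.
pose s := r / 2; have s0 : 0 < s by rewrite divr_gt0.
have sr x : `|a - x| <= s -> ball a r x.
  by move=> h; rewrite -ball_normE /ball_/= (le_lt_trans h)// /s; lra.
have aa : ball a r a by exact: ballxx.
have ex z : ball (F a) (s / 2) z -> exists2 y, ball a s y & F y = z.
  rewrite -ball_normE /ball_/= => zs.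
  pose U := [set y | `|a - y| <= s].
  (* As [u] is F - id, the fixed points of [T] are the solutions of F y = z. *)
  pose T y := z - u y.
  have aT y : U y -> `|a - T y| <= `|F a - z| + s / 2.
    move=> ay; have -> : a - T y = (F a - z) + (u y - u a).
      by rewrite /T /u !opprD !opprK; apply/rowP => i; rewrite !mxE; ring.
    rewrite (le_trans (ler_normD _ _))// lerD2l.
    have := lip _ _ aa (sr _ ay); rewrite (distrC y a) => h.
    by rewrite /U /= in ay; lra.
  have TU : set_fun U U T by move=> y /aT h; rewrite /U /= (le_trans h)//; lra.
  pose X : completeNormedModType R :=
    HB.pack 'rV[R]_q (Uniform_isComplete.Build 'rV[R]_q (@mx_complete R 1 q)).
  pose Tf : {fun U >-> U} := HB.pack T (@isFun.Build _ _ U U T TU).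
  have ctr : @is_contraction R X X U U Tf.
    exists (2^-1)%:nng; split => /=; first by lra.
    move=> [x y] /= [Ux Uy].
    have -> : T x - T y = - (u x - u y).
      by rewrite /T !opprD !opprK; apply/rowP => i; rewrite !mxE; ring.
    by rewrite normrN lip//; exact: sr.
  have [||y Uy yT] := @banach_fixed_point R X U Tf ctr.
  - rewrite [U](_ : _ = closed_ball_ Num.Def.normr a s)//.
    exact: closed_closed_ball_.
  - by exists a; rewrite /U /= subrr normr0 ltW.
  have yT' : y = T y by rewrite {1}yT.
  exists y.
    have := aT _ Uy; rewrite -yT' => h.
    by rewrite /ball_/=; lra.
  by move: yT'; rewrite /T /u => /eqP; rewrite eq_sym subr_eq addrC subrK => /eqP <-.
pose B := ball (F a) (s / 2).
have [G BG] : exists G : 'rV[R]_q -> 'rV[R]_q,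
    forall z, B z -> ball a s (G z) /\ F (G z) = z.
  have := @choice _ _ (fun z y => B z -> ball a s y /\ F y = z).
  move=> /(_ _)[z|G HG]; last by exists G.
  have [/ex[y ys yz]|nB] := pselect (B z); first by exists y.
  by exists a.
have oB : open B by exact: ball_open.
have sr' x : ball a s x -> ball a r x.
  by move=> h; apply: sr; move: h; rewrite -ball_normE => /ltW.
have Glip (z z' : 'rV[R]_q) : B z -> B z' -> `|G z' - G z| <= 2 * `|z' - z|.
  move=> Bz Bz'; have [[gz Fz] [gz' Fz']] := (BG _ Bz, BG _ Bz').
  by rewrite -{2}Fz -{2}Fz'; apply: Flow; exact: sr'.
have Gc (z : 'rV[R]_q) : B z -> {for z, continuous G}.
  move=> Bz; apply/(@cvgrPdist_le _ _ _ (nbhs z)) => e e0; near=> z'.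
  rewrite distrC (le_trans (Glip _ _ Bz _))//.
    by near: z'; exact: open_nbhs_nbhs.
  rewrite -ler_pdivlMl// distrC; near: z'.
  by apply: cvgr_dist_le; [exact: cvg_id|rewrite mulr_gt0// invr_gt0].
have dG (z : 'rV[R]_q) : B z -> is_diff z G (fun v => v *m invmx (jacobian F (G z))).
  move=> Bz; have [gz Fz] := BG _ Bz.
  have [Ay Ju' _] := Hr _ (sr' _ gz).
  set M := invmx _.
  have ML : linear (fun v : 'rV[R]_q => v *m M).
    by move=> b x y; rewrite mulmxDl scalemxAl.
  pose L : {linear 'rV[R]_q -> 'rV[R]_q} :=
    HB.pack (fun v => v *m M) (GRing.isLinear.Build _ _ _ _ _ ML).
  have Lc : continuous L by exact: rV_linear_continuous.
  have [k k0 Lk] := linear_lipschitz Lc.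
  apply: (@diff_from_le _ _ _ _ L) => // e e0.
  (* The error in the expansion of [F] at [G z] is multiplied by [k] when [L] is applied, and by 2
     when |G z' - G z| is replaced by |z' - z|. *)
  have e'0 : 0 < e / (k * 2) by rewrite divr_gt0// mulr_gt0.
  have := diff_near_le (dF _ Ay) e'0.
  move=> /(Gc _ Bz); rewrite near_simpl => H.
  near=> z'.
  have Bz' : B z' by near: z'; exact: open_nbhs_nbhs.
  have : `|F (G z') - F (G z) - 'd F (G z) (G z' - G z)| <=
         e / (k * 2) * `|G z' - G z| by near: z'.
  have [gz' Fz'] := BG _ Bz'.
  rewrite Fz Fz' => h.
  have -> : G z' - G z - L (z' - z) =
     - L (z' - z - 'd F (G z) (G z' - G z)).
    have E : L ('d F (G z) (G z' - G z)) = G z' - G z.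
      by rewrite jacobian_mul /= -mulmxA mulmxV// mulmx1.
    by rewrite [L (z' - z - _)]linearB E opprB.
  rewrite normrN (le_trans (Lk _))// -ler_pdivlMl// (le_trans h)//.
  have -> : k^-1 * (e * `|z' - z|) = e / (k * 2) * (2 * `|z' - z|).
    by field; rewrite gt_eqF.
  by rewrite ler_wpM2l ?(ltW e'0)//; exact: Glip.
have BGA z : B z -> ball a r (G z) by move=> /BG[/sr'].
exists B, G; split => //.
- by rewrite /B; apply: ballxx; rewrite divr_gt0.
- elim => [|k IH]; first by move=> z; exact: Gc.
  split=> [z /dG[]//|v].
  (* This formula for the differential involves [G] itself but no derivative of [G]: order k for [G]
     gives order k+1. *)
  apply: (@CK_ext _ _ _ k B (fun z => v *m invmx (jacobian F (G z)))
    (fun z => 'd G z v) oB).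
    by move=> z /set_mem /dG[_ ->].
  apply: CK_mulmx => //; first exact: (CK_cst _ _ v).
  apply: CK_invmx => //; first by move=> z /BGA /Hr[].
  apply: (@CK_comp_rV _ _ _ _ _ B (ball a r) G (jacobian F)) => //.
    exact: ball_open.
  apply: (@CK_subset _ _ _ _ A); first by move=> x /Hr[].
  exact: CK_jacobian.
- near=> x.
  have xs : ball a s x by near: x; exact: nbhsx_ballx.
  have xB : B (F x).
    near: x; apply: (CK_continuous (AF 0) Aa).
    by apply: nbhsx_ballx; rewrite divr_gt0.
  have [gx Fgx] := BG _ xB.
  apply/eqP; rewrite -subr_eq0 -normr_le0.
  rewrite (le_trans (Flow _ _ (sr' _ xs) (sr' _ gx)))//.
  by rewrite Fgx subrr normr0 mulr0.
Unshelve. all: by end_near. Qed.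

End InverseFunction.

Section LeftInverse.
Context (R : realType).

Definition affine p q (M : 'M[R]_(p, q)) (a : 'rV[R]_p) (b : 'rV[R]_q)
  (y : 'rV[R]_p) : 'rV[R]_q := b + (y - a) *m M.

Lemma is_diff_affine p q (M : 'M[R]_(p, q)) a b x :
  is_diff x (affine M a b) (fun v => v *m M).
Proof.
have ML : linear (fun v : 'rV[R]_p => v *m M).
  by move=> c u v; rewrite mulmxDl scalemxAl.
pose L : {linear 'rV[R]_p -> 'rV[R]_q} :=
  HB.pack (fun v => v *m M) (GRing.isLinear.Build _ _ _ _ _ ML).
apply: (@diff_from_le _ _ _ _ L); first exact: rV_linear_continuous.
move=> e e0; near=> y.
rewrite (_ : _ - _ - _ = 0) ?normr0 ?mulr_ge0 ?(ltW e0)//.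
rewrite /affine /= opprD addrACA subrr add0r -mulmxBl opprB addrA subrK subrr.
by [].
Unshelve. all: by end_near. Qed.

Lemma CK_affine p q (M : 'M[R]_(p, q)) a b k A : open A -> CK k A (affine M a b).
Proof.
move=> oA; apply: CK_add => //; first exact: (CK_cst _ _ b).
apply: (@CK_mulmx R _ 1 p q k A (fun y : 'rV[R]_p => y - a) (fun=> M)) => //.
  by apply: CK_add => //; [exact: CK_id|exact: (CK_cst _ _ (- a))].
exact: (CK_cst _ _ M).
Qed.

Lemma affine_continuous p q (M : 'M[R]_(p, q)) a b : continuous (affine M a b).
Proof.
by move=> x; apply: differentiable_continuous; case: (is_diff_affine M a b x).
Qed.

(** The Jacobian D at [a] has a right inverse L. The map F(y) = f(a + (y - f a) L) + (y - f a)(1 - L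
    D) extends [f] from the affine image of D to the whole space, and its differential at [f a] is v
    L D + v (1 - L D) = v. A local inverse of F, followed by y |-> a + (y - f a) L, is the left
    inverse. *)
Lemma immersion_left_inverse p q (f : 'rV[R]_p -> 'rV[R]_q) (A : set 'rV[R]_p) a :
  open A -> A a -> (forall k, CK k A f) -> (forall v, 'd f a v = 0 -> v = 0) ->
  exists (B : set 'rV[R]_q) (r : 'rV[R]_q -> 'rV[R]_p),
    [/\ open B, B (f a), forall k, CK k B r & \forall x \near a, r (f x) = x].
Proof.
move=> oA Aa Af f_inj.
pose D := jacobian f a.
have [L DL] : exists L, D *m L = 1%:M.
  by apply/row_freeP/inj_row_free => v vD; apply: f_inj; rewrite jacobian_mul.
pose g := affine L (f a) a; pose h := affine (1%:M - L *m D) (f a) 0.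
pose F y := f (g y) + h y.
have ga : g (f a) = a by rewrite /g /affine subrr mul0mx addr0.
have ha : h (f a) = 0 by rewrite /h /affine subrr mul0mx addr0.
pose A' := g @^-1` A.
have oA' : open A' by apply: open_comp => // y _; exact: affine_continuous.
have AF k : CK k A' F.
  apply: CK_add => //; last exact: CK_affine.
  by apply: (@CK_comp_rV _ _ _ _ k A' A g f) => //; exact: CK_affine.
have Fid v : 'd F (f a) v = v.
  have dg : is_diff (f a) g (fun v => v *m L) := is_diff_affine L (f a) a (f a).
  have dfa : is_diff (g (f a)) f ('d f a).
    by rewrite ga; apply/differentiableP; exact: (Af 1).1.
  have dfg := is_diff_comp dg dfa.
  have dF := is_diffD dfg (is_diff_affine (1%:M - L *m D) (f a) 0 (f a)).
  rewrite [LHS](congr1 (@^~ v) (diff_val (is_diff_def := dF))).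
  rewrite -[LHS]/('d f a (v *m L) + v *m (1%:M - L *m D)).
  by rewrite jacobian_mul mulmxBr mulmx1 mulmxA addrC subrK.
have A'a : A' (f a) by rewrite /A' /= ga.
have [B [G [oB BFa BG GF]]] := inverse_function_id oA' A'a AF Fid.
have Fa : F (f a) = f a by rewrite /F ga ha addr0.
rewrite Fa in BFa.
exists B, (g \o G); split => //.
  move=> k; apply: (@CK_comp_rV _ _ _ _ k B setT G g) => //; first exact: openT.
  by apply: CK_affine; exact: openT.
(* The point with parameter [x] in the affine image of D. There D L = 1 gives g y = x and h y = 0,
   hence F y = f x. *)
pose y x := affine D a (f a) x.
have ya : y a = f a by rewrite /y /affine subrr mul0mx addr0.
have yc : y x @[x --> a] --> f a by rewrite -ya; exact: affine_continuous.
have GFy : \forall x \near a, G (F (y x)) = y x by exact: yc _ GF.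
apply: filterS GFy => x.
have yB : y x - f a = (x - a) *m D by rewrite /y /affine addrC addKr.
have E1 : g (y x) = x.
  by rewrite /g {1}/affine yB -mulmxA DL mulmx1 addrC subrK.
have -> : F (y x) = f x.
  rewrite /F E1 /h {1}/affine yB add0r.
  by rewrite -mulmxA mulmxBr mulmx1 mulmxA DL mul1mx subrr mulmx0 addr0.
by move=> /= ->; exact: E1.
Qed.

End LeftInverse.

(** * A smooth function that vanishes exactly on the half-line t <= 0 *)

Section FlatFunction.
Context (R : realType).

Lemma is_derive_diff (f : R -> R) (t a : R) :
  is_derive t (1 : R) f a -> is_diff t f (fun v : R => v * a).
Proof.
move=> [df <-]; have dft : differentiable f t by exact/derivable1_diffP.
apply: DiffDef => //; rewrite (diff1E dft); apply/funext => v.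
by rewrite derive1E.
Qed.

(* This family contains the flat function expR (- t^-1) and its span is stable
   under differentiation. *)
Definition flat (n : nat) (t : R) : R :=
  if 0 < t then (t^-1) ^+ n * expR (- t^-1) else 0.

(** A quadratic bound is what gives derivative 0 at the origin. With s = 1/t and N = n+2 it follows
    from exp(s) = exp(s/N)^N >= (s/N)^N: of the N powers of s, n offset the factor s^n and two give
    t^2. *)
Lemma flat_le n (t : R) : `|flat n t| <= (n.+2%:R) ^+ n.+2 * t ^+ 2.
Proof.
rewrite /flat; case: ifPn => [t0|_]; last first.
  by rewrite normr0 mulr_ge0 ?sqr_ge0// exprn_ge0.
rewrite ger0_norm ?mulr_ge0 ?exprn_ge0 ?invr_ge0 ?expR_ge0 ?(ltW t0)//.
set s := t^-1; have s0 : 0 < s by rewrite invr_gt0.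
have Es : s / n.+2%:R <= expR (s / n.+2%:R).
  by rewrite (le_trans _ (expR_ge1Dx _))// lerDr.
have : (s / n.+2%:R) ^+ n.+2 <= expR s.
  have -> : expR s = expR (s / n.+2%:R) ^+ n.+2.
    by rewrite -expRM_natl mulrCA mulfV ?mulr1// pnatr_eq0.
  by rewrite lerXn2r// nnegrE ?expR_ge0// divr_ge0// ltW.
rewrite expr_div_n ler_pdivrMr ?exprn_gt0// => H.
have -> : t ^+ 2 = s ^- 2 by rewrite /s exprVn invrK.
rewrite expRN ler_pdivrMr ?expR_gt0// mulrAC ler_pdivlMr ?exprn_gt0//.
by rewrite -exprD addn2 mulrC.
Qed.

Lemma is_diff_flat n (t : R) :
  is_diff t (flat n) (fun v : R => v * (flat n.+2 t - n%:R * flat n.+1 t)).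
Proof.
have lc (c : R) : linear (fun v : R => v * c : R^o).
  by move=> a x y; rewrite mulrDl scalerAl.
pose L c : {linear R -> R} :=
  HB.pack (fun v : R => v * c : R) (GRing.isLinear.Build _ _ _ _ _ (lc c)).
have Lc c : continuous (L c) by exact: mulrr_continuous.
have [t0|t0|t0] := ltgtP t 0.
- have E : flat n.+2 t - n%:R * flat n.+1 t = 0.
    by rewrite /flat ltNge (ltW t0)/= mulr0 subrr.
  rewrite E; apply: (@diff_from_le _ _ _ _ (L 0)) => // e e0.
  near=> y; have y0 : y < 0 by near: y; exact: lt_nbhsl.
  rewrite /flat ltNge (ltW y0)/= ltNge (ltW t0)/= mulr0 !subrr normr0.
  by rewrite mulr_ge0// ltW.
- pose g := (fun s : R => s ^+ n * expR (- s)) \o (fun y : R => y^-1).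
  have tn0 : t != 0 by rewrite gt_eqF.
  have dg : is_derive t 1 g (flat n.+2 t - n%:R * flat n.+1 t).
    have di : is_derive t (1:R) (fun y : R => y^-1) (- (t ^- 2)).
      have := @is_deriveV R (@id R) t 1 1 tn0 (is_derive_id t 1).
      by rewrite /GRing.scale /= mulr1.
    have dh : is_derive (t^-1) 1 (fun s : R => s ^+ n * expR (- s))
        (t^-1 ^+ n * - expR (- t^-1) + expR (- t^-1) * (n%:R * t^-1 ^+ n.-1)).
      have dX : is_derive (t^-1) 1 (fun s : R => s ^+ n) (n%:R * t^-1 ^+ n.-1).
        have := @is_deriveX R R (@id R) n t^-1 1 1 (is_derive_id _ _).
        by rewrite /GRing.scale /= mulr1 exprfctE.
      have dE : is_derive (t^-1) 1 (fun s : R => expR (- s)) (- expR (- t^-1)).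
        have dN : is_derive (t^-1) 1 (fun s : R => - s) (-1).
          by have := is_deriveN (is_derive_id t^-1 (1 : R)).
        have := @is_derive1_comp R (@expR R) -%R t^-1 _ _ (is_derive_expR _) dN.
        by rewrite mulrN1.
      by have := is_deriveM dX dE.
    have := @is_derive1_comp R (fun s : R => s ^+ n * expR (- s)) (fun y : R => y^-1) t _ _ dh di.
    set a := (X in is_derive _ _ _ X -> _).
    set b := (X in _ -> is_derive _ _ _ X).
    suff -> : a = b by [].
    rewrite /a /b /flat t0 -exprVn.
    case: (n) => [|k] /=; first by ring.
    by rewrite !exprS; ring.
  have [dgd gE] := is_derive_diff dg.
  have gf : \forall y \near t, g y = flat n y.
    near=> y; rewrite /g /flat /=.
    by have -> : 0 < y by near: y; exact: lt_nbhsr.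
  have [df fE] := is_diff_near_eq gf dgd.
  by apply: DiffDef => //; rewrite fE.
- have E : flat n.+2 t - n%:R * flat n.+1 t = 0.
    by rewrite t0 /flat ltxx mulr0 subrr.
  rewrite E; apply: (@diff_from_le _ _ _ _ (L 0)) => // e e0.
  have c0 : 0 < n.+2%:R ^+ n.+2 :> R by rewrite exprn_gt0.
  near=> y; rewrite {2}/flat t0 ltxx /= mulr0 !subr0.
  rewrite (le_trans (flat_le _ _))// -real_normK ?num_real// expr2 mulrA.
  rewrite ler_wpM2r// -ler_pdivlMl// mulrC.
  have : `|t - y| <= e / n.+2%:R ^+ n.+2.
    by near: y; apply: cvgr_dist_le; [exact: cvg_id|rewrite divr_gt0].
  by rewrite t0 sub0r normrN.
Unshelve. all: by end_near. Qed.

Lemma CK_flat n k : CK k setT (flat n).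
Proof.
elim: k n => [|k IH] n; first by move=> t _; apply: differentiable_continuous; case: (is_diff_flat n t).
split=> [t _|v]; first by case: (is_diff_flat n t).
apply: (@CK_ext _ _ _ k setT
  (fun t => v * (flat n.+2 t - n%:R * flat n.+1 t)) (fun t => 'd (flat n) t v) openT).
  by move=> t _; case: (is_diff_flat n t) => _ ->.
apply: CK_mul; [exact: openT|exact: (CK_cst _ _ v)|].
apply: CK_add; [exact: openT|exact: IH|].
apply: CK_opp; first exact: openT.
by apply: CK_mul; [exact: openT|exact: (CK_cst _ _ (n%:R : R))|exact: IH].
Qed.

Lemma flat_ge0 n t : 0 <= flat n t.
Proof.
rewrite /flat; case: ifPn => // t0.
by rewrite mulr_ge0 ?expR_ge0// exprn_ge0// invr_ge0 ltW.
Qed.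

Lemma flat_gt0 n t : (0 < flat n t) = (0 < t).
Proof.
rewrite /flat; case: ifPn => t0; last by rewrite ltxx.
by rewrite mulr_gt0 ?expR_gt0// exprn_gt0// invr_gt0.
Qed.

End FlatFunction.

(** * Generic affine perturbations *)

Section Counting.
Context (R : realType).

(* A substitute for the fact that a Lipschitz image of a box of dimension #|Ia| is
   negligible in dimension #|Ib|: count the points of a fine grid. *)
Lemma grid_pigeonhole (Ia Ib I : finType)
    (rel : (Ib -> R) -> I -> (Ia -> R) -> Prop) (e rho L : R) :
  (#|Ia| < #|Ib|)%N -> 0 < e -> 0 <= rho -> 0 <= L ->
  (forall z i u, rel z i u -> forall l, `|u l| <= rho) ->
  (forall z z' i u u' h, 0 <= h -> rel z i u -> rel z' i u' ->
    (forall l, `|u l - u' l| <= h) -> forall j, `|z j - z' j| <= L * h) ->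
  exists2 z : Ib -> R, (forall j, 0 <= z j < e) & forall i u, ~ rel z i u.
Proof.
move=> ab e0 rho0 L0 urho lip.
apply: contrapT => H.
have cover (z : Ib -> R) : (forall j, 0 <= z j < e) ->
    exists iu : I * (Ia -> R), rel z iu.1 iu.2.
  move=> ze; apply: contrapT => nz; apply: H; exists z => // i u rzu.
  by apply: nz; exists (i, u).
(* [M] grid values are used on each side of the box of the z, and at most [C * M] cells of width [h]
   on each side of that of the u. [C] does not depend on [M], so [M] can be chosen above |I| C^|Ia|;
   then M^(|Ia|+1) grid points outnumber the |I| (C M)^|Ia| codes. *)
pose C := (Num.truncn (4 * rho * (L + 1) / e)).+2.
pose M := (#|I| * C ^ #|Ia|).+1.
(* Chosen so that L h is smaller than the grid spacing e / M. *)
pose h := e / (2 * M%:R * (L + 1)).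
have M0 : 0 < M%:R :> R by rewrite ltr0n.
have L1 : 0 < L + 1 by rewrite ltr_wpDl.
have h0 : 0 < h by rewrite divr_gt0// mulr_gt0// mulr_gt0.
have Lh : L * h < e / M%:R.
  have -> : L * h = (e / M%:R) * (L / (2 * (L + 1))).
    by rewrite /h; field; rewrite !gt_eqF.
  rewrite gtr_pMr ?divr_gt0// ltr_pdivrMr ?mulr_gt0// mul1r; lra.
pose zk (k : {ffun Ib -> 'I_M}) (j : Ib) : R := e / M%:R * (k j)%:R.
have zke k j : 0 <= zk k j < e.
  rewrite /zk mulr_ge0 ?divr_ge0 ?(ltW e0)//= mulrAC ltr_pdivrMr//.
  by rewrite ltr_pM2l// ltr_nat.
have [u Hu] := choice (fun k => cover _ (zke k)).
pose cell k l := Num.truncn (((u k).2 l + rho) / h).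
have cell_ge0 k l : 0 <= ((u k).2 l + rho) / h.
  have := urho _ _ _ (Hu k) l; rewrite ler_norml => /andP[h1 _].
  by rewrite divr_ge0 ?(ltW h0)//; lra.
have cellP k l : (cell k l < C * M)%N.
  rewrite -(ltr_nat R); apply: le_lt_trans (_ : 2 * rho / h < _).
    have /andP[h1 _] := truncn_itv (cell_ge0 k l).
    rewrite (le_trans h1)// ler_pM2r ?invr_gt0//.
    have := urho _ _ _ (Hu k) l; rewrite ler_norml => /andP[_ h2].
    by lra.
  have -> : 2 * rho / h = (4 * rho * (L + 1) / e) * M%:R.
    by rewrite /h; field; rewrite !gt_eqF.
  rewrite natrM ltr_pM2r// /C.
  have w0 : 0 <= 4 * rho * (L + 1) / e.
    by rewrite divr_ge0 ?(ltW e0)// mulr_ge0 ?(ltW L1)// mulr_ge0.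
  have /andP[_ h2] := truncn_itv w0.
  by rewrite (lt_trans h2)// ltr_nat.
pose code k : I * {ffun Ia -> 'I_(C * M)} :=
  ((u k).1, [ffun l => Ordinal (cellP k l)]).
(* Two grid points with the same code have parameters at distance at most [h], hence coordinates
   that differ by less than the spacing. *)
have code_inj : injective code.
  move=> k k' [E1 E2]; apply/ffunP => j; apply/val_inj/eqP.
  have uh l : `|(u k).2 l - (u k').2 l| <= h.
    have := congr1 (fun w : {ffun Ia -> 'I_(C * M)} => val (w l)) E2.
    rewrite !ffunE /= => Ec.
    have /andP[a1 a2] := truncn_itv (cell_ge0 k l).
    have /andP[b1 b2] := truncn_itv (cell_ge0 k' l).
    rewrite -/(cell k' l) in b1 b2; rewrite -/(cell k l) Ec in a1 a2.
    rewrite -addn1 natrD ltr_pdivrMr// mulrDl mul1r in a2.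
    rewrite -addn1 natrD ltr_pdivrMr// mulrDl mul1r in b2.
    rewrite ler_pdivlMr// in a1; rewrite ler_pdivlMr// in b1.
    by rewrite ler_norml; apply/andP; split; lra.
  have Hk' : rel (zk k') (u k).1 (u k').2 by rewrite E1; exact: Hu.
  have := lip _ _ _ _ _ _ (ltW h0) (Hu k) Hk' uh j.
  move=> /le_lt_trans/(_ Lh).
  rewrite /zk -mulrBr normrM gtr0_norm ?divr_gt0// gtr_pMr ?divr_gt0// => lt1.
  move: lt1; rewrite ltr_norml => /andP[l1 l2].
  case: (ltngtP (k j) (k' j)) => // lt; exfalso.
    have : (k j)%:R + 1 <= (k' j)%:R :> R by rewrite natr1 ler_nat.
    by lra.
  have : (k' j)%:R + 1 <= (k j)%:R :> R by rewrite natr1 ler_nat.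
  by lra.
have := leq_card code code_inj.
rewrite card_prod !card_ffun !card_ord; apply/negP; rewrite -ltnNge.
rewrite expnMn mulnA.
have : (#|I| * C ^ #|Ia| * M ^ #|Ia| < M ^ #|Ia|.+1)%N.
  by rewrite expnS ltn_pmul2r// expn_gt0.
by move=> /leq_trans; apply; rewrite leq_pexp2l.
Qed.

End Counting.

Section AffinePerturbation.
Context (R : realType).

(** A nonzero linear relation between the columns is solved for the column whose coefficient has the
    largest modulus. The coefficients obtained are then bounded by 1, so that they range over a
    fixed box, as the counting argument requires. *)
Lemma not_row_full_col m n (J : 'M[R]_(m, n.+1)) :
  ~~ row_full J ->
  exists (i : 'I_n.+1) (c : 'I_n -> R),
    (forall l, `|c l| <= 1) /\
    (forall k, J k i = \sum_l c l * J k (lift i l)).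
Proof.
move=> nfull.
have [w [w0 Jw]] : exists w : 'rV[R]_n.+1, w != 0 /\ w *m J^T = 0.
  apply: contrapT => H; move/negP: nfull; apply.
  have : row_free J^T.
    apply: inj_row_free => v vJ; apply: contrapT => v0; apply: H.
    by exists v; split => //; exact/eqP.
  by rewrite /row_free /row_full mxrank_tr.
have [i wi] : exists i, forall j, `|w 0 j| <= `|w 0 i|.
  have [i _ iP] := @Order.TotalTheory.arg_maxP _ _ _ (@ord0 n) xpredT (fun i => `|w 0 i|) isT.
  by exists i => j; exact: iP.
have wi0 : w 0 i != 0.
  apply: contra w0 => /eqP wi0; apply/eqP/rowP => j; rewrite mxE.
  have := wi j; rewrite wi0 normr0 normr_le0.
  by move/eqP.
exists i, (fun l => - (w 0 (lift i l) / w 0 i)); split => [l|k].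
  by rewrite normrN normrM normfV ler_pdivrMr ?normr_gt0// mul1r.
have := congr1 (fun v : 'rV[R]_m => v 0 k) Jw; rewrite !mxE.
rewrite (bigD1_ord i)//= mxE => E.
apply: (mulfI wi0); rewrite mulr_sumr.
rewrite (eq_bigr (fun l => - (w 0 (lift i l) * (J k (lift i l))))); last first.
  by move=> l _; field.
rewrite sumrN; move/eqP: E; rewrite addr_eq0 => /eqP ->.
by congr (- _); apply: eq_bigr => l _; rewrite mxE.
Qed.

Lemma norm_le_of_dist (V : normedModType R) (x y : V) (c : R) :
  `|x - y| <= c -> `|y| <= `|x| + c.
Proof.
move=> xyc; rewrite -{1}(subrK x y) addrC (le_trans (ler_normD _ _))//.
by rewrite lerD2l distrC.
Qed.

Definition cball m (a : 'rV[R]_m) (r : R) : set 'rV[R]_m := [set c | `|a - c| <= r].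

Lemma cball_compact m (a : 'rV[R]_m) r : compact (cball a r).
Proof.
apply: bounded_closed_compact.
  exists (`|a| + r); split; first exact: num_real.
  move=> s sr x xr /=; rewrite (le_trans (norm_le_of_dist xr))// ltW//.
rewrite [cball a r](_ : _ = closed_ball_ Num.Def.normr a r)//.
exact: closed_closed_ball_.
Qed.

Lemma cball_bounded m (W : normedModType R) (h : 'rV[R]_m -> W) a (r : R) :
  (forall x, cball a r x -> {for x, continuous h}) ->
  exists2 b : R, 0 <= b & forall x, cball a r x -> `|h x| <= b.
Proof.
move=> hc; have /compact_near_coveringP cov := @cball_compact m a r.
have H : \forall b \near +oo, forall x, cball a r x -> `|h x| <= b.
  apply: cov => x xr.
  exists ([set y | `|h x - h y| <= 1], [set b | `|h x| + 1 <= b]) => /=.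
    split; last exact: nbhs_pinfty_ge.
    exact: cvgr_dist_le (hc x xr) 1 ltr01.
  by move=> [y b] /= [/norm_le_of_dist hy hb]; exact: le_trans hy hb.
near (@pinfty_nbhs R) => b; exists b; last by near: b.
by near: b; exact: nbhs_pinfty_ge.
Unshelve. all: by end_near. Qed.

Lemma CK_lipschitz m n (f : 'rV[R]_m -> 'rV[R]_n) (A : set 'rV[R]_m) a (r : R) :
  open A -> cball a r `<=` A -> CK 1 A f ->
  exists2 c : R, 0 <= c & forall x y,
    ball a r x -> ball a r y -> `|f y - f x| <= c * `|y - x|.
Proof.
move=> oA rA Af.
have brA z : ball a r z -> cball a r z.
  by rewrite -ball_normE /ball_ /cball /= => /ltW.
have [c c0 Hc] := @cball_bounded m _ (jacobian f) a r
  (fun x xr => CK_continuous (CK_jacobian oA Af) (rA x xr)).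
exists (m%:R * c); first by rewrite mulr_ge0.
apply: (@rV_mean_value R m n f a r); first by rewrite mulr_ge0.
  by move=> z /brA/rA; exact: Af.1.
move=> z v /brA/Hc Jz; apply: rV_linear_le => j.
apply: mx_norm_le => // i l.
by rewrite ord1 -jacobian_entry (le_trans (mx_entry_le _ _ _)).
Qed.

(* If f + p + x P has a degenerate zero x, some column of G x + P is a combination
   of the others. Then (p, P) depends in a Lipschitz way on x, these n columns and
   the n coefficients, which is one parameter less than in (p, P). *)
Lemma affine_perturbation_lipschitz m n (f : 'rV[R]_m -> 'rV[R]_n.+1)
    (G : 'rV[R]_m -> 'M[R]_(m, n.+1)) a (r b c1 c2 e : R) :
  0 < r -> 0 <= b -> 0 <= c1 -> 0 <= c2 -> 0 < e ->
  (forall x, ball a r x -> `|G x| <= b) ->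
  (forall x y, ball a r x -> ball a r y -> `|f y - f x| <= c1 * `|y - x|) ->
  (forall x y k j, ball a r x -> ball a r y ->
    `|G y k j - G x k j| <= c2 * `|y - x|) ->
  exists (p : 'rV[R]_n.+1) (P : 'M[R]_(m, n.+1)), [/\ `|p| <= e, `|P| <= e &
    forall x, ball a r x -> f x + p + x *m P = 0 -> row_full (G x + P)%R].
Proof.
move=> rgt0 b0 c10 c20 e0 HA Hf HJ.
pose Ia := ('I_m + 'I_m * 'I_n + 'I_n)%type.
pose Ib := ('I_n.+1 + 'I_m * 'I_n.+1)%type.
pose pz (z : Ib -> R) : 'rV[R]_n.+1 := \row_j z (inl j).
pose Pz (z : Ib -> R) : 'M[R]_(m, n.+1) := \matrix_(k, j) z (inr (k, j)).
pose xu (u : Ia -> R) : 'rV[R]_m := \row_k u (inl (inl k)).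
pose Bu (u : Ia -> R) k l := u (inl (inr (k, l))).
pose cu (u : Ia -> R) l := u (inr l).
pose rel (z : Ib -> R) (i : 'I_n.+1) (u : Ia -> R) :=
  [/\ ball a r (xu u), f (xu u) + pz z + xu u *m Pz z = 0, `|Pz z| <= 1,
      (forall l, `|cu u l| <= 1) /\
      (forall k l, (G (xu u) + Pz z) k (lift i l) = Bu u k l) &
      forall k, (G (xu u) + Pz z) k i = \sum_l cu u l * Bu u k l].
pose rho := `|a| + r + (b + 1) + 1.
have a0 : 0 <= `|a| by [].
have rho0 : 0 <= rho by rewrite !addr_ge0// ltW.
have ar_rho : `|a| + r <= rho by rewrite /rho -addrA lerDl !addr_ge0.
have b_rho : b + 1 <= rho.
  by rewrite /rho addrAC lerDr !addr_ge0// ltW.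
have rho1 : 1 <= rho by rewrite /rho lerDr !addr_ge0// ltW.
(* Lipschitz constants of the successive unknowns: [K1] for G x + P, whose dependent column is a sum
   of n products; K1 + c2 for P, after subtracting G x; and [K2] for p = - f x - x P. *)
pose K1 : R := n%:R * (rho + 1) + 1.
pose K2 := c1 + m%:R * (1 + rho * (K1 + c2)).
pose L := K2 + (K1 + c2).
have K10 : 0 <= K1 by rewrite addr_ge0// mulr_ge0// addr_ge0.
have K1c2 : 0 <= K1 + c2 by rewrite addr_ge0.
have K20 : 0 <= K2 by rewrite addr_ge0// mulr_ge0// addr_ge0// mulr_ge0.
have L0 : 0 <= L by rewrite addr_ge0.
have xr x : ball a r x -> `|x| <= `|a| + r.
  by rewrite -ball_normE /ball_ /= => /ltW/norm_le_of_dist.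
have rel_bound z i u : rel z i u -> forall l, `|u l| <= rho.
  move=> [ax _ P1 [c_1 HB] _] [[k|[k l]]|l].
  - have := mx_entry_le (xu u) 0 k; rewrite mxE => /le_trans; apply.
    exact: le_trans (xr _ ax) ar_rho.
  - rewrite -[u _]/(Bu u k l) -HB mxE (le_trans _ b_rho)//.
    rewrite (le_trans (ler_normD _ _))// lerD// (le_trans (mx_entry_le _ _ _))//.
    exact: HA.
  - exact: le_trans (c_1 l) rho1.
have rel_lip z z' i u u' h : 0 <= h -> rel z i u -> rel z' i u' ->
    (forall l, `|u l - u' l| <= h) -> forall j, `|z j - z' j| <= L * h.
  move=> h0 [ax Ex P1 [c_1 HB] Hi] [ax' Ex' P1' [c_1' HB'] Hi'] uh.
  have xd : `|xu u - xu u'| <= h.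
    by apply: mx_norm_le => // s k; rewrite !mxE; exact: uh.
  have Jd k j : `|G (xu u) k j - G (xu u') k j| <= c2 * h.
    by rewrite (le_trans (HJ _ _ k j ax' ax))// ler_wpM2l.
  have fd : `|f (xu u) - f (xu u')| <= c1 * h.
    by have := Hf _ _ ax' ax; move=> /le_trans/(_ (ler_wpM2l c10 xd)).
  have Bb k l : `|Bu u k l| <= rho.
    by have := rel_bound z i u _ (inl (inr (k, l))); apply; split.
  have K1h : h <= K1 * h by rewrite ler_peMl// lerDr mulr_ge0// addr_ge0.
  have Nd k j : `|(G (xu u) + Pz z) k j -
                  (G (xu u') + Pz z') k j| <= K1 * h.
    case: (unliftP i j) => [l|] ->.
      by rewrite HB HB' (le_trans _ K1h)//; exact: uh.
    rewrite Hi Hi' -sumrB (le_trans (ler_norm_sum _ _ _))//.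
    apply: (@le_trans _ _ (\sum_(l < n) (rho + 1) * h)).
      apply: ler_sum => l _.
      have -> : cu u l * Bu u k l - cu u' l * Bu u' k l =
         (cu u l - cu u' l) * Bu u k l + cu u' l * (Bu u k l - Bu u' k l) by ring.
      rewrite (le_trans (ler_normD _ _))// !normrM mulrDl lerD//.
        by rewrite mulrC ler_pM//; exact: uh.
      by rewrite ler_pM//; exact: uh.
    rewrite sumr_const card_ord -mulr_natl mulrA ler_wpM2r//.
    by rewrite lerDl.
  have Pd k j : `|Pz z k j - Pz z' k j| <= (K1 + c2) * h.
    have -> : Pz z k j - Pz z' k j = ((G (xu u) + Pz z) k j -
        (G (xu u') + Pz z') k j) -
        (G (xu u) k j - G (xu u') k j).
      have addE (M N : 'M[R]_(m, n.+1)) : (M + N) k j = M k j + N k j.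
        by rewrite mxE.
      by rewrite !addE; ring.
    rewrite (le_trans (ler_normB _ _))// mulrDl lerD//.
  case=> [j|[k j]]; last first.
    have := Pd k j; rewrite !mxE => /le_trans; apply.
    by rewrite ler_wpM2r// lerDr.
  have pE (w : Ib -> R) (v : Ia -> R) : f (xu v) + pz w + xu v *m Pz w = 0 ->
      w (inl j) = - (f (xu v) 0 j) - \sum_k xu v 0 k * Pz w k j.
    move=> /(congr1 (fun M : 'rV[R]_n.+1 => M 0 j)); rewrite !mxE => Ew.
    by apply/eqP; rewrite -opprD -addr_eq0 addrCA addrA Ew.
  rewrite (pE _ _ Ex) (pE _ _ Ex').
  have subE (s t s' t' : R) : - s - t - (- s' - t') = - (s - s') - (t - t').
    by ring.
  rewrite subE.
  rewrite -sumrB (le_trans (ler_normB _ _))// normrN.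
  apply: (@le_trans _ _ (K2 * h)); last by rewrite ler_wpM2r// lerDl.
  rewrite mulrDl lerD//.
    rewrite (le_trans _ fd)//.
    by have := mx_entry_le (f (xu u) - f (xu u')) 0 j; rewrite !mxE.
  rewrite (le_trans (ler_norm_sum _ _ _))//.
  apply: (@le_trans _ _ (\sum_(k < m) (1 + rho * (K1 + c2)) * h)); last first.
    by rewrite sumr_const card_ord -[leLHS]mulr_natl mulrA.
  apply: ler_sum => k _.
  have mulE (s t s' t' : R) : s * t - s' * t' = (s - s') * t + s' * (t - t').
    by ring.
  rewrite mulE.
  rewrite (le_trans (ler_normD _ _))// !normrM mulrDl mul1r lerD//.
    rewrite -[leRHS]mulr1 ler_pM//.
      by rewrite !mxE; exact: uh.
    exact: le_trans (mx_entry_le _ _ _) P1.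
  rewrite -mulrA ler_pM//.
  rewrite (le_trans (mx_entry_le _ _ _))// (le_trans (xr _ ax'))//.
have card_lt : (#|{: Ia}| < #|{: Ib}|)%N.
  by rewrite !card_sum !card_prod !card_ord mulnS addSn ltnS addnC.
(* The bound 1 on [P] belongs to [rel], where it enters the Lipschitz estimate of x P. *)
have e'0 : 0 < Num.min e 1 by rewrite lt_min e0 ltr01.
have [z ze Hz] := grid_pigeonhole card_lt e'0 rho0 L0 rel_bound rel_lip.
have zle j : `|z j| <= Num.min e 1.
  by have /andP[h1 h2] := ze j; rewrite ger0_norm// ltW.
have zle1 j : `|z j| <= 1 by rewrite (le_trans (zle j))// ge_min lexx orbT.
have zlee j : `|z j| <= e by rewrite (le_trans (zle j))// ge_min lexx.
exists (pz z), (Pz z); split.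
- by apply: mx_norm_le => [|i j]; rewrite ?(ltW e0)// mxE.
- by apply: mx_norm_le => [|i j]; rewrite ?(ltW e0)// mxE.
move=> x ax fx; apply: contrapT => /negP/not_row_full_col[i [c [c_1 Hc]]].
pose u (l : Ia) : R := match l with
  | inl (inl k) => x 0 k
  | inl (inr (k, l)) => (G x + Pz z) k (lift i l)
  | inr l => c l end.
have xuE : xu u = x by apply/rowP => k; rewrite mxE.
apply: (Hz i u); split; rewrite ?xuE//.
by apply: mx_norm_le => // k l; rewrite mxE.
Qed.

Lemma mxvec_dist m n (M N : 'M[R]_(m, n)) k j :
  `|M k j - N k j| <= `|mxvec M - mxvec N|.
Proof.
rewrite -linearB /=; apply: le_trans (mx_entry_le _ 0 (mxvec_index k j)).
by rewrite mxvecE !mxE.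
Qed.

Lemma affine_perturbation_regular m n (f : 'rV[R]_m -> 'rV[R]_n)
    (A : set 'rV[R]_m) a (r e : R) :
  open A -> 0 < r -> cball a r `<=` A -> (forall k, CK k A f) -> 0 < e ->
  exists (p : 'rV[R]_n) (P : 'M[R]_(m, n)), [/\ `|p| <= e, `|P| <= e &
    forall x, ball a r x -> f x + p + x *m P = 0 ->
      row_full (jacobian f x + P)%R].
Proof.
case: n f => [|n] f oA r0 rA Af e0.
  exists 0, 0; rewrite !normr0 ltW//; split => // x _ _.
  by rewrite /row_full -leqn0 rank_leq_col.
have [c1 c10 Hf] := CK_lipschitz oA rA (Af 1).
(* The Jacobian is flattened in order to apply the Lipschitz estimate for maps with values in row
   vectors. *)
pose Jv x : 'rV[R]_(m * n.+1) := mxvec (jacobian f x).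
have AJ : CK 1 A Jv.
  apply: (@CK_matrix R _ 1 (m * n.+1) 1 A Jv oA) => i j.
  case/mxvec_indexP: j => k l; rewrite ord1.
  rewrite (_ : (fun _ => _) = fun x => jacobian f x k l).
    by apply: CK_coord => //; exact: CK_jacobian.
  by apply/funext => x; rewrite /Jv mxvecE.
have [c2 c20 HJ] := CK_lipschitz oA rA AJ.
have [b b0 Hb] := @cball_bounded m _ (jacobian f) a r
  (fun x xr => CK_continuous (CK_jacobian oA (Af 1)) (rA x xr)).
apply: (affine_perturbation_lipschitz r0 b0 c10 c20 e0 _ Hf).
  by move=> x; rewrite -ball_normE => xr; apply: Hb; exact: ltW.
move=> x y k j ax ay; apply: le_trans (HJ _ _ ax ay).
exact: mxvec_dist.
Qed.

End AffinePerturbation.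

Local Opaque derive.diff jacobian.

(** * Smooth functions on manifolds *)

Section SmoothNear.
Context (R : realType).
Implicit Types V W : normedModType R.

Definition sm_near V W (f : V -> W) (a : V) : Prop :=
  exists B, [/\ open B, B a & forall k, CK k B f].

Lemma sm_near_eq V W (f g : V -> W) a :
  (\forall x \near a, f x = g x) -> sm_near f a -> sm_near g a.
Proof.
move=> fg [B [oB Ba Bf]].
have : nbhs a (B `&` [set x | f x = g x]).
  by apply: filterI => //; exact: open_nbhs_nbhs.
rewrite nbhsE => -[C [oC Ca] CB]; exists C; split => // k.
apply: (@CK_ext _ _ _ k C f) => //; first by move=> x /set_mem /CB[].
by apply: CK_subset (Bf k) => x /CB[].
Qed.

Lemma sm_near_near V W (f : V -> W) a :
  sm_near f a -> \forall x \near a, sm_near f x.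
Proof.
move=> [B [oB Ba Bf]]; have := open_nbhs_nbhs (conj oB Ba).
by apply: filterS => x Bx; exists B.
Qed.

Lemma sm_near_differentiable V W (f : V -> W) a :
  sm_near f a -> differentiable f a.
Proof. by move=> [B [_ Ba Bf]]; exact: (Bf 1).1. Qed.

Lemma sm_near_continuous V W (f : V -> W) a :
  sm_near f a -> {for a, continuous f}.
Proof. by move=> /sm_near_differentiable/differentiable_continuous. Qed.

Lemma sm_near_comp m V W (f : V -> 'rV[R]_m) (g : 'rV[R]_m -> W) a :
  sm_near f a -> sm_near g (f a) -> sm_near (g \o f) a.
Proof.
move=> smf [B [oB Ba Bg]]; have fc := sm_near_continuous smf.
case: smf => A [oA Aa Af].
have : nbhs a (A `&` f @^-1` B).
  by apply: filterI; [exact: open_nbhs_nbhs|exact/fc/open_nbhs_nbhs].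
rewrite nbhsE => -[C [oC Ca] CB]; exists C; split => // k.
apply: (@CK_comp_rV _ _ _ _ k C B f g) => //; first by move=> x /CB[].
by apply: CK_subset (Af k) => x /CB[].
Qed.

Lemma sm_near_cst V W (w : W) (a : V) : sm_near (fun=> w) a.
Proof. by exists setT; split => // [|k]; [exact: openT|exact: CK_cst]. Qed.

Lemma sm_near_lin V W (L : {linear V -> W}) a : continuous L -> sm_near L a.
Proof.
by move=> Lc; exists setT; split => // [|k]; [exact: openT|exact: CK_lin].
Qed.

Lemma sm_near2 V W1 W2 W3 (f : V -> W1) (g : V -> W2) (h : V -> W3) a :
  (forall k (A : set V), open A -> CK k A f -> CK k A g -> CK k A h) ->
  sm_near f a -> sm_near g a -> sm_near h a.
Proof.
move=> H [A [oA Aa Af]] [B [oB Ba Bg]]; exists (A `&` B); split => //.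
  exact: openI.
move=> k; apply: H; first exact: openI.
  by apply: CK_subset (Af k) => x [].
by apply: CK_subset (Bg k) => x [].
Qed.

Lemma sm_near_add V W (f g : V -> W) a :
  sm_near f a -> sm_near g a -> sm_near (fun x => f x + g x) a.
Proof. by apply: sm_near2 => k A oA; exact: CK_add. Qed.

Lemma sm_near_scale V W (c : V -> R) (f : V -> W) a :
  sm_near c a -> sm_near f a -> sm_near (fun x => c x *: f x) a.
Proof. by apply: sm_near2 => k A oA; exact: CK_scale. Qed.

Lemma sm_near_sum V W (I : Type) (r : seq I) (F : I -> V -> W) a :
  (forall i, sm_near (F i) a) -> sm_near (fun x => \sum_(i <- r) F i x) a.
Proof.
move=> HF; elim: r => [|i r IH].
  rewrite (_ : (fun _ => _) = fun=> 0); first exact: sm_near_cst.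
  by apply/funext => x; rewrite big_nil.
rewrite (_ : (fun _ => _) = fun x => F i x + \sum_(i <- r) F i x).
  by apply: sm_near_add; [exact: HF|exact: IH].
by apply/funext => x; rewrite big_cons.
Qed.

Lemma sm_near_inv V (f : V -> R) a :
  f a != 0 -> sm_near f a -> sm_near (fun x => (f x)^-1) a.
Proof.
move=> fa0 smf; have fc := sm_near_continuous smf.
case: smf => A [oA Aa Af].
have : nbhs a (A `&` [set x | f x != 0]).
  by apply: filterI; [exact: open_nbhs_nbhs|exact: cvgr_neq0 fc fa0].
rewrite nbhsE => -[C [oC Ca] CB]; exists C; split => // k.
apply: CK_inv => //; first by move=> x /CB[].
by apply: CK_subset (Af k) => x /CB[].
Qed.

Lemma sm_near_jacobian m n (f : 'rV[R]_m -> 'rV[R]_n) a :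
  sm_near f a -> {for a, continuous (jacobian f)}.
Proof.
move=> [A [oA Aa Af]]; have Jc := CK_continuous (CK_jacobian oA (Af 1)) Aa.
exact: Jc.
Qed.

Lemma near_eq_jacobian m n (f g : 'rV[R]_m -> 'rV[R]_n) a :
  (\forall x \near a, f x = g x) -> differentiable f a ->
  jacobian g a = jacobian f a.
Proof.
move=> fg df; apply/matrixP => i j.
apply: (etrans (jacobian_entry g a i j)).
apply: (etrans _ (esym (jacobian_entry f a i j))).
exact: (congr1 (fun h : _ -> 'rV[R]_n => h (delta_mx 0 i) 0 j)
  (is_diff_near_eq fg df).2).
Qed.

Lemma jacobian_comp l m n (f : 'rV[R]_l -> 'rV[R]_m) (g : 'rV[R]_m -> 'rV[R]_n) a :
  differentiable f a -> differentiable g (f a) ->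
  jacobian (g \o f) a = jacobian f a *m jacobian g (f a).
Proof.
move=> df dg; apply/matrixP => i j; apply: (etrans (jacobian_entry (g \o f) a i j)).
apply: (etrans (congr1 (fun h : _ -> 'rV[R]_n => h (delta_mx 0 i) 0 j)
  (diff_comp df dg))) => /=.
rewrite (jacobian_mul g (f a)) (jacobian_mul f a).
by rewrite -mulmxA -rowE mxE.
Qed.

Lemma jacobian_add m n (f g : 'rV[R]_m -> 'rV[R]_n) a :
  differentiable f a -> differentiable g a ->
  jacobian (fun x => f x + g x) a = jacobian f a + jacobian g a.
Proof.
move=> df dg; apply/matrixP => i j; apply: (etrans (jacobian_entry (f + g) a i j)).
apply: (etrans (congr1 (fun h : _ -> 'rV[R]_n => h (delta_mx 0 i) 0 j)
  (diffD df dg))).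
have addE p q (M N : 'M[R]_(p, q)) k l : (M + N) k l = M k l + N k l.
  by rewrite mxE.
apply: (etrans (addE _ _ _ _ 0 j)); apply: (etrans _ (esym (addE _ _ _ _ i j))).
by congr (_ + _); apply: esym; exact: jacobian_entry.
Qed.

Lemma smooth_onE m n (A : set 'rV[R]_m) (f : 'rV[R]_m -> 'rV[R]_n) :
  smooth_on A f <-> forall k, CK k A f.
Proof. by split=> H k; have := H k; rewrite Ck_onE. Qed.

Lemma sm_near_smooth_on m n (A : set 'rV[R]_m) (f : 'rV[R]_m -> 'rV[R]_n) a :
  open A -> A a -> smooth_on A f -> sm_near f a.
Proof. by move=> oA Aa /smooth_onE Af; exists A. Qed.

End SmoothNear.

Lemma near_eq_continuous (T S : topologicalType) (f g : T -> S) x :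
  (\forall y \near x, f y = g y) -> {for x, continuous f} ->
  {for x, continuous g}.
Proof.
move=> fg; rewrite /prop_for /continuous_at (nbhs_singleton fg).
by apply: cvg_trans; apply: near_eq_cvg; exact: filterS fg.
Qed.

Section Charts.
Context (R : realType) (M : manifold R).
Implicit Types (x y z : M).

Lemma open_within_at (T S : topologicalType) (A : set T) (f : T -> S) (x : T) :
  open A -> A x -> {within A, continuous f} -> {for x, continuous f}.
Proof.
move=> oA Ax; rewrite continuous_open_subspace//; apply; exact/mem_set.
Qed.

Lemma mchart_at x y : mdom x y -> {for y, continuous (mchart x)}.
Proof.
by move=> xy; exact: (open_within_at (@mdom_open _ M x) xy (@mchart_continuous _ M x)).
Qed.

Lemma mchartV_at x y : mdom x y ->
  {for mchart x y, continuous (@mchartV _ _ x)}.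
Proof.
move=> xy; have cy : (mchart x @` mdom x) (mchart x y) by exists y.
exact: (open_within_at (@mimage_open _ M x) cy (@mchartV_continuous _ M x)).
Qed.

Lemma mchartV_cvg x y : mdom x y ->
  @mchartV _ _ x c @[c --> mchart x y] --> y.
Proof. by move=> xy; have := mchartV_at xy; rewrite /prop_for /continuous_at mchartK. Qed.

Lemma near_mchart x y (P : set M) : mdom x y ->
  (\forall z \near y, P z) -> \forall c \near mchart x y, P (@mchartV _ _ x c).
Proof. by move=> xy Py; exact: (mchartV_cvg xy Py). Qed.

Lemma near_mchartV x y (P : set M) : mdom x y ->
  (\forall c \near mchart x y, P (@mchartV _ _ x c)) -> \forall z \near y, P z.
Proof.
move=> xy /(mchart_at xy) H; near=> z.
have <- : @mchartV _ _ x (mchart x z) = z.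
  by rewrite mchartK//; near: z; apply: open_nbhs_nbhs; split => //; exact: mdom_open.
by near: z.
Unshelve. all: by end_near. Qed.

Lemma near_mdom x y : mdom x y -> \forall z \near y, mdom x z.
Proof. by move=> xy; apply: open_nbhs_nbhs; split => //; exact: mdom_open. Qed.

Lemma near_mchart_mem x y : mdom x y ->
  \forall c \near mchart x y, mdom x (@mchartV _ _ x c).
Proof. by move=> xy; apply: near_mchart => //; exact: near_mdom. Qed.

Lemma near_mchartVK x y : mdom x y ->
  \forall c \near mchart x y, mchart x (@mchartV _ _ x c) = c.
Proof.
move=> xy; have := open_nbhs_nbhs (conj (@mimage_open _ M x) (ex_intro2 _ _ y xy erefl)).
by apply: filterS => c [z xz <-]; rewrite mchartK.
Qed.

Definition transition x z : 'rV[R]_(mdim M) -> 'rV[R]_(mdim M) :=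
  mchart z \o @mchartV _ _ x.

Lemma sm_transition x z y : mdom x y -> mdom z y ->
  sm_near (transition x z) (mchart x y).
Proof.
move=> xy zy.
have : nbhs (mchart x y) (mchart x @` (mdom x `&` mdom z)).
  have H1 := near_mchart xy (near_mdom zy).
  have H2 := near_mchart_mem xy; have H3 := near_mchartVK xy.
  near=> c; exists (@mchartV _ _ x c); last by near: c.
  by split; near: c.
rewrite nbhsE => -[C [oC Ca] CB]; exists C; split => // k.
apply: CK_subset CB _; exact: (smooth_onE _ _).1 (@mtransition_smooth _ M x z) k.
Unshelve. all: by end_near. Qed.

Lemma transitionE x z y : mdom x y -> transition x z (mchart x y) = mchart z y.
Proof. by move=> xy; rewrite /transition /= mchartK. Qed.

Lemma transition_row_full x z y : mdom x y -> mdom z y ->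
  row_full (jacobian (transition x z) (mchart x y)).
Proof.
move=> xy zy.
have zx := sm_transition zy xy; rewrite -(transitionE z xy) in zx.
have E := jacobian_comp (sm_near_differentiable (sm_transition xy zy))
  (sm_near_differentiable zx).
have Eid : \forall c \near mchart x y,
    id c = (transition z x \o transition x z) c.
  have H1 := near_mchart xy (near_mdom zy).
  have H3 := near_mchartVK xy.
  near=> c; rewrite /transition /= mchartK; last by near: c.
  by apply: esym; near: c.
have Jid : jacobian (@id 'rV[R]_(mdim M)) (mchart x y) = 1%:M.
  apply/matrixP => i j; apply: (etrans (jacobian_entry _ _ _ _)).
  have [_ idE] := @is_diff_id R 'rV[R]_(mdim M) (mchart x y).
  apply: (etrans (congr1 (fun h : _ -> 'rV[R]_(mdim M) => h (delta_mx 0 i) 0 j) idE)).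
  by rewrite !mxE eqxx eq_sym.
have idd : differentiable (@id 'rV[R]_(mdim M)) (mchart x y).
  by case: (is_diff_id (mchart x y)).
have := near_eq_jacobian Eid idd; rewrite E Jid => JJ.
have /mulmx1_unit[u _] := JJ.
by rewrite row_full_unit.
Unshelve. all: by end_near. Qed.

End Charts.

Section SmoothFunctions.
Context (R : realType) (M : manifold R).
Implicit Types (x y z : M) (E : vectType R).

Definition smooth_at E (f : M -> E) x : Prop :=
  sm_near (local_vrep f x) (mchart x x).

Lemma smooth_vmapP E (A : set M) (f : M -> E) :
  smooth_vmap A f <-> forall x, A x -> smooth_at f x.
Proof.
split=> H x Ax.
  by have [B [oB Bx _ sB]] := H x Ax; exact: sm_near_smooth_on sB.
have [B [oB Bx sB]] := H x Ax.
exists (B `&` mchart x @` mdom x); split.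
- by apply: openI => //; exact: mimage_open.
- by split => //; exists x => //; exact: mdom_mem.
- by move=> c [].
- by apply/smooth_onE => k; apply: CK_subset (sB k) => c [].
Qed.

Lemma vrep_change E (f : M -> E) x z y : mdom x y -> mdom z y ->
  sm_near (local_vrep f x) (mchart x y) -> sm_near (local_vrep f z) (mchart z y).
Proof.
move=> xy zy sf.
apply: (@sm_near_eq _ _ _ (local_vrep f x \o transition z x)).
  have H1 := near_mchart zy (near_mdom xy).
  near=> c; rewrite /local_vrep /transition /= mchartK//.
  by near: c.
apply: sm_near_comp; first exact: sm_transition.
by rewrite transitionE.
Unshelve. all: by end_near. Qed.

Lemma smooth_at_chart E (f : M -> E) x y : mdom x y ->
  smooth_at f y <-> sm_near (local_vrep f x) (mchart x y).
Proof.
by move=> xy; split; apply: vrep_change => //; exact: mdom_mem.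
Qed.

Lemma jacobian_change E (f : M -> E) x z y : mdom x y -> mdom z y ->
  smooth_at f y ->
  jacobian (local_vrep f z) (mchart z y) =
  jacobian (transition z x) (mchart z y) *m jacobian (local_vrep f x) (mchart x y).
Proof.
move=> xy zy sf.
have sfx := (smooth_at_chart f xy).1 sf; rewrite -(transitionE x zy) in sfx.
have E1 := jacobian_comp (sm_near_differentiable (sm_transition zy xy))
  (sm_near_differentiable sfx).
rewrite -[X in _ *m jacobian _ X](transitionE x zy) -E1.
apply: near_eq_jacobian; last first.
  by apply: differentiable_comp; apply: sm_near_differentiable => //; exact: sm_transition.
have H1 := near_mchart zy (near_mdom xy).
near=> c; rewrite /local_vrep /transition /= mchartK//.
by near: c.
Unshelve. all: by end_near. Qed.

Lemma vdiffE E (f : M -> E) x u :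
  vdiff f x u = r2v (u *m jacobian (local_vrep f x) (mchart x x)).
Proof. by rewrite /vdiff lfunE /= jacobian_mul. Qed.

Lemma limg_vdiff_full E (f : M -> E) x :
  (limg (vdiff f x) == fullv) = row_full (jacobian (local_vrep f x) (mchart x x)).
Proof.
apply/eqP/idP => [Hf|/row_fullP[B BJ]].
  apply/row_fullP.
  have ex (i : 'I_(dim E)) : exists u, vdiff f x u = r2v (delta_mx 0 i).
    have : r2v (delta_mx 0 i) \in limg (vdiff f x) by rewrite Hf memvf.
    by move/memv_imgP => [u _ ->]; exists u.
  have [u Hu] := choice ex.
  exists (\matrix_i u i); apply/row_matrixP => i.
  rewrite row_mul rowK row1; apply: (can_inj r2vK).
  by rewrite -vdiffE.
apply/vspaceP => v; rewrite memvf; apply/memv_imgP.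
exists (v2r v *m B); first exact: memvf.
by rewrite vdiffE -mulmxA BJ mulmx1 v2rK.
Qed.

Lemma regular_chart E (f : M -> E) x y : mdom x y -> smooth_at f y ->
  (limg (vdiff f y) == fullv) =
  row_full (jacobian (local_vrep f x) (mchart x y)).
Proof.
move=> xy sf; rewrite limg_vdiff_full (jacobian_change xy (mdom_mem y) sf).
have T_full := transition_row_full (mdom_mem y) xy.
by rewrite /row_full (eqmxMfull _ T_full).
Qed.

Lemma smooth_at_near E (f : M -> E) x :
  smooth_at f x -> \forall y \near x, smooth_at f y.
Proof.
move=> sf; apply: (near_mchartV (mdom_mem x)).
have H1 := sm_near_near sf; have H2 := near_mchart_mem (mdom_mem x).
have H3 := near_mchartVK (mdom_mem x).
near=> c; apply/(@smooth_at_chart _ _ x); first by near: c.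
have -> : mchart x (mchartV x c) = c by near: c.
by near: c.
Unshelve. all: by end_near. Qed.

Lemma near_local_vrep E (f g : M -> E) x y : mdom x y ->
  (\forall z \near y, f z = g z) ->
  \forall c \near mchart x y, local_vrep f x c = local_vrep g x c.
Proof.
move=> xy fg; apply: filterS (near_mchart xy fg) => c fgc.
by rewrite /local_vrep /= fgc.
Qed.

Lemma smooth_at_near_eq E (f g : M -> E) x :
  (\forall y \near x, f y = g y) -> smooth_at f x -> smooth_at g x.
Proof. by move=> fg; apply: sm_near_eq; exact: near_local_vrep (mdom_mem x) fg. Qed.

Lemma vdiff_near_eq E (f g : M -> E) x :
  (\forall y \near x, f y = g y) -> smooth_at f x -> vdiff g x = vdiff f x.
Proof.
move=> fg sf; apply/lfunP => u.
apply: (etrans (vdiffE g x u)); apply: (etrans _ (esym (vdiffE f x u))).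
apply: (congr1 (fun J => r2v (u *m J))).
exact: near_eq_jacobian (near_local_vrep (mdom_mem x) fg) (sm_near_differentiable sf).
Qed.

Lemma smooth_at_add E (f g : M -> E) x :
  smooth_at f x -> smooth_at g x -> smooth_at (fun y => f y + g y) x.
Proof.
move=> sf sg; rewrite /smooth_at.
rewrite (_ : local_vrep _ x = fun c => local_vrep f x c + local_vrep g x c).
  exact: sm_near_add.
by apply/funext => c; rewrite /local_vrep /= linearD.
Qed.

Lemma smooth_at_cst E (e : E) x : smooth_at (fun=> e) x.
Proof. exact: (sm_near_cst (v2r e)). Qed.

Lemma smooth_at_sum E (I : Type) (r : seq I) (F : I -> M -> E) x :
  (forall i, smooth_at (F i) x) -> smooth_at (fun y => \sum_(i <- r) F i y) x.
Proof.
move=> HF; elim: r => [|i r IH].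
  rewrite (_ : (fun _ => _) = fun=> 0); first exact: smooth_at_cst.
  by apply/funext => y; rewrite big_nil.
rewrite (_ : (fun _ => _) = fun y => F i y + \sum_(i <- r) F i y).
  by apply: smooth_at_add; [exact: HF|exact: IH].
by apply/funext => y; rewrite big_cons.
Qed.

Lemma smooth_at_lin E (F : vectType R) (L : 'Hom(E, F)) (f : M -> E) x :
  smooth_at f x -> smooth_at (fun y => L (f y)) x.
Proof.
move=> sf.
have Ll : linear (fun c : 'rV[R]_(dim E) => v2r (L (r2v c))).
  by move=> a u v; rewrite !linearP.
pose L' : {linear 'rV[R]_(dim E) -> 'rV[R]_(dim F)} :=
  HB.pack (fun c => v2r (L (r2v c))) (GRing.isLinear.Build _ _ _ _ _ Ll).
rewrite /smooth_at (_ : local_vrep _ x = L' \o local_vrep f x).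
  apply: sm_near_comp => //; apply: sm_near_lin; exact: rV_linear_continuous.
by apply/funext => c; rewrite /local_vrep /= v2rK.
Qed.

Definition smooth_scalar_at (h : M -> R) x : Prop :=
  sm_near (h \o mchartV x) (mchart x x).

Lemma smooth_at_scale E (h : M -> R) (f : M -> E) x :
  smooth_scalar_at h x -> smooth_at f x -> smooth_at (fun y => h y *: f y) x.
Proof.
move=> sh sf; rewrite /smooth_at.
rewrite (_ : local_vrep _ x = fun c => (h \o mchartV x) c *: local_vrep f x c).
  exact: sm_near_scale.
by apply/funext => c; rewrite /local_vrep /= linearZ.
Qed.

Lemma smooth_scalar_sum (I : Type) (r : seq I) (F : I -> M -> R) x :
  (forall i, smooth_scalar_at (F i) x) ->
  smooth_scalar_at (fun y => \sum_(i <- r) F i y) x.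
Proof. by move=> HF; exact: sm_near_sum. Qed.

Lemma smooth_scalar_inv (h : M -> R) x :
  h x != 0 -> smooth_scalar_at h x -> smooth_scalar_at (fun y => (h y)^-1) x.
Proof.
by move=> h0; apply: sm_near_inv; rewrite /= mchartK//; exact: mdom_mem.
Qed.

Lemma smooth_scalar_chart (h : M -> R) x y : mdom x y ->
  sm_near (h \o mchartV x) (mchart x y) -> smooth_scalar_at h y.
Proof.
move=> xy sh.
have sc : sm_near ((h \o mchartV x) \o transition y x) (mchart y y).
  apply: sm_near_comp; first by apply: sm_transition => //; exact: mdom_mem.
  by rewrite transitionE//; exact: mdom_mem.
apply: sm_near_eq sc.
have H1 := near_mchart (mdom_mem y) (near_mdom xy).
near=> c; rewrite /transition /= mchartK//.
by near: c.
Unshelve. all: by end_near. Qed.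

Lemma smooth_scalar_near_eq (h l : M -> R) x :
  (\forall y \near x, h y = l y) -> smooth_scalar_at h x -> smooth_scalar_at l x.
Proof. by move=> hl; apply: sm_near_eq; exact: near_mchart (mdom_mem x) hl. Qed.

Lemma smooth_scalar_continuous (h : M -> R) x :
  smooth_scalar_at h x -> {for x, continuous h}.
Proof.
move=> /sm_near_continuous hc.
have xx := mdom_mem x.
apply: near_eq_continuous (continuous_comp (mchart_at xx) hc).
have H := near_mdom xx; near=> y; rewrite /= mchartK//.
by near: y.
Unshelve. all: by end_near. Qed.

Lemma smooth_at_continuous E (f : M -> E) x :
  smooth_at f x -> {for x, continuous (v2r \o f)}.
Proof.
move=> /sm_near_continuous fc.
have xx := mdom_mem x.
apply: near_eq_continuous (continuous_comp (mchart_at xx) fc).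
have H := near_mdom xx; near=> y; rewrite /local_vrep /= mchartK//.
by near: y.
Unshelve. all: by end_near. Qed.

End SmoothFunctions.

(** Compactness in its near-covering form, along the filter of finite sequences of points of [K]
    ordered by inclusion. *)
Lemma finite_subcover (T : topologicalType) (K : set T) (O : T -> set T) :
  compact K -> (forall x, K x -> nbhs x (O x)) ->
  exists s : seq T, (forall x, x \in s -> K x) /\
    forall y, K y -> exists2 x, x \in s & O x y.
Proof.
move=> /compact_near_coveringP cK HO.
pose F := filter_from [set s : seq T | forall x, x \in s -> K x]
  (fun s => [set s' : seq T | {subset s <= s'}]).
have FF : Filter F.
  apply: filter_from_filter; first by exists [::].
  move=> s t Ks Kt; exists (s ++ t).
    by move=> x; rewrite mem_cat => /orP[/Ks|/Kt].
  by move=> u Hu; split => x xs; apply: Hu; rewrite mem_cat xs ?orbT.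
have [|s Ks Hs] := cK _ F (fun s y => exists2 x, x \in s & O x y) FF.
  move=> x Kx; exists (O x, [set s' : seq T | {subset [:: x] <= s'}]) => /=.
    split; first exact: HO.
    by exists [:: x] => // y; rewrite inE => /eqP ->.
  by move=> [y s] /= [Oxy xs]; exists x => //; apply: xs; rewrite mem_head.
by exists s; split => // y Ky; exact: Hs.
Qed.

(** * Gluing and transversality *)

Section Bump.
Context (R : realType).

(** A bump function: for r > 0 it is positive exactly on the open cube of centre [a] and half-side
    [r], which is a ball of the maximum norm. *)
Definition box m (a : 'rV[R]_m) (r : R) (c : 'rV[R]_m) : R :=
  \prod_i (flat 0 (r + (c 0 i - a 0 i)) * flat 0 (r + (a 0 i - c 0 i))).

Lemma CK_box m (a : 'rV[R]_m) r k : CK k setT (box a r).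
Proof.
have oT : open [set: 'rV[R]_m] by exact: openT.
apply: CK_prod => // i _; apply: CK_mul => //.
- apply: (@CK_comp_R R _ _ k setT setT (fun c : 'rV[R]_m => r + (c 0 i - a 0 i)) (@flat R 0)) => //.
  + exact: openT.
  + apply: CK_add => //; first exact: (CK_cst _ _ r).
    apply: CK_add => //; last exact: (CK_cst _ _ (- a 0 i)).
    by apply: (@CK_coord _ _ _ _ _ _ (@idfun 'rV[R]_m)) => //; exact: CK_id.
  + exact: CK_flat.
- apply: (@CK_comp_R R _ _ k setT setT (fun c : 'rV[R]_m => r + (a 0 i - c 0 i)) (@flat R 0)) => //.
  + exact: openT.
  + apply: CK_add => //; first exact: (CK_cst _ _ r).
    apply: CK_add => //; first exact: (CK_cst _ _ (a 0 i)).
    apply: CK_opp => //.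
    by apply: (@CK_coord _ _ _ _ _ _ (@idfun 'rV[R]_m)) => //; exact: CK_id.
  + exact: CK_flat.
Qed.

Lemma box_ge0 m (a : 'rV[R]_m) r c : 0 <= box a r c.
Proof. by apply: prodr_ge0 => i _; rewrite mulr_ge0// flat_ge0. Qed.

Lemma box_gt0 m (a : 'rV[R]_m) r c : `|a - c| < r -> 0 < box a r c.
Proof.
move=> acr; apply: prodr_gt0 => i _.
have := le_lt_trans (mx_entry_le (a - c) 0 i) acr.
rewrite !mxE ltr_norml => /andP[h1 h2].
by rewrite mulr_gt0// flat_gt0; lra.
Qed.

Lemma box_neq0 m (a : 'rV[R]_m) r c : 0 <= r -> box a r c != 0 -> `|a - c| <= r.
Proof.
move=> r0 /prodf_neq0 b0; apply: mx_norm_le => // i j.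
have := b0 j isT; rewrite ord1 mulf_eq0 negb_or => /andP[f1 f2].
have {}f1 : 0 < r + (c 0 j - a 0 j) by rewrite -(flat_gt0 0) lt_neqAle eq_sym f1 flat_ge0.
have {}f2 : 0 < r + (a 0 j - c 0 j) by rewrite -(flat_gt0 0) lt_neqAle eq_sym f2 flat_ge0.
by rewrite !mxE ler_norml; apply/andP; split; lra.
Qed.

Lemma nbhs_cball m (a : 'rV[R]_m) (A : set 'rV[R]_m) :
  nbhs a A -> exists2 r : R, 0 < r & cball a r `<=` A.
Proof.
move=> /nbhs_ballP[r /= r0 rA]; exists (r / 2); first by rewrite divr_gt0.
move=> c /= cr; apply: rA; rewrite -ball_normE /ball_ /=.
by rewrite (le_lt_trans cr)//; lra.
Qed.

Context (M : manifold R).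
Implicit Types (x y : M).

Definition chart_cball x (r : R) : set M :=
  @mchartV _ M x @` cball (mchart x x) r.

Definition chart_bump x (r : R) y : R :=
  if y \in mdom x then box (mchart x x) r (mchart x y) else 0.

Lemma chart_radius x (O : set M) : nbhs x O ->
  exists2 r : R, 0 < r & cball (mchart x x) r `<=` mchart x @` (mdom x `&` O).
Proof.
move=> xO; apply: nbhs_cball.
have xx := mdom_mem x.
have H1 := near_mchart xx xO; have H2 := near_mchart_mem xx.
have H3 := near_mchartVK xx.
near=> c; exists (@mchartV _ M x c); last by near: c.
by split; near: c.
Unshelve. all: by end_near. Qed.

Section Radius.
Context (x : M) (O : set M) (r : R).
Hypotheses (r0 : 0 < r)
  (rO : cball (mchart x x) r `<=` mchart x @` (mdom x `&` O)).

Lemma chart_cball_compact : compact (chart_cball x r).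
Proof.
apply: continuous_compact; last exact: cball_compact.
apply: continuous_subspaceW (@mchartV_continuous _ M x).
by move=> c /rO[y [xy _] <-]; exists y.
Qed.

Lemma chart_cball_sub : chart_cball x r `<=` mdom x `&` O.
Proof. by move=> _ [c /rO[y [xy Oy] <-] <-]; rewrite mchartK. Qed.

Lemma chart_cballP y : mdom x y -> cball (mchart x x) r (mchart x y) ->
  chart_cball x r y.
Proof. by move=> xy yr; exists (mchart x y) => //; rewrite mchartK. Qed.

Lemma chart_bump_ge0 y : 0 <= chart_bump x r y.
Proof. by rewrite /chart_bump; case: ifP => // _; exact: box_ge0. Qed.

Lemma chart_bump_out y : ~ chart_cball x r y -> chart_bump x r y = 0.
Proof.
move=> yr; rewrite /chart_bump; case: ifPn => // /set_mem xy.
apply: contrapT => /eqP/(box_neq0 (ltW r0)) h; apply: yr.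
exact: chart_cballP.
Qed.

Lemma chart_bump_gt0 y : mdom x y -> `|mchart x x - mchart x y| < r ->
  0 < chart_bump x r y.
Proof. by move=> xy h; rewrite /chart_bump mem_set//; exact: box_gt0. Qed.

Lemma near_out_cball y : ~ chart_cball x r y ->
  \forall z \near y, ~ chart_cball x r z.
Proof.
move=> yr; apply: open_nbhs_nbhs; split => //.
apply: closed_openC; apply: compact_closed chart_cball_compact.
exact: m_hausdorff.
Qed.

Lemma chart_bump_rep y : mdom x y ->
  \forall c \near mchart x y, (chart_bump x r \o @mchartV _ M x) c =
                              box (mchart x x) r c.
Proof.
move=> xy; have H1 := near_mchart_mem xy; have H2 := near_mchartVK xy.
near=> c; rewrite /chart_bump /= mem_set; last by near: c.
by congr (box _ _ _); near: c.
Unshelve. all: by end_near. Qed.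

(** Inside the chart domain the bump is [box] in coordinates. Near a point outside it vanishes,
    because the closed coordinate ball is compact, hence closed in the Hausdorff manifold, and lies
    in the domain. *)
Lemma smooth_chart_bump y : smooth_scalar_at (chart_bump x r) y.
Proof.
have [xy|xy] := pselect (mdom x y).
  apply: (smooth_scalar_chart xy).
  apply: (@sm_near_eq _ _ _ (box (mchart x x) r)).
    by apply: filterS (chart_bump_rep xy) => c ->.
  by exists setT; split => // [|k]; [exact: openT|exact: CK_box].
apply: (@smooth_scalar_near_eq _ _ (fun=> 0)); last exact: sm_near_cst.
have /near_out_cball : ~ chart_cball x r y by move=> /chart_cball_sub[].
by apply: filterS => z /chart_bump_out.
Qed.

End Radius.

End Bump.

Section Gluing.
Context (R : realType).

Lemma near_continuous_gt0 (T : topologicalType) (h : T -> R) (x : T) :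
  {for x, continuous h} -> 0 < h x -> \forall y \near x, 0 < h y.
Proof. by move=> hc h0; exact: (hc _ (lt_nbhsr h0)). Qed.

Definition convex_pred (E : lmodType R) (P : set E) : Prop :=
  forall u v (t : R), 0 <= t <= 1 -> P u -> P v -> P (t *: u + (1 - t) *: v).

(** Only the vectors of nonzero weight have to satisfy [P]: a local solution is unusable away from
    its own point, where its bump vanishes. The mean over [i :: s] is a convex combination of [v i]
    and the mean over [s], unless one of the two weights is 0. *)
Lemma convex_sum (E : lmodType R) (P : set E) (I : eqType) (s : seq I)
    (w : I -> R) (v : I -> E) :
  convex_pred P -> (forall i, 0 <= w i) ->
  (forall i, i \in s -> w i != 0 -> P (v i)) -> 0 < \sum_(i <- s) w i ->
  P ((\sum_(i <- s) w i)^-1 *: \sum_(i <- s) w i *: v i).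
Proof.
move=> cP w0; elim: s => [|i s IH] Pv; first by rewrite big_nil ltxx.
rewrite !big_cons; set S := \sum_(j <- s) w j; set T := \sum_(j <- s) _.
have S0 : 0 <= S by apply: sumr_ge0.
have Ps j : j \in s -> w j != 0 -> P (v j).
  by move=> js; apply: Pv; rewrite inE js orbT.
have [wi0|wi0] := eqVneq (w i) 0.
  by rewrite wi0 add0r scale0r add0r => S1; exact: IH.
have Pi : P (v i) by apply: Pv => //; exact: mem_head.
have wi : 0 < w i by rewrite lt_neqAle eq_sym wi0 w0.
move=> wS0.
have [SE|Sn0] := eqVneq S 0.
  have -> : T = 0.
    have /allP Z : all (fun j => true ==> (w j == 0)) s.
      by rewrite -psumr_eq0 //; exact/eqP.
    by rewrite /T big_seq big1// => j /Z /eqP ->; rewrite scale0r.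
  by rewrite SE !addr0 scalerA mulVf// scale1r.
have S1 : 0 < S by rewrite lt_neqAle eq_sym Sn0.
have -> : (w i + S)^-1 *: (w i *: v i + T) =
    (w i / (w i + S)) *: v i + (1 - w i / (w i + S)) *: (S^-1 *: T).
  rewrite scalerDr !scalerA; congr (_ *: _ + _ *: _); first by rewrite mulrC.
  by field; rewrite (gt_eqF wS0) (gt_eqF S1).
apply: cP => //; last exact: IH.
by rewrite divr_ge0 ?(ltW wS0)//= ler_pdivrMr// mul1r lerDl.
Qed.

Context (M : manifold R) (E : vectType R).

Lemma smooth_at_bump_scale x (O : set M) (r : R) (f : M -> E) :
  0 < r -> cball (mchart x x) r `<=` mchart x @` (mdom x `&` O) ->
  (forall y, O y -> smooth_at f y) ->
  forall y, smooth_at (fun z => chart_bump x r z *: f z) y.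
Proof.
move=> r0 rO fO y; have [yr|yr] := pselect (chart_cball x r y).
  apply: smooth_at_scale; first exact: smooth_chart_bump r0 rO _.
  by apply: fO; case: (chart_cball_sub rO yr).
apply: (@smooth_at_near_eq _ _ _ (fun=> 0)); last exact: smooth_at_cst.
apply: filterS (near_out_cball rO yr) => z zr.
by rewrite (chart_bump_out r0 zr) scale0r.
Qed.

Lemma near_chart_bump_gt0 x (O : set M) (r : R) :
  0 < r -> cball (mchart x x) r `<=` mchart x @` (mdom x `&` O) ->
  \forall y \near x, 0 < chart_bump x r y.
Proof.
move=> r0 rO; apply: near_continuous_gt0.
  exact: (smooth_scalar_continuous (smooth_chart_bump r0 rO x)).
apply: chart_bump_gt0; first exact: mdom_mem.
by rewrite subrr normr0.
Qed.

(** A mean of finitely many local solutions, weighted by bump functions and divided by the sum of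
    the weights. That sum is positive on [K], hence near each of its points, so that the solution
    reaches beyond [K]. *)
Lemma convex_gluing (K : set M) (P : M -> set E) :
  compact K -> (forall y, convex_pred (P y)) ->
  (forall x, K x -> exists f : M -> E,
     \forall y \near x, smooth_at f y /\ P y (f y)) ->
  exists f : M -> E, forall x, K x ->
     \forall y \near x, smooth_at f y /\ P y (f y).
Proof.
move=> cK cP loc.
have loc' x : exists fr : (M -> E) * R, K x -> [/\ 0 < fr.2,
    cball (mchart x x) fr.2 `<=`
      mchart x @` (mdom x `&` [set y | smooth_at fr.1 y /\ P y (fr.1 y)]) &
    forall y, smooth_at (fun z => chart_bump x fr.2 z *: fr.1 z) y].
  have [Kx|nKx] := pselect (K x); last by exists (fun=> 0, 1).
  have [f Hf] := loc x Kx.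
  have [r r0 rO] := chart_radius Hf.
  exists (f, r) => _; split => //.
  by apply: (smooth_at_bump_scale r0 rO) => y [].
have {loc'}[fr Hfr] := choice loc'.
pose f x := (fr x).1; pose r x := (fr x).2.
pose rho x := chart_bump x (r x).
have [s [sK Ks]] := @finite_subcover _ K (fun x => [set y | 0 < rho x y]) cK
  (fun x Kx => let: And3 r0 rO _ := Hfr x Kx in near_chart_bump_gt0 r0 rO).
(* The test [x \in s] makes every summand smooth, whatever its index: smoothness is known for the
   points of [K] only, and the lemmas on sums ask for it at all indices. *)
pose S y := \sum_(x <- s) (if x \in s then rho x y else 0).
pose F y := (S y)^-1 *: \sum_(x <- s) (if x \in s then rho x y *: f x y else 0).
have SE y : S y = \sum_(x <- s) rho x y by rewrite /S -big_mkcond -big_seq.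
have rho0 x y : 0 <= rho x y by exact: chart_bump_ge0.
have smS y : smooth_scalar_at S y.
  apply: smooth_scalar_sum => x; case xs: (x \in s); last exact: sm_near_cst.
  have [r0 rO _] := Hfr x (sK x xs); exact: smooth_chart_bump r0 rO _.
have S_gt0 y : K y -> 0 < S y.
  move=> /Ks[x xs xy]; rewrite SE (big_rem x)//= ltr_pwDl//.
  exact: sumr_ge0.
exists F => x Kx.
have : \forall y \near x, 0 < S y.
  apply: near_continuous_gt0; last exact: S_gt0.
  exact: (smooth_scalar_continuous (smS x)).
apply: filterS => y Sy; split.
  apply: smooth_at_scale.
    by apply: smooth_scalar_inv => //; rewrite gt_eqF.
  apply: smooth_at_sum => z; case zs: (z \in s); last exact: smooth_at_cst.
  by have [_ _] := Hfr z (sK z zs); apply.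
rewrite /F -big_mkcond -big_seq SE; rewrite SE in Sy.
apply: (convex_sum (cP y)) => // z zs rz.
have [r0 rO _] := Hfr z (sK z zs).
have zy : chart_cball z (r z) y.
  apply: contrapT => zy; move/eqP: rz; apply.
  by rewrite /rho (@chart_bump_out _ _ z (r z) r0 _ zy).
by have [_ []] := chart_cball_sub rO zy.
Qed.

End Gluing.

(** * Stability of regular zeros in Euclidean space *)

Section RegularityInRm.
Context (R : realType).

(** If B J = 1, then det (B J') stays nonzero for J' near J, and this bounds the rank of J' from
    below. *)
Lemma row_full_open m n (J : 'M[R]_(m, n)) :
  row_full J -> exists2 eta : R, 0 < eta &
    forall J' : 'M[R]_(m, n), `|J - J'| < eta -> row_full J'.
Proof.
move=> /row_fullP[B BJ].
have BT k : CK k setT (fun J' : 'M[R]_(m, n) => \det (B *m J')).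
  apply: CK_det; first exact: openT.
  apply: (@CK_mulmx R _ n m n k setT (fun=> B) id); first exact: openT.
    exact: (CK_cst _ _ B).
  exact: CK_id.
have dc : {for J, continuous (fun J' : 'M[R]_(m, n) => \det (B *m J'))}.
  exact: (CK_continuous (BT 0)).
have : \forall J' \near J, \det (B *m J') != 0.
  apply: (cvgr_neq0 _ dc); rewrite BJ det1; exact: oner_neq0.
move=> /nbhs_ballP[eta /= eta0 H]; exists eta => // J' JJ'.
have {}H : \det (B *m J') != 0 by apply: H; rewrite -ball_normE.
have u : B *m J' \in unitmx by rewrite unitmxE unitfE.
rewrite /row_full eqn_leq rank_leq_col /=.
have := mxrankM_maxr B J'.
by rewrite mxrank_unit.
Qed.

Lemma norm_family_le (V : normedModType R) (I : finType) (theta : I -> R)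
    (v : I -> V) (e : R) :
  (forall i, `|theta i| <= e) ->
  `|\sum_i theta i *: v i| <= e * \sum_i `|v i|.
Proof.
move=> te; rewrite (le_trans (ler_norm_sum _ _ _))// mulr_sumr.
by apply: ler_sum => i _; rewrite normrZ ler_wpM2r.
Qed.

Lemma near_norm_sum (T : topologicalType) (V : normedModType R) (I : finType)
    (G : I -> T -> V) (c : T) :
  (forall i, {for c, continuous (G i)}) ->
  \forall x \near c, \sum_i `|G i x| <= \sum_i (`|G i c| + 1).
Proof.
move=> Gc; have : \forall x \near c, forall i, `|G i x| <= `|G i c| + 1.
  apply: filter_forall => i.
  have : \forall x \near c, `|G i c - G i x| <= 1.
    exact: cvgr_dist_le (Gc i) 1 ltr01.
  by apply: filterS => x /norm_le_of_dist.
by apply: filterS => x Hx; apply: ler_sum.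
Qed.

(** Either F c is nonzero, and no zeros appear near [c], or the Jacobian at [c] has full rank, and
    this persists. Both cases are open conditions and rest on the estimate [pert], applied to values
    in the first case and to Jacobians in the second. *)
Lemma regular_stable m n (I : finType) (F : 'rV[R]_m -> 'rV[R]_n)
    (G : I -> 'rV[R]_m -> 'rV[R]_n) c :
  sm_near F c -> (forall i, sm_near (G i) c) ->
  (F c = 0 -> row_full (jacobian F c)) ->
  exists (N : set 'rV[R]_m) (d : R), [/\ nbhs c N, 0 < d &
    forall x e theta, N x -> e < d -> (forall i, `|theta i| <= e) ->
      F x + \sum_i theta i *: G i x = 0 ->
      row_full (jacobian F x + \sum_i theta i *: jacobian (G i) x)%R].
Proof.
move=> sF sG Freg.
have pert (V : normedModType R) (f : 'rV[R]_m -> V) (g : I -> 'rV[R]_m -> V)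
    (eta : R) :
    0 < eta -> {for c, continuous f} -> (forall i, {for c, continuous (g i)}) ->
    exists (N : set 'rV[R]_m) (d : R), [/\ nbhs c N, 0 < d &
      forall x e theta, N x -> e < d -> (forall i, `|theta i| <= e) ->
      `|f c - (f x + \sum_i theta i *: g i x)| < eta].
  move=> eta0 fc gc; set B := \sum_i (`|g i c| + 1).
  have B0 : 0 <= B by apply: sumr_ge0 => i _; rewrite addr_ge0.
  exists [set x | `|f c - f x| < eta / 2 /\ \sum_i `|g i x| <= B],
    (eta / (2 * (B + 1))).
  split.
  - have eta2 : 0 < eta / 2 by rewrite divr_gt0.
    have h1 : \forall x \near c, `|f c - f x| < eta / 2.
      exact: cvgr_dist_lt fc _ eta2.
    exact: (filterI h1 (near_norm_sum gc)).
  - by rewrite divr_gt0// mulr_gt0// ltr_wpDl.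
  move=> x e theta [h1 h2] ed te.
  rewrite opprD addrA (le_lt_trans (ler_normB _ _))//.
  have h3 : `|\sum_i theta i *: g i x| < eta / 2.
    rewrite (le_lt_trans (norm_family_le _ te))//.
    have [e0|e0] := ltP e 0.
      rewrite (le_lt_trans _ (_ : 0 < eta / 2)) ?divr_gt0//.
      by rewrite nmulr_rle0// sumr_ge0.
    have : e * \sum_i `|g i x| <= eta / (2 * (B + 1)) * B.
      by rewrite ler_pM// ?sumr_ge0// ltW.
    move=> /le_lt_trans; apply.
    have -> : eta / (2 * (B + 1)) * B = (eta / 2) * (B / (B + 1)).
      by field; rewrite gt_eqF// ltr_wpDl.
    by rewrite gtr_pMr ?divr_gt0// ltr_pdivrMr ?ltr_wpDl// mul1r ltrDl.
  by move: h1 h3; lra.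
have [F0|F0] := eqVneq (F c) 0; last first.
  have F0' : 0 < `|F c| by rewrite normr_gt0.
  have [N [d [Nc d0 H]]] := pert _ F G _ F0' (sm_near_continuous sF)
    (fun i => sm_near_continuous (sG i)).
  exists N, d; split => // x e theta Nx ed te E.
  by have := H x e theta Nx ed te; rewrite E subr0 ltxx.
have [eta eta0 Heta] := row_full_open (Freg F0).
have [N [d [Nc d0 H]]] := pert _ (jacobian F) (fun i => jacobian (G i)) _ eta0
  (sm_near_jacobian sF) (fun i => sm_near_jacobian (sG i)).
exists N, d; split => // x e theta Nx ed te _.
by apply: Heta; exact: H ed te.
Qed.

Lemma jacobian_scale m n (b : R) (f : 'rV[R]_m -> 'rV[R]_n) c :
  differentiable f c -> jacobian (fun x => b *: f x) c = b *: jacobian f c.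
Proof.
move=> df; apply/matrixP => i j; apply: (etrans (jacobian_entry (b *: f) c i j)).
apply: (etrans (congr1 (fun h : _ -> 'rV[R]_n => h (delta_mx 0 i) 0 j)
  (diffZ b df))).
have scaleE p q (M : 'M[R]_(p, q)) k l : (b *: M) k l = b * M k l by rewrite mxE.
apply: (etrans (scaleE _ _ _ 0 j)); apply: (etrans _ (esym (scaleE _ _ _ i j))).
by congr (_ * _); apply: esym; exact: jacobian_entry.
Qed.

Lemma jacobian_cst0 m n c : jacobian (fun=> 0 : 'rV[R]_n) c = 0 :> 'M[R]_(m, n).
Proof.
apply/matrixP => i j; apply: (etrans (jacobian_entry _ c i j)).
apply: (etrans (congr1 (fun h : _ -> 'rV[R]_n => h (delta_mx 0 i) 0 j)
  (diff_cst _ _))).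
by rewrite !mxE.
Qed.

Lemma jacobian_family m n (I : finType) (theta : I -> R)
    (G : I -> 'rV[R]_m -> 'rV[R]_n) c :
  (forall i, sm_near (G i) c) ->
  jacobian (fun x => \sum_i theta i *: G i x) c =
  \sum_i theta i *: jacobian (G i) c.
Proof.
move=> sG; elim: (index_enum I) => [|i s IH].
  rewrite (_ : (fun _ => _) = fun=> 0) ?big_nil ?jacobian_cst0//.
  by apply/funext => x; rewrite big_nil.
rewrite (_ : (fun _ => _) =
    fun x => theta i *: G i x + \sum_(i <- s) theta i *: G i x); last first.
  by apply/funext => x; rewrite big_cons.
have d1 : sm_near (fun x => theta i *: G i x) c.
  by apply: (@sm_near_scale _ _ _ (fun=> theta i)) => //; exact: sm_near_cst.
have d2 : sm_near (fun x => \sum_(i <- s) theta i *: G i x) c.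
  apply: sm_near_sum => j.
  by apply: (@sm_near_scale _ _ _ (fun=> theta j)) => //; exact: sm_near_cst.
rewrite big_cons -IH -(jacobian_scale _ (sm_near_differentiable (sG i))).
by apply: jacobian_add; exact: sm_near_differentiable.
Qed.

(** At a zero of [f] the term with the derivative of [b] drops out; so a factor without zeros
    changes neither the zeros nor their regularity. *)
Lemma jacobian_scale_zero m n (b : 'rV[R]_m -> R) (f : 'rV[R]_m -> 'rV[R]_n) c :
  differentiable b c -> differentiable f c -> f c = 0 ->
  jacobian (fun x => b x *: f x) c = b c *: jacobian f c.
Proof.
move=> db df f0; apply/matrixP => i j.
apply: (etrans (jacobian_entry _ c i j)).
have [_ E] := is_diff_scale db df.
apply: (etrans (congr1 (fun h : _ -> 'rV[R]_n => h (delta_mx 0 i) 0 j) E)) => /=.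
rewrite f0 scaler0 addr0.
have scaleE p q (M : 'M[R]_(p, q)) k l : (b c *: M) k l = b c * M k l by rewrite mxE.
apply: (etrans (scaleE _ _ _ 0 j)); apply: (etrans _ (esym (scaleE _ _ _ i j))).
by congr (_ * _); apply: esym; exact: jacobian_entry.
Qed.

Lemma row_full_scale m n (b : R) (J : 'M[R]_(m, n)) :
  b != 0 -> row_full J -> row_full (b *: J)%R.
Proof.
by move=> b0; rewrite /row_full (eqmx_scale _ b0).
Qed.

End RegularityInRm.

(** * Transversality by finitely many perturbations supported in charts *)

Section TransversePerturbation.
Context (R : realType) (M : manifold R) (E : vectType R).
Implicit Types (x y z : M) (f : M -> E).

Definition regular_at f x : Prop := f x = 0 -> limg (vdiff f x) = fullv.

Lemma local_vrepE f z y : mdom z y -> local_vrep f z (mchart z y) = v2r (f y).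
Proof. by move=> zy; rewrite /local_vrep /= mchartK. Qed.

Lemma v2r_eq0 (e : E) : v2r e = 0 <-> e = 0.
Proof.
split=> [|->]; last exact: linear0.
by move=> e0; apply: (can_inj v2rK); rewrite e0 linear0.
Qed.

Lemma regular_at_chart f z y : mdom z y -> smooth_at f y ->
  regular_at f y <-> (local_vrep f z (mchart z y) = 0 ->
                      row_full (jacobian (local_vrep f z) (mchart z y))).
Proof.
move=> zy sf; rewrite local_vrepE// -(regular_chart zy sf) /regular_at.
split=> H.
  by move=> /v2r_eq0/H/eqP.
by move=> /v2r_eq0/H/eqP.
Qed.

Definition perturb_family (I : finType) f (g : I -> M -> E) (theta : I -> R) y : E :=
  f y + \sum_i theta i *: g i y.

Lemma local_vrep_family (I : finType) f (g : I -> M -> E) theta z :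
  local_vrep (perturb_family f g theta) z =
  fun c => local_vrep f z c + \sum_i theta i *: local_vrep (g i) z c.
Proof.
apply/funext => c; rewrite /local_vrep /perturb_family /= linearD linear_sum.
by congr (_ + _); apply: eq_bigr => i _; rewrite linearZ.
Qed.

Lemma smooth_at_family (I : finType) f (g : I -> M -> E) theta y :
  smooth_at f y -> (forall i, smooth_at (g i) y) ->
  smooth_at (perturb_family f g theta) y.
Proof.
move=> sf sg; apply: smooth_at_add => //; apply: smooth_at_sum => i.
by apply: smooth_at_scale => //; exact: sm_near_cst.
Qed.

(** Local stability comes with a bound on the coefficients that depends on the point; compactness of
    [K] makes the bound uniform. *)
Lemma regular_at_stable (I : finType) f (g : I -> M -> E) (K : set M) :
  compact K -> (forall x, K x -> smooth_at f x) ->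
  (forall i x, smooth_at (g i) x) -> (forall x, K x -> regular_at f x) ->
  exists2 d : R, 0 < d & forall theta, (forall i, `|theta i| <= d) ->
    forall x, K x -> regular_at (perturb_family f g theta) x.
Proof.
move=> /compact_near_coveringP cK sf sg freg.
have H : \forall e \near (0 : R)^'+, forall x, K x -> forall theta,
    (forall i, `|theta i| <= e) -> regular_at (perturb_family f g theta) x.
  apply: cK => x Kx; have xx := mdom_mem x.
  have [N [d [Nc d0 HN]]] := regular_stable (sf x Kx) (fun i => sg i x)
    ((regular_at_chart xx (sf x Kx)).1 (freg x Kx)).
  exists ([set y | [/\ mdom x y, smooth_at f y & N (mchart x y)]],
          [set e | e < d]) => /=.
    split; last exact: nbhs_right_lt.
    have h1 := near_mdom xx; have h2 := smooth_at_near (sf x Kx).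
    have h3 := mchart_at xx Nc.
    near=> y; split; near: y => //.
  move=> [y e] /= [[xy sy Ny] ed] theta te.
  have syf : smooth_at (perturb_family f g theta) y by exact: smooth_at_family.
  apply/(regular_at_chart xy syf); rewrite local_vrep_family => /(HN _ e theta Ny ed te).
  have s1 := (smooth_at_chart f xy).1 sy.
  have s2 i := (smooth_at_chart (g i) xy).1 (sg i y).
  rewrite jacobian_add ?jacobian_family//.
    exact: sm_near_differentiable.
  apply: sm_near_differentiable; apply: sm_near_sum => i.
  by apply: (@sm_near_scale _ _ _ (fun=> theta i)) => //; exact: sm_near_cst.
near (0 : R)^'+ => e; exists e; first by near: e; exact: nbhs_right_gt.
move=> theta te x Kx; move: x Kx theta te.
by near: e.
Unshelve. all: by end_near. Qed.

Local Notation n := (dim E).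
Local Notation m := (mdim M).

(** The basis of the affine maps c |-> p + c P in the chart at [x], cut off by the bump: the left
    summand indexes the entries of p, the right one those of P. *)
Definition affine_family x (r : R) (i : 'I_n + 'I_m * 'I_n) y : E :=
  chart_bump x r y *: match i with
    | inl j => r2v (delta_mx 0 j)
    | inr (k, j) => (mchart x y) 0 k *: r2v (delta_mx 0 j)
  end.

Section Ball.
Context (x : M) (O : set M) (r : R).
Hypotheses (r0 : 0 < r)
  (rO : cball (mchart x x) r `<=` mchart x @` (mdom x `&` O)).

Lemma affine_family_smooth i y : smooth_at (affine_family x r i) y.
Proof.
have rO' : cball (mchart x x) r `<=` mchart x @` (mdom x `&` mdom x).
  by move=> c /rO[z [xz _] <-]; exists z.
apply: (smooth_at_bump_scale r0 rO') => z xz.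
case: i => [j|[k j]]; first exact: smooth_at_cst.
apply/(smooth_at_chart _ xz).
pose h (c : 'rV[R]_m) : 'rV[R]_n := c 0 k *: delta_mx 0 j.
pose l (y0 : M) : E := mchart x y0 0 k *: r2v (delta_mx 0 j).
have H : \forall c \near mchart x z, h c = local_vrep l x c.
  apply: filterS (near_mchartVK xz) => c cE.
  by rewrite /local_vrep /l /= cE linearZ /= r2vK.
apply: sm_near_eq H _.
exists setT; split => // [|q]; first exact: openT.
apply: CK_scale; [exact: openT| |exact: (CK_cst _ _ (delta_mx 0 j))].
by apply: (@CK_coord _ _ _ _ _ _ (@idfun 'rV[R]_m)); [exact: openT|exact: CK_id].
Qed.

Lemma affine_family_out i y : ~ chart_cball x r y -> affine_family x r i y = 0.
Proof. by move=> /(chart_bump_out r0) h; rewrite /affine_family h scale0r. Qed.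

Lemma affine_family_bound i y :
  `|v2r (affine_family x r i y)| <= 1 + (`|mchart x x| + r).
Proof.
have b0 : 0 <= `|mchart x x| + r by rewrite addr_ge0// ltW.
have [yr|yr] := pselect (chart_cball x r y); last first.
  by rewrite affine_family_out// linear0 normr0 addr_ge0.
have bump1 : `|chart_bump x r y| <= 1.
  rewrite ger0_norm ?chart_bump_ge0// /chart_bump; case: ifP => // _.
  have fl t : flat 0 t <= 1 :> R.
    rewrite /flat; case: ifP => // t0; rewrite expr0 mul1r -expR0 ler_expR.
    by rewrite oppr_le0 invr_ge0 ltW.
  apply: (@le_trans _ _ (\prod_(k < m) (1 : R))); last by rewrite big1_eq.
  apply: ler_prod => k _.
  by rewrite mulr_ge0 ?flat_ge0//= mulr_ile1// flat_ge0.
have dl j : `|delta_mx 0 j : 'rV[R]_n| <= 1.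
  by apply: mx_norm_le => // a b; rewrite mxE; case: (_ && _); rewrite ?normr1 ?normr0.
have yx : `|mchart x y| <= `|mchart x x| + r.
  apply: norm_le_of_dist; case: yr => c cr <-.
  by have [z [xz _] zc] := rO cr; move: cr; rewrite -zc mchartK.
rewrite /affine_family linearZ /= normrZ.
case: i => [j|[k j]].
  rewrite r2vK (le_trans (ler_pM _ _ bump1 (dl j)))// mul1r.
  by rewrite lerDl.
rewrite linearZ /= normrZ r2vK.
have h : `|mchart x y 0 k| * `|delta_mx 0 j : 'rV[R]_n| <= `|mchart x x| + r.
  rewrite -[leRHS]mulr1 ler_pM//.
  exact: le_trans (mx_entry_le _ _ _) yx.
rewrite (le_trans (ler_pM _ _ bump1 h))// ?mulr_ge0// mul1r.
by rewrite lerDr.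
Qed.

End Ball.

Lemma sm_near_CK (V W : normedModType R) (F : V -> W) (A : set V) k :
  (forall c, A c -> sm_near F c) -> CK k A F.
Proof.
move=> AF; apply: (@CK_subset _ _ _ _ [set c | exists i : {c | A c}, c = sval i]).
  by move=> c Ac; exists (exist _ c Ac).
apply: CK_bigcup => -[c Ac] /=.
have [B [oB Bc BF]] := AF c Ac.
by apply: CK_subset (BF k) => _ ->.
Qed.

Lemma affine_family_sum x (r : R) (p : 'rV[R]_n) (P : 'M[R]_(m, n)) y :
  v2r (\sum_i (match i with inl j => p 0 j | inr (k, j) => P k j end) *:
       affine_family x r i y) =
  chart_bump x r y *: (p + mchart x y *m P).
Proof.
rewrite linear_sum big_sumType /= scalerDr; congr (_ + _).
  rewrite {2}(row_sum_delta p) scaler_sumr; apply: eq_bigr => j _.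
  by rewrite linearZ /= /affine_family linearZ /= r2vK !scalerA mulrC.
transitivity (\sum_k \sum_j v2r (P k j *: affine_family x r (inr (k, j)) y)).
  by rewrite pair_bigA; apply: eq_bigr => -[k j] _.
rewrite (row_sum_delta (_ *m P)) scaler_sumr exchange_big /=.
apply: eq_bigr => j _; rewrite mxE scaler_suml scaler_sumr.
apply: eq_bigr => k _.
rewrite /affine_family !scalerA linearZ /= r2vK.
by congr (_ *: _); ring.
Qed.

(** The available perturbation is b (p + c P) with the bump b, which is not affine. Writing f + b (p
    + c P) = b (f / b + p + c P) where b > 0 reduces the claim to affine perturbations of f / b. *)
Lemma local_affine_perturbation f x (O : set M) (r e : R) :
  0 < r -> cball (mchart x x) r `<=` mchart x @` (mdom x `&` O) ->
  (forall y, O y -> smooth_at f y) -> 0 < e ->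
  exists theta, (forall i, `|theta i| <= e) /\
    forall y, chart_cball x (r / 2) y ->
      regular_at (perturb_family f (affine_family x r) theta) y.
Proof.
move=> r0 rO Of e0.
set a := mchart x x in rO *.
pose A := ball a r.
have oA : open A by exact: ball_open.
have AO c : A c -> exists y, [/\ mdom x y, O y & mchart x y = c].
  rewrite /A -ball_normE /ball_ /= => /ltW/rO[y [xy Oy] yc].
  by exists y.
pose F := local_vrep f x.
have sF c : A c -> sm_near F c.
  move=> /AO[y [xy Oy <-]]; apply/(smooth_at_chart f xy); exact: Of.
pose H c := (box a r c)^-1 *: F c.
have box0 c : A c -> 0 < box a r c.
  by rewrite /A -ball_normE => h; exact: box_gt0.
have AH k : CK k A H.
  apply: CK_scale => //; last exact: sm_near_CK.
  apply: CK_inv => //; first by move=> c /box0; exact: lt0r_neq0.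
  by apply: CK_subset (CK_box a r k).
(* Between r/2, where regularity is claimed, and r, where the bump vanishes and f / b is no longer
   defined. *)
have r'0 : 0 < 3 / 4 * r by rewrite mulr_gt0.
have r'A : cball a (3 / 4 * r) `<=` A.
  move=> c; rewrite /A -ball_normE /ball_ /cball /= => /le_lt_trans; apply; lra.
have [p [P [pe Pe HpP]]] := affine_perturbation_regular oA r'0 r'A AH e0.
pose theta (i : 'I_n + 'I_m * 'I_n) : R :=
  match i with inl j => p 0 j | inr (k, j) => P k j end.
exists theta; split.
  by case=> [j|[k j]] /=; exact: le_trans (mx_entry_le _ _ _) _.
move=> y [c cr yc].
have Ac : A c by apply: r'A; rewrite /cball /= (le_trans cr)//; lra.
have c34 : ball a (3 / 4 * r) c.
  by rewrite -ball_normE /ball_ /= (le_lt_trans cr)//; lra.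
have [y' [xy' Oy' y'c]] := AO c Ac.
have yE : y = y' by rewrite -yc -y'c mchartK.
subst y'.
have sfy := Of y Oy'.
have sg i z : smooth_at (affine_family x r i) z.
  exact: affine_family_smooth r0 rO i z.
have sy : smooth_at (perturb_family f (affine_family x r) theta) y.
  exact: smooth_at_family.
apply/(regular_at_chart xy' sy); rewrite y'c.
pose L c := H c + (p + c *m P).
have sH c' : A c' -> sm_near H c' by exists A.
have rep : \forall c' \near c, box a r c' *: L c' =
    local_vrep (perturb_family f (affine_family x r) theta) x c'.
  have h1 : \forall c' \near c, A c' by exact: open_nbhs_nbhs.
  have h2 := chart_bump_rep r xy'; rewrite y'c in h2.
  have h3 := near_mchartVK xy'; rewrite y'c in h3.
  near=> c'.
  have Ac' : A c' by near: c'.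
  rewrite /L /H scalerDr scalerA mulfV ?scale1r; last exact/lt0r_neq0/box0.
  have e1 : chart_bump x r (@mchartV _ M x c') = box a r c' by near: c'.
  have e2 : mchart x (@mchartV _ M x c') = c' by near: c'.
  have := affine_family_sum x r p P (@mchartV _ M x c').
  rewrite e1 e2 => <-; rewrite /local_vrep /perturb_family /=.
  by rewrite [RHS](linearD v2r).
have rep0 := nbhs_singleton rep.
rewrite -rep0 => /eqP; rewrite scaler_eq0 (gt_eqF (box0 c Ac)) /= => /eqP Lc0.
have sP : sm_near (fun c : 'rV[R]_m => p + c *m P) c.
  have -> : (fun c : 'rV[R]_m => p + c *m P) = affine P 0 p.
    by apply/funext => c'; rewrite /affine subr0.
  by exists setT; split => // [|k]; [exact: openT|apply: CK_affine; exact: openT].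
have dP : jacobian (fun c : 'rV[R]_m => p + c *m P) c = P.
  have -> : (fun c : 'rV[R]_m => p + c *m P) = affine P 0 p.
    by apply/funext => c'; rewrite /affine subr0.
  apply/row_matrixP => i.
  rewrite !rowE -jacobian_mul; have [_ dE] := is_diff_affine P 0 p c.
  exact: (congr1 (fun h : _ -> 'rV[R]_n => h (delta_mx 0 i)) dE).
have dL : jacobian L c = jacobian H c + P.
  rewrite -[in RHS]dP; apply: jacobian_add; apply: sm_near_differentiable => //.
  exact: sH.
have sL : sm_near L c by apply: sm_near_add => //; exact: sH.
have sbox : sm_near (box a r) c.
  by exists setT; split => // [|k]; [exact: openT|exact: CK_box].
have -> : jacobian (local_vrep (perturb_family f (affine_family x r) theta) x) c =
    jacobian (fun c' => box a r c' *: L c') c.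
  apply: near_eq_jacobian rep _; apply: sm_near_differentiable.
  exact: sm_near_scale.
rewrite (jacobian_scale_zero (sm_near_differentiable sbox)
  (sm_near_differentiable sL) Lc0).
apply: row_full_scale; first exact/lt0r_neq0/box0.
by rewrite dL; apply: HpP => //; rewrite -Lc0 /L addrA.
Unshelve. all: by end_near. Qed.

Lemma regular_at_near f x :
  smooth_at f x -> regular_at f x -> \forall y \near x, regular_at f y.
Proof.
move=> sf rf; have xx := mdom_mem x.
(* Stability for the empty family of perturbations says that regularity is an open condition. *)
have [N [d [Nc d0 HN]]] := @regular_stable R _ _ void _ (fun=> fun=> 0) _ sf
  (fun i => sm_near_cst _ _) ((regular_at_chart xx sf).1 rf).
have h1 := near_mdom xx; have h2 := smooth_at_near sf.
have h3 := mchart_at xx Nc.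
near=> y.
have xy : mdom x y by near: y.
have sy : smooth_at f y by near: y.
apply/(regular_at_chart xy sy).
have Ny : N (mchart x y) by near: y.
have := HN (mchart x y) 0 (fun=> 0) Ny d0.
have void_sum (V : nmodType) (F : void -> V) : \sum_i F i = 0.
  by apply: big1 => -[].
by rewrite !void_sum !addr0; apply; case.
Unshelve. all: by end_near. Qed.

(** The part of [K] not covered by finitely many coordinate balls inside [W] is compact and consists
    of regular points. The balls are then treated one after the other; each new perturbation is so
    small that the regularity already reached, on a compact set, persists. *)
Lemma transverse_perturbation f (K W : set M) (e : R) :
  compact K -> open W -> (forall x, K x -> smooth_at f x) ->
  (forall x, K x -> regular_at f x \/ W x) -> 0 < e ->
  exists g : M -> E, [/\ forall y, smooth_at g y, forall y, ~ W y -> g y = 0,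
    forall y, `|v2r (g y)| <= e &
    forall x, K x -> regular_at (fun y => f y + g y) x].
Proof.
move=> cK oW sf reg e0.
pose O := W `&` [set y | smooth_at f y].
have [r Hr] : exists r : M -> R, forall x, K x -> W x -> 0 < r x /\
    cball (mchart x x) (r x) `<=` mchart x @` (mdom x `&` O).
  have : forall x, exists s : R, K x -> W x -> 0 < s /\
    cball (mchart x x) s `<=` mchart x @` (mdom x `&` O).
    move=> x; have [[Kx Wx]|n] := pselect (K x /\ W x); last first.
      by exists 1 => Kx Wx; exfalso; exact: n.
    have xO : nbhs x O.
      by apply: filterI; [exact: open_nbhs_nbhs|exact: smooth_at_near (sf x Kx)].
    by have [s s0 sO] := chart_radius xO; exists s.
  by move=> /choice[r Hr]; exists r.
(* The covering uses balls of half the radius, since a perturbation supported in the ball of radius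
   r achieves regularity in that of radius r/2. *)
have Hr2 x : K x -> W x -> 0 < r x / 2 /\
    cball (mchart x x) (r x / 2) `<=` mchart x @` (mdom x `&` O).
  move=> Kx Wx; have [r0 rO] := Hr x Kx Wx; split; first by rewrite divr_gt0.
  by move=> c cr; apply: rO; rewrite /cball /= (le_trans cr)//; lra.
pose B x := [set y | 0 < chart_bump x (r x / 2) y].
pose N x := [set y | (W x /\ B x y) \/ (~ W x /\ regular_at f y)].
have cover : (forall x, K x -> nbhs x (N x)).
  move=> x Kx; have [Wx|nW] := pselect (W x).
    have [r0 rO] := Hr2 x Kx Wx.
    by apply: filterS (near_chart_bump_gt0 r0 rO) => y By; left.
  have [rx|//] := reg x Kx.
  by apply: filterS (regular_at_near (sf x Kx) rx) => y ry; right.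
have [s [sK Ks]] := finite_subcover cK cover.
pose sW := [seq z <- s | `[< W z >]].
have sWP z : z \in sW -> K z /\ W z.
  by rewrite mem_filter => /andP[/asboolP Wz /sK].
pose U := [set y | exists2 z, z \in sW & B z y].
have oU : open U.
  rewrite openE => y [z zs Bzy]; have [Kz Wz] := sWP z zs.
  have [r0 rO] := Hr2 z Kz Wz.
  have : \forall y' \near y, B z y'.
    apply: near_continuous_gt0 Bzy.
    exact: smooth_scalar_continuous (smooth_chart_bump r0 rO y).
  by apply: filterS => y' By'; exists z.
pose K0 := K `&` ~` U.
have cK0 : compact K0 by apply: compact_closedI => //; exact: open_closedC.
have K0reg x : K0 x -> regular_at f x.
  move=> [Kx nU]; have [z zs [[Wz Bx]|[_]//]] := Ks x Kx.
  by exfalso; apply: nU; exists z => //; rewrite mem_filter zs andbT; exact/asboolP.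
pose D t := foldr (fun z A => chart_cball z (r z / 2) `|` A) K0 t.
have KD x : K x -> D sW x.
  move=> Kx; have [Ux|nU] := pselect (U x); last first.
    have : K0 x by [].
    by elim: (sW) => [//|z t IH] h; right; exact: IH.
  case: Ux => z zs Bx; have [Kz Wz] := sWP z zs; have [r0 rO] := Hr2 z Kz Wz.
  have zx : chart_cball z (r z / 2) x.
    apply: contrapT => nzx; move: Bx.
    by rewrite /B /= (chart_bump_out r0 nzx) ltxx.
  elim: (sW) zs => [//|z' t IH]; rewrite inE => /orP[/eqP <-|zt]; first by left.
  by right; exact: IH.
suff : forall t, {subset t <= sW} -> forall e, 0 < e -> exists g : M -> E,
    [/\ forall y, smooth_at g y, forall y, ~ W y -> g y = 0,
    forall y, `|v2r (g y)| <= e &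
    forall x, D t x -> regular_at (fun y => f y + g y) x].
  move=> /(_ sW (fun _ => id) e e0)[g [g1 g2 g3 g4]]; exists g; split => // x /KD.
  exact: g4.
elim=> [|z t IH] ts {}e {}e0.
  exists (fun=> 0); split => // [y|y|x /K0reg].
  - exact: smooth_at_cst.
  - by rewrite linear0 normr0 ltW.
  - by rewrite (_ : (fun y => f y + 0) = f)//; apply/funext => y; rewrite addr0.
have [Kz Wz] := sWP z (ts z (mem_head z t)).
have {}ts : {subset t <= sW} by move=> w wt; apply: ts; rewrite inE wt orbT.
have e20 : 0 < e / 2 by rewrite divr_gt0.
have [g [g1 g2 g3 g4]] := IH ts (e / 2) e20.
pose f' y := f y + g y.
have sf' y : smooth_at f y -> smooth_at f' y by move=> fy; exact: smooth_at_add.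
have [r0 rO] := Hr z Kz Wz.
have [r20 r2O] := Hr2 z Kz Wz.
have Dcompact u : {subset u <= sW} -> compact (D u) /\
    forall y, D u y -> smooth_at f y.
  elim: u => [|w u IHu] us; first by split => // y [/sf].
  have [Kw Ww] := sWP w (us w (mem_head w u)); have [q0 qO] := Hr2 w Kw Ww.
  have us' : {subset u <= sW} by move=> v vu; apply: us; rewrite inE vu orbT.
  have [c1 c2] := IHu us'.
  split; first by apply: compactU => //; exact: chart_cball_compact qO.
  by move=> y [/(chart_cball_sub qO)[_ []]//|/c2].
have [cDt sDt] := Dcompact t ts.
have sg i y : smooth_at (affine_family z (r z) i) y.
  exact: affine_family_smooth r0 rO i y.
have [d d0 Hd] := regular_at_stable cDt (fun x Dx => sf' x (sDt x Dx)) sg g4.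
pose c := 1 + (`|mchart z z| + r z).
pose N' := #|{: 'I_(dim E) + 'I_(mdim M) * 'I_(dim E)}|%:R : R.
have c0 : 0 < c by rewrite ltr_wpDr// addr_ge0// ltW.
have cN0 : 0 < c * (N' + 1) by rewrite mulr_gt0// ltr_wpDl.
(* The bound [d] preserves regularity on [D t]; the other one keeps the sum of [N'] terms, each of
   norm at most [e1 * c], below e/2. *)
pose e1 := Num.min d (e / 2 / (c * (N' + 1))).
have e10 : 0 < e1 by rewrite lt_min d0 divr_gt0.
have [theta [te Hth]] := @local_affine_perturbation f' z O (r z) e1 r0 rO
  (fun y Oy => sf' y Oy.2) e10.
pose h y := \sum_i theta i *: affine_family z (r z) i y.
have out y : ~ W y -> forall i, affine_family z (r z) i y = 0.
  move=> nW i; apply: affine_family_out => //.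
  by move=> /(chart_cball_sub rO)[_ []].
exists (fun y => g y + h y); split.
- move=> y; apply: smooth_at_add => //; apply: smooth_at_sum => i.
  by apply: smooth_at_scale => //; exact: sm_near_cst.
- move=> y nW; rewrite g2// add0r /h big1// => i _.
  by rewrite out// scaler0.
- move=> y; rewrite linearD (le_trans (ler_normD _ _))//.
  rewrite [leRHS](splitr e); apply: lerD; first exact: g3.
  rewrite /h linear_sum (eq_bigr (fun i => theta i *: v2r (affine_family z (r z) i y))).
    rewrite (le_trans (norm_family_le _ te))//.
    apply: (@le_trans _ _ (e1 * (N' * c))).
      rewrite ler_wpM2l// ?(ltW e10)//.
      rewrite /N' mulr_natl -sumr_const; apply: ler_sum => i _.
      exact: affine_family_bound r0 rO i y.
    apply: (@le_trans _ _ (e / 2 / (c * (N' + 1)) * (N' * c))).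
      by rewrite ler_wpM2r ?mulr_ge0 ?(ltW c0)// ge_min lexx orbT.
    rewrite -mulrA ler_piMr ?(ltW e20)// mulrC ler_pdivrMr// mul1r mulrC.
    by rewrite ler_wpM2l ?(ltW c0)// lerDl.
  by move=> i _; rewrite linearZ.
- move=> x; rewrite (_ : (fun y => f y + (g y + h y)) =
    perturb_family f' (affine_family z (r z)) theta); last first.
    by apply/funext => y; rewrite /perturb_family /f' addrA.
  case=> [|Dx]; first exact: Hth.
  apply: Hd => // i; rewrite (le_trans (te i))// ge_min lexx//.
Qed.

End TransversePerturbation.

(** * Smooth maps between manifolds *)

Section SmoothMaps.
Context (R : realType) (M N : manifold R).
Implicit Types (x : M) (A : set M) (f : M -> N).

Lemma smooth_map_near A f x : smooth_map A f -> A x ->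
  {for x, continuous f} /\ sm_near (local_rep f x) (mchart x x).
Proof.
move=> sf Ax; have [fc [B [oB Bx _ sB]]] := sf x Ax; split => //.
exact: sm_near_smooth_on sB.
Qed.

Lemma local_repE f x : local_rep f x (mchart x x) = mchart (f x) (f x).
Proof. by rewrite /local_rep /= mchartK//; exact: mdom_mem. Qed.

Lemma near_local_rep_comp (E : vectType R) f (g : N -> E) x :
  {for x, continuous f} ->
  \forall c \near mchart x x,
    (local_vrep g (f x) \o local_rep f x) c = local_vrep (g \o f) x c.
Proof.
move=> fc; have H := fc _ (near_mdom (mdom_mem (f x))).
have H2 := near_mchart (mdom_mem x) H.
by apply: filterS H2 => c fcd; rewrite /local_vrep /local_rep /= mchartK.
Qed.

Lemma tangent_mapE f x u :
  tangent_map f x u = u *m jacobian (local_rep f x) (mchart x x).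
Proof. by rewrite /tangent_map lfunE /= jacobian_mul. Qed.

Lemma vdiff_comp (E : vectType R) A f (g : N -> E) x u :
  smooth_map A f -> A x -> smooth_at g (f x) ->
  vdiff (g \o f) x u = vdiff g (f x) (tangent_map f x u).
Proof.
move=> sf Ax sg; have [fc sfx] := smooth_map_near sf Ax.
have dg : differentiable (local_vrep g (f x)) (local_rep f x (mchart x x)).
  by rewrite local_repE; exact: sm_near_differentiable.
have df := sm_near_differentiable sfx.
apply: (etrans (vdiffE (g \o f) x u)).
apply: (etrans _ (esym (vdiffE g (f x) _))); rewrite tangent_mapE -mulmxA.
apply: (congr1 (fun J => r2v (u *m J))).
rewrite (near_eq_jacobian (near_local_rep_comp g fc)).
  by rewrite (jacobian_comp df dg) local_repE.
exact: differentiable_comp.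
Qed.

(** The left inverse of an immersion, read in the charts at [x] and [f x]. Its smoothness is
    recorded only through composition, which is the form in which sections are transported by it. *)
Lemma local_left_inverse A f x : smooth_map A f -> A x ->
  lker (tangent_map f x) = 0%VS ->
  exists r : N -> M, [/\ r (f x) = x, {for f x, continuous r},
    \forall z \near x, r (f z) = z &
    forall (E : vectType R) (g : M -> E), smooth_at g x -> smooth_at (g \o r) (f x)].
Proof.
move=> sf Ax kf; have [fc sfx] := smooth_map_near sf Ax.
have [B [oB Bx BF]] := sfx.
have inj v : 'd (local_rep f x) (mchart x x) v = 0 -> v = 0.
  move=> dv; have : v \in lker (tangent_map f x).
    by rewrite memv_ker tangent_mapE -jacobian_mul dv.
  by rewrite kf memv0 => /eqP.
have [D [q [oD Dx Dq qK]]] := immersion_left_inverse oB Bx BF inj.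
rewrite local_repE in Dx.
have q0 : q (mchart (f x) (f x)) = mchart x x.
  by rewrite -local_repE; exact: nbhs_singleton qK.
have sq : sm_near q (mchart (f x) (f x)) by exists D.
have fxx := mdom_mem (f x); have xx := mdom_mem x.
exists (@mchartV _ M x \o q \o mchart (f x)); split.
- by rewrite /= q0 mchartK.
- apply: continuous_comp; first exact: mchart_at.
  apply: continuous_comp; first exact: sm_near_continuous.
  by rewrite q0; exact: mchartV_at.
- have H1 := fc _ (near_mdom fxx).
  have H2 := near_mdom xx.
  have H3 := mchart_at xx qK.
  near=> z.
  have fz : mdom (f x) (f z) by near: z.
  have xz : mdom x z by near: z.
  have : q (local_rep f x (mchart x z)) = mchart x z by near: z.
  by rewrite /local_rep /= mchartK// => ->; rewrite mchartK.
- move=> E g sg.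
  apply: (@sm_near_eq _ _ _ (local_vrep g x \o q)).
    apply: filterS (near_mchartVK fxx) => c cE.
    by rewrite /local_vrep /= cE.
  by apply: sm_near_comp => //; rewrite q0.
Unshelve. all: by end_near. Qed.

End SmoothMaps.

Arguments disjoint_union {R X} K.
Arguments single {R X K}.
Arguments idx_sub {R X K}.
Arguments idx_psub {R X K}.
Arguments size_idx {R X K}.
Arguments sec {R X K}.
Arguments sum_map {R X K}.
Arguments step {R X} K.
Arguments piK {R X K}.
Arguments pull {R X K}.
Arguments perturbed {R X K}.
Arguments nbhdU {R X K} d {I}.
Arguments Vk {R X K}.
Arguments Nk {R X K}.
Arguments eta {R}.
Arguments Ctilde {R X K}.
Arguments delta_condition {R X K}.

(** * Tame atlases *)

Section TameAtlas.
Context (R : realType) (X : topologicalType) (K : atlas R X).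
Implicit Types (I J H L : aidx K).

Lemma idx_sub_eqVp I J : idx_sub I J -> I = J \/ idx_psub I J.
Proof.
rewrite /idx_sub /idx_psub finset.subEproper => /orP[/eqP IJ|]; last by right.
by left; exact/val_inj.
Qed.

Lemma idx_psubW I J : idx_psub I J -> idx_sub I J.
Proof. exact: fintype.proper_sub. Qed.

Lemma idx_sub_trans J I L : idx_sub I J -> idx_sub J L -> idx_sub I L.
Proof. exact: fintype.subset_trans. Qed.

Lemma idx_psub_size I J : idx_psub I J -> (size_idx I < size_idx J)%N.
Proof. exact: proper_card. Qed.

Lemma idx_sub_refl I : idx_sub I I.
Proof. exact: subxx. Qed.

Lemma aphihat_ker I J : idx_sub I J -> lker (aphihat K I J) = 0%VS.
Proof.
case/idx_sub_eqVp => [<-|/a_change[[_ _ _]] //].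
apply/eqP; rewrite -subv0; apply/subvP => v.
by rewrite memv_ker aphihat_id memv0.
Qed.

Lemma aphihat_inj I J : idx_sub I J -> injective (aphihat K I J).
Proof. by move=> /aphihat_ker k0; apply/lker0P; rewrite k0. Qed.

Lemma aphihat_comp I J L e : idx_sub I J -> idx_sub J L ->
  aphihat K J L (aphihat K I J e) = aphihat K I L e.
Proof.
case/idx_sub_eqVp => [<-|IJ]; first by rewrite aphihat_id.
case/idx_sub_eqVp => [<-|JL]; first by rewrite aphihat_id.
by have [-> ] := a_cocycle _ _ _ _ _ _ IJ JL.
Qed.

Lemma aphihat_limgS I J L e : idx_sub I J -> idx_sub J L ->
  e \in limg (aphihat K I L) -> e \in limg (aphihat K J L).
Proof.
move=> IJ JL /memv_imgP[v _ ->]; rewrite -(aphihat_comp v IJ JL).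
by apply: memv_img; exact: memvf.
Qed.

Lemma aU_trans I J L x : idx_sub I J -> idx_sub J L ->
  aU K I J x -> aU K J L (aphi K I J x) -> aU K I L x.
Proof.
case/idx_sub_eqVp => [<-|IJ]; first by rewrite aphi_id.
case/idx_sub_eqVp => [<- //|JL] IJx JLx.
by have [_ + _] := a_cocycle _ _ _ _ _ _ IJ JL; apply.
Qed.

Lemma aphi_comp I J L x : idx_sub I J -> idx_sub J L ->
  aU K I J x -> aU K J L (aphi K I J x) ->
  aphi K J L (aphi K I J x) = aphi K I L x.
Proof.
case/idx_sub_eqVp => [<-|IJ]; first by rewrite aphi_id.
case/idx_sub_eqVp => [<-|JL] IJx JLx; first by rewrite aphi_id.
by have [_ _] := a_cocycle _ _ _ _ _ _ IJ JL; apply.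
Qed.

Lemma sec_aphi I J x : idx_sub I J -> aU K I J x ->
  sec J (aphi K I J x) = aphihat K I J (sec I x).
Proof.
case/idx_sub_eqVp => [<-|/a_change[_ [+ _ _ _]]]; first by rewrite aphi_id aphihat_id.
exact.
Qed.

Lemma aU_open I J : idx_sub I J -> open (aU K I J).
Proof.
by case/idx_sub_eqVp => [<-|/a_change[[]]//]; rewrite aU_id; exact: openT.
Qed.

Lemma aphi_continuous I J x : idx_sub I J -> aU K I J x ->
  {for x, continuous (aphi K I J)}.
Proof.
case/idx_sub_eqVp => [<- _|/a_change[[_ _ [+ _ _] _] _]].
  rewrite (_ : aphi K I I = id); first exact: cvg_id.
  by apply/funext => y; rewrite aphi_id.
by move=> sm /sm[].
Qed.

Lemma piK_aphi I J x : idx_sub I J -> aU K I J x ->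
  piK J (aphi K I J x) = piK I x.
Proof.
case/idx_sub_eqVp => [<-|IJ xIJ]; first by rewrite aphi_id.
rewrite /piK /quotient_proj; apply/eqmodP; apply/asboolP; apply: rst_sym.
exact: rst_step.
Qed.

Hypothesis K_tame : tame K.

(** The second tameness equality with L = J, where U_JJ is all of U_J: the image of phi_IJ is the
    closed set s_J^-1(E_I). *)
Lemma image_aphi I J y : idx_sub I J -> sec J y \in limg (aphihat K I J) ->
  exists2 x, aU K I J x & aphi K I J x = y.
Proof.
move=> IJ sy; have [_ _ /(_ I J J IJ (idx_sub_refl J)) E] := K_tame.
have : (aU K J J `&` [set y | sec J y \in limg (aphihat K I J)]) y.
  by split => //; rewrite aU_id.
by rewrite -E => -[x xIJ <-]; exists x.
Qed.

Let joined (p q : disjoint_union K) : Prop := exists L,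
  [/\ idx_sub (projT1 p) L, idx_sub (projT1 q) L,
      aU K (projT1 p) L (projT2 p), aU K (projT1 q) L (projT2 q) &
      aphi K (projT1 p) L (projT2 p) = aphi K (projT1 q) L (projT2 q)].

(** If the middle point lies in U_JL1 and U_JL2, the first tameness equality puts it in U_JL with L
    the union of L1 and L2, and the second one carries both common images on to U_L. *)
Let joined_trans p q r : joined p q -> joined q r -> joined p r.
Proof.
case: p q r => [I x] [J y] [H z] [L1 /= [IL1 JL1 xL1 yL1 xy]] [L2 /= [JL2 HL2 yL2 zL2 yz]].
have [_ tame2 tame3] := K_tame.
have : (aU K J L1 `&` aU K J L2) y by [].
rewrite (tame2 J L1 L2 JL1 JL2) => -[L [LE yL]].
have L1L : idx_sub L1 L by rewrite /idx_sub LE finset.subsetUl.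
have L2L : idx_sub L2 L by rewrite /idx_sub LE finset.subsetUr.
have JL := idx_sub_trans JL1 L1L.
have up M : idx_sub J M -> idx_sub M L -> aU K M L (aphi K J M y).
  move=> JM ML.
  have : (aphi K J M @` aU K J L) (aphi K J M y) by exists y.
  by rewrite (tame3 J M L JM ML) => -[].
have l1 := up L1 JL1 L1L; have l2 := up L2 JL2 L2L.
have x1 : aU K L1 L (aphi K I L1 x) by rewrite xy.
have z2 : aU K L2 L (aphi K H L2 z) by rewrite -yz.
exists L; split => /=.
- exact: idx_sub_trans IL1 L1L.
- exact: idx_sub_trans HL2 L2L.
- exact: aU_trans IL1 L1L xL1 x1.
- exact: aU_trans HL2 L2L zL2 z2.
- rewrite -(aphi_comp IL1 L1L xL1 x1) xy (aphi_comp JL1 L1L yL1 l1).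
  by rewrite -(aphi_comp HL2 L2L zL2 z2) -yz (aphi_comp JL2 L2L yL2 l2).
Qed.

Lemma piK_eqP I J x y : piK I x = piK J y -> exists L,
  [/\ idx_sub I L, idx_sub J L, aU K I L x, aU K J L y &
      aphi K I L x = aphi K J L y].
Proof.
move=> /eqmodP/asboolP.
suff main p q : clos_refl_sym_trans (disjoint_union K) (step K) p q -> joined p q.
  by move=> /main.
elim=> {p q} [p q [pq pU pE]|p|p q _ [L [h1 h2 h3 h4 h5]]|p q r _ + _].
- exists (projT1 q); split; [exact: idx_psubW|exact: idx_sub_refl|exact: pU| |].
    by rewrite aU_id.
  by rewrite aphi_id.
- exists (projT1 p); split; rewrite ?aU_id//; exact: idx_sub_refl.
- by exists L; split.
- exact: joined_trans.
Qed.

Context (d : realization K -> realization K -> R).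
Hypothesis d_adm : admissible_metric d.

Lemma d_metric : is_metric d. Proof. by case: d_adm. Qed.

Lemma piK_inj I (x y : dom K I) : piK I x = piK I y -> x = y.
Proof.
move=> xy; have [_ _ /(_ I)[[_ /(_ x y)[+ _] _ _] _]] := d_adm; apply.
by rewrite /pull xy; have [_ /(_ (piK I y) (piK I y))[_ ->]] := d_metric.
Qed.

(** In a common chart L both points have the same image, so s_J(y) lies in E_I by injectivity of
    phihat_JL. By tameness [y] is then the image of some point of U_I, and this point is [x] because
    the pulled-back metric separates the points of U_I. *)
Lemma piK_aphiP I J x y : idx_sub I J -> piK I x = piK J y ->
  aU K I J x /\ aphi K I J x = y.
Proof.
move=> IJ xy; have [L [IL JL xL yL E]] := piK_eqP xy.
have : sec J y \in limg (aphihat K I J).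
  have h := sec_aphi JL yL; rewrite -E sec_aphi// in h.
  have : aphihat K J L (sec J y) \in limg (aphihat K I L).
    by rewrite -h; apply: memv_img; exact: memvf.
  case/memv_imgP => v _; rewrite -(aphihat_comp v IJ JL) => /(aphihat_inj JL) ->.
  by apply: memv_img; exact: memvf.
move=> /(image_aphi IJ)[x' xx' E'].
have : piK I x' = piK I x by rewrite xy -E' piK_aphi.
by move=> /piK_inj <-.
Qed.

Lemma d_sym p q : d p q = d q p. Proof. by have [_ _ + _] := d_metric; apply. Qed.
Lemma d_trans p q r : d p r <= d p q + d q r.
Proof. by have [_ _ _] := d_metric; apply. Qed.
Lemma d_refl p : d p p = 0.
Proof. by have [_ /(_ p p)[_ ->]] := d_metric. Qed.

Lemma near_dist I (x : dom K I) (e : R) : 0 < e ->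
  \forall y \near x, d (piK I x) (piK I y) < e.
Proof.
move=> e0; have [_ _ /(_ I)[_ top]] := d_adm.
by apply/(top x); exists e.
Qed.

Lemma nbhs_dist I (x : dom K I) (A : set (dom K I)) : nbhs x A ->
  exists2 e : R, 0 < e & forall y, d (piK I x) (piK I y) < e -> A y.
Proof.
move=> xA; have [_ _ /(_ I)[_ top]] := d_adm.
by have [e e0 eA] := (top x A).1 xA; exists e => // y; exact: eA.
Qed.

Lemma closure_dist I (x : dom K I) (A : set (dom K I)) (e : R) :
  closure A x -> 0 < e -> exists2 y, A y & d (piK I x) (piK I y) < e.
Proof. by move=> /(_ _ (near_dist x _)) H e0; have [y [Ay h]] := H e e0; exists y. Qed.

Lemma nbhdU_near I (e : R) (A : set (dom K I)) (x : dom K I) :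
  nbhdU d e A x -> \forall y \near x, nbhdU d e A y.
Proof.
move=> [z Az xz]; have e0 : 0 < e - d (piK I x) (piK I z) by rewrite subr_gt0.
apply: filterS (near_dist x e0) => y h; exists z => //.
rewrite (le_lt_trans (d_trans (piK I y) (piK I x) (piK I z)))//.
by rewrite -ltrBrDr d_sym.
Qed.

Lemma nbhdU_open I (e : R) (A : set (dom K I)) : open (nbhdU d e A).
Proof. by rewrite openE => x; exact: nbhdU_near. Qed.

End TameAtlas.

(** * Norms on the obstruction spaces *)

Section AdditiveNorms.
Context (R : realType) (X : topologicalType) (K : atlas R X).
Context (nrm : forall I : aidx K, obs K I -> R).
Arguments nrm : clear implicits.
Hypotheses (K_additive : additive_atlas R X K) (nrm_additive : additive_norms nrm).
Implicit Types (I J : aidx K).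

Let part I := forall i : {i : 'I_(aN K) | i \in val I}, obs K (single (val i)).

(** Components are extended by 0 to all basic indices, so that decompositions over different index
    sets can be compared. *)
Let extend I (e : part I) (i : 'I_(aN K)) : obs K (single i) :=
  if @idP (i \in val I) is ReflectT p then e (exist _ i p) else 0.

Let extendE I (e : part I) j : extend e (val j) = e j.
Proof.
case: j => i p; rewrite /extend /=; case: {-}_ / idP => [p'|//].
by rewrite (bool_irrelevance p' p).
Qed.

Let extend_out I (e : part I) i : i \notin val I -> extend e i = 0.
Proof. by rewrite /extend; case: {-}_ / idP => // p /negP. Qed.

Let sum_map_extend I (e : part I) :
  sum_map I e = \sum_(i in val I) aphihat K (single i) I (extend e i).
Proof.
by rewrite big_sub; apply: eq_bigr => j _; rewrite extendE.
Qed.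

Lemma sum_mapP I (v : obs K I) : exists e : part I, sum_map I e = v.
Proof. by have [g _ gK] := K_additive I; exists (g v). Qed.

Let single_norm i : is_norm (nrm (single i)).
Proof. by case: nrm_additive => + _; apply. Qed.

Let single_hom i a u : nrm (single i) (a *: u) = `|a| * nrm (single i) u.
Proof. by case: (single_norm i). Qed.

Let single_tri i u v :
  nrm (single i) (u + v) <= nrm (single i) u + nrm (single i) v.
Proof. by case: (single_norm i). Qed.

Let single_norm0 i : nrm (single i) 0 = 0.
Proof. by have [_ /(_ 0 0) + _] := single_norm i; rewrite scale0r normr0 mul0r. Qed.

Let nrm_sum I (e : part I) : nrm I (sum_map I e) =
  \big[Num.max/0]_(i : {i : 'I_(aN K) | i \in val I}) nrm (single (val i)) (e i).
Proof. by case: nrm_additive => _; apply. Qed.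

Lemma nrm_ge0 I v : 0 <= nrm I v.
Proof.
have [e <-] := sum_mapP v; rewrite nrm_sum.
by elim/big_rec: _ => // i x _ x0; rewrite le_max x0 orbT.
Qed.

Let nrm_part I (e : part I) i : nrm (single (val i)) (e i) <= nrm I (sum_map I e).
Proof. rewrite nrm_sum; exact: (le_bigmax (0 : R) (fun i => nrm _ (e i)) i). Qed.

Let nrm_extend I (e : part I) i : nrm (single i) (extend e i) <= nrm I (sum_map I e).
Proof.
rewrite /extend; case: {-}_ / idP => [p|_]; last by rewrite single_norm0 nrm_ge0.
exact: (nrm_part e (exist _ i p)).
Qed.

Let nrm_le I (e : part I) (c : R) : 0 <= c ->
  (forall i, nrm (single (val i)) (e i) <= c) -> nrm I (sum_map I e) <= c.
Proof. by move=> c0 H; rewrite nrm_sum; apply/bigmax_leP; split. Qed.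

Lemma nrm_add_le I u v : nrm I (u + v) <= nrm I u + nrm I v.
Proof.
have [[e <-] [f <-]] := (sum_mapP u, sum_mapP v).
have -> : sum_map I e + sum_map I f = sum_map I (fun i => e i + f i).
  by rewrite -big_split; apply: eq_bigr => i _; rewrite linearD.
apply: nrm_le => [|i]; first by rewrite addr_ge0 ?nrm_ge0.
by rewrite (le_trans (single_tri _ _))// lerD ?nrm_part.
Qed.

Lemma nrm_scale_le I (a : R) v : nrm I (a *: v) <= `|a| * nrm I v.
Proof.
have [e <-] := sum_mapP v.
have -> : a *: sum_map I e = sum_map I (fun i => a *: e i).
  by rewrite scaler_sumr; apply: eq_bigr => i _; rewrite linearZ.
apply: nrm_le => [|i]; first by rewrite mulr_ge0 ?nrm_ge0.
by rewrite single_hom ler_wpM2l ?nrm_part.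
Qed.

Lemma nrm_opp_le I v : nrm I (- v) <= nrm I v.
Proof. by rewrite -scaleN1r (le_trans (nrm_scale_le _ _))// normrN1 mul1r. Qed.

Lemma nrm0 I : nrm I 0 = 0.
Proof.
apply/eqP; rewrite eq_le nrm_ge0 andbT.
by have := nrm_scale_le 0 (0 : obs K I); rewrite scale0r normr0 mul0r.
Qed.

(** By the cocycle condition the components of phihat_IJ(e) are those of [e], and 0 at the indices
    outside I; the maximum does not grow. *)
Lemma nrm_aphihat_le I J e : idx_sub I J -> nrm J (aphihat K I J e) <= nrm I e.
Proof.
move=> IJ; have [f <-] := sum_mapP e.
have sub i : i \in val I -> idx_sub (single i) I.
  by move=> iI; rewrite /idx_sub finset.sub1set.
have -> : aphihat K I J (sum_map I f) = sum_map J (fun j => extend f (val j)).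
  rewrite sum_map_extend linear_sum /=.
  transitivity (\sum_(i in val J) aphihat K (single i) J (extend f i)).
    rewrite [RHS](bigID (fun i => i \in val I)) /= [X in _ + X]big1 ?addr0; last first.
      by move=> i /andP[_ iI]; rewrite extend_out// linear0.
    apply: eq_big => [i|i iI].
      apply/idP/andP => [iI|[//]]; split => //.
      by move: IJ => /fintype.subsetP; apply.
    by rewrite aphihat_comp//; exact: sub.
  by rewrite big_sub.
by apply: nrm_le => [|j]; [exact: nrm_ge0|exact: nrm_extend].
Qed.

Lemma nrm_bounded I : exists2 c : R, 0 <= c & forall v, nrm I v <= c * `|v2r v|.
Proof.
pose b j := nrm I (r2v (delta_mx 0 j)).
have b0 j : 0 <= b j by exact: nrm_ge0.
exists (\sum_j b j) => [|v]; first exact: sumr_ge0.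
have vE : v = \sum_j (v2r v) 0 j *: r2v (delta_mx 0 j).
  rewrite -{1}(v2rK v) {1}(row_sum_delta (v2r v)) linear_sum.
  by apply: eq_bigr => j _; rewrite linearZ.
have sum_le (r : seq 'I_(dim (obs K I))) (F : 'I_(dim (obs K I)) -> obs K I) :
    nrm I (\sum_(j <- r) F j) <= \sum_(j <- r) nrm I (F j).
  elim: r => [|j r IH]; first by rewrite !big_nil nrm0.
  by rewrite !big_cons (le_trans (nrm_add_le _ _))// lerD2l.
rewrite {1}vE (le_trans (sum_le _ _))// mulr_suml; apply: ler_sum => j _.
rewrite (le_trans (nrm_scale_le _ _))// mulrC ler_wpM2l//; first exact: b0.
exact: (mx_entry_le (v2r v) 0 j).
Qed.

End AdditiveNorms.

Section LinearImages.
Context (R : realType) (M : manifold R).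
Implicit Types (E F : vectType R) (x : M).

Lemma vdiff_add E (f g : M -> E) x u : smooth_at f x -> smooth_at g x ->
  vdiff (fun y => f y + g y) x u = vdiff f x u + vdiff g x u.
Proof.
move=> sf sg.
apply: (etrans (vdiffE (fun y => f y + g y) x u)).
have E1 : local_vrep (fun y => f y + g y) x =
    fun c => local_vrep f x c + local_vrep g x c.
  by apply/funext => c; rewrite /local_vrep /= linearD.
have H := jacobian_add (sm_near_differentiable sf) (sm_near_differentiable sg).
apply: (etrans (congr1 (fun l => r2v (u *m jacobian l (mchart x x))) E1)).
apply: (etrans (congr1 (fun J => r2v (u *m J)) H)).
have D (A B : 'M[R]_(mdim M, dim E)) :
    r2v (u *m (A + B)) = r2v (u *m A) + r2v (u *m B) :> E.
  by rewrite mulmxDr linearD.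
apply: (etrans (D _ _)).
exact: (esym (congr2 +%R (vdiffE f x u) (vdiffE g x u))).
Qed.

Lemma vdiff_lin E F (L : 'Hom(E, F)) (f : M -> E) x u : smooth_at f x ->
  vdiff (fun y => L (f y)) x u = L (vdiff f x u).
Proof.
move=> sf.
have Ll : linear (fun c : 'rV[R]_(dim E) => v2r (L (r2v c))).
  by move=> a v w; rewrite !linearP.
pose L' : {linear 'rV[R]_(dim E) -> 'rV[R]_(dim F)} :=
  HB.pack (fun c => v2r (L (r2v c))) (GRing.isLinear.Build _ _ _ _ _ Ll).
have Lc : continuous L' by exact: rV_linear_continuous.
have E1 : local_vrep (fun y => L (f y)) x = L' \o local_vrep f x.
  by apply/funext => c; rewrite /local_vrep /= v2rK.
have dL c : differentiable L' c by exact: linear_differentiable.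
have H := jacobian_comp (sm_near_differentiable sf) (dL _).
apply: (etrans (vdiffE (fun y => L (f y)) x u)).
apply: (etrans (congr1 (fun l => r2v (u *m jacobian l (mchart x x))) E1)).
apply: (etrans (congr1 (fun J => r2v (u *m J)) H)).
have JL c w : w *m jacobian L' c = v2r (L (r2v w)).
  by rewrite -jacobian_mul diff_lin.
apply: (etrans (congr1 r2v (mulmxA _ _ _))).
apply: (etrans (congr1 r2v (JL _ _))).
exact: (etrans (v2rK _) (congr1 L (esym (vdiffE f x u)))).
Qed.

(** An endomorphism with kernel [U]: values in [U] become zeros of a smooth function, to which
    differentiation and passage to the closure apply. *)
Let quot E (U : {vspace E}) : 'End(E) := (\1 - projv U)%VF.

Let quotP E (U : {vspace E}) v : quot U v = 0 <-> v \in U.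
Proof.
rewrite /quot add_lfunE opp_lfunE id_lfunE; split=> [/eqP|vU].
  by rewrite subr_eq0 => /eqP ->; exact: memv_proj.
by rewrite projv_id// subrr.
Qed.

Let vdiff_cst0 E x u : vdiff (fun=> 0 : E) x u = 0.
Proof.
apply: (etrans (vdiffE (fun=> 0 : E) x u)).
have E1 : local_vrep (fun=> 0 : E) x = fun=> 0.
  by apply/funext => c; rewrite /local_vrep /= linear0.
apply: (etrans (congr1 (fun l => r2v (u *m jacobian l (mchart x x))) E1)).
rewrite jacobian_cst0.
by rewrite mulmx0 linear0.
Qed.

Lemma vdiff_mem E (U : {vspace E}) (f : M -> E) x u : smooth_at f x ->
  (\forall y \near x, f y \in U) -> vdiff f x u \in U.
Proof.
move=> sf fU; apply/quotP; rewrite -vdiff_lin//.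
have H : \forall y \near x, (fun=> 0) y = quot U (f y).
  by apply: filterS fU => y /quotP ->.
rewrite (vdiff_near_eq H (smooth_at_cst 0 x)).
exact: vdiff_cst0.
Qed.

Lemma closure_mem E (U : {vspace E}) (f : M -> E) x : smooth_at f x ->
  closure [set y | f y \in U] x -> f x \in U.
Proof.
move=> sf cl; apply/quotP; apply: contrapT => fx0.
have /smooth_at_continuous c := smooth_at_lin (quot U) sf.
have n0 : 0 < `|v2r (quot U (f x))|.
  by rewrite normr_gt0; apply/eqP => /v2r_eq0.
have cn : {for x, continuous (fun y => `|v2r (quot U (f y))|)}.
  by apply: continuous_comp c _; exact: norm_continuous.
have [y [/quotP fy]] := cl _ (near_continuous_gt0 cn n0).
by rewrite fy linear0 normr0 ltxx.
Qed.

End LinearImages.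

Section Neighbourhoods.
Context (R : realType) (X : topologicalType) (K : atlas R X).
Context (d : realization K -> realization K -> R) (V : chart_sets K).
Arguments V : clear implicits.
Hypothesis d_adm : admissible_metric d.
Implicit Types (I J H : aidx K) (r : R).

Let d_trans p q z := d_trans d_adm p q z.
Let d_sym p q := d_sym d_adm p q.

(* [V_I^k] and [N_JI^k] are [VV r I] and [NN r I J] with [r = 2^-k delta]. *)
Definition VV r I : set (dom K I) := nbhdU d r (V I).
Arguments VV : clear implicits.

Definition NN r I J : set (dom K J) := VV r J `&` aphi K I J @` (VV r I `&` aU K I J).
Arguments NN : clear implicits.

Lemma VV_le r r' I x : r <= r' -> VV r I x -> VV r' I x.
Proof. by move=> rr [y Vy h]; exists y => //; exact: lt_le_trans h rr. Qed.

Lemma NN_le r r' I J x : r <= r' -> NN r I J x -> NN r' I J x.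
Proof.
move=> rr [Vx [z [Vz Uz] zx]]; split; first exact: VV_le Vx.
by exists z => //; split => //; exact: VV_le Vz.
Qed.

Lemma nbhdU_le r r' I (A B : set (dom K I)) x : r <= r' -> A `<=` B ->
  nbhdU d r A x -> nbhdU d r' B x.
Proof.
move=> rr AB [y Ay h]; exists y; [exact: AB|exact: lt_le_trans h rr].
Qed.

Lemma VV_dist r s t I (x : dom K I) (y : dom K I) :
  VV r I x -> d (piK I x) (piK I y) <= s -> r + s <= t -> VV t I y.
Proof.
move=> [z Vz xz] xy st; exists z => //.
rewrite (le_lt_trans (d_trans _ (piK I x) _))// d_sym addrC.
by apply: lt_le_trans st; exact: ltr_leD.
Qed.

Lemma closure_nbhdU r r' I (A : set (dom K I)) x : r < r' ->
  closure (nbhdU d r A) x -> nbhdU d r' A x.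
Proof.
move=> rr cx; have e0 : 0 < r' - r by rewrite subr_gt0.
have [y [z Az yz] xy] := closure_dist d_adm cx e0.
exists z => //; rewrite (le_lt_trans (d_trans _ (piK I y) _))//.
by rewrite -(subrK r r') ltrD.
Qed.

Lemma closure_VV r r' I x : r < r' -> closure (VV r I) x -> VV r' I x.
Proof. exact: closure_nbhdU. Qed.

Lemma VV_open r I : open (VV r I).
Proof. exact: nbhdU_open. Qed.

End Neighbourhoods.

Arguments VV {R X K} d V r I.
Arguments NN {R X K} d V r I J.

(** Room for two errors [s], one for each approximation of a point of a closure. *)
Lemma slack (R : realType) (a b c e : R) : a < b -> c + a < e ->
  exists2 s : R, 0 < s & s <= b - a /\ c + a + s + s <= e.
Proof.
move=> ab ce; exists (Num.min (b - a) ((e - c - a) / 2)).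
  by rewrite lt_min; apply/andP; split; lra.
split; first by rewrite ge_min lexx.
have : Num.min (b - a) ((e - c - a) / 2) <= (e - c - a) / 2.
  by rewrite ge_min lexx orbT.
lra.
Qed.

(** * The inductive step *)

Section Step.
Context (R : realType) (X : topologicalType) (K : atlas R X).
Context (d : realization K -> realization K -> R) (V C : chart_sets K).
Arguments V : clear implicits.
Arguments C : clear implicits.
Hypotheses (K_tame : tame K) (d_adm : admissible_metric d).
Context (nrm : forall I : aidx K, obs K I -> R).
Arguments nrm : clear implicits.
Hypothesis nrm_additive : additive_norms nrm.
Context (J : aidx K) (mu : section_family K).
Arguments mu : clear implicits.
(* r0, r1, r2, r3 stand for 2^-k delta with k = |J|-1, |J|-1/2, |J|-1/4, |J|, and
   e0, e1, e3 for eta_k with k = |J|-1, |J|-1/2, |J|. *)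
Context (delta sigma sigma0 r0 r1 r2 r3 e0 e1 e3 : R).
Hypotheses (sigma0_ge0 : 0 <= sigma0) (sigma0_lt : sigma0 < sigma).
Hypotheses (r10 : r1 < r0) (r21 : r2 + e1 <= r1) (r32 : r3 < r2)
  (re0 : r1 + e1 < r0) (e3_gt0 : 0 < e3) (e31 : e3 < e1) (e10 : e1 < e0)
  (r0_le : r0 <= 2 * delta).
Hypothesis delta_ok : delta_condition d V delta.
Implicit Types (I H : aidx K).
Notation VV := (VV d V).
Notation NN := (NN d V).
Hypothesis mu_smooth : forall I, idx_psub I J -> forall x, VV r0 I x ->
  smooth_at (mu I) x.
Hypothesis mu_compat : forall H I, idx_psub H I -> idx_psub I J ->
  forall x, VV r0 H x -> aU K H I x -> VV r0 I (aphi K H I x) ->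
  mu I (aphi K H I x) = aphihat K H I (mu H x).
Hypothesis mu_regular : forall I, idx_psub I J -> forall x, VV r0 I x ->
  regular_at (perturbed mu I) x.
Hypothesis mu_image : forall H I, idx_psub H I -> idx_psub I J ->
  forall x, VV r0 I x -> nbhdU d e0 (NN r0 H I) x -> mu I x \in limg (aphihat K H I).
Hypothesis mu_zero : forall I, idx_psub I J -> forall x, VV r0 I x ->
  perturbed mu I x = 0 -> pi_family C (piK I x).
Hypothesis mu_bound : forall I, idx_psub I J -> forall x, VV r0 I x ->
  nrm I (mu I x) <= sigma0.

Let K_additive : additive_atlas R X K. Proof. by case: K_tame. Qed.

(** The admissible values at [y]. The radii [r1], [r2] and [e1] lie between those at which the
    sections [mu I] are known and those required of the new section. *)
Definition target (y : dom K J) (e : obs K J) : Prop :=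
  [/\ forall I z, idx_psub I J -> VV r1 I z -> aU K I J z -> aphi K I J z = y ->
        VV r1 J y -> e = aphihat K I J (mu I z),
      forall I, idx_psub I J -> nbhdU d e1 (NN r2 I J) y ->
        e \in limg (aphihat K I J) &
      nrm J e <= sigma0].

Lemma target_convex y : convex_pred (target y).
Proof.
move=> u v t /andP[t0 t1] [u1 u2 u3] [v1 v2 v3]; split.
- move=> I z IJ Vz Uz zy Vy.
  rewrite (u1 I z IJ Vz Uz zy Vy) (v1 I z IJ Vz Uz zy Vy).
  by rewrite -scalerDl addrC subrK scale1r.
- move=> I IJ yN; apply: memvD; apply: memvZ; [exact: u2|exact: v2].
- rewrite (le_trans (nrm_add_le K_additive nrm_additive _ _))//.
  have -> : sigma0 = t * sigma0 + (1 - t) * sigma0 by ring.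
  apply: lerD; apply: le_trans (nrm_scale_le K_additive nrm_additive _ _) _.
    by rewrite ger0_norm// ler_wpM2l.
  by rewrite ger0_norm ?ler_wpM2l// subr_ge0.
Qed.

(** There are finitely many indices, so one neighbourhood of [x] avoids every [A I] whose closure
    misses [x]. *)
Lemma near_closure (T : topologicalType) (A : aidx K -> set T) x :
  \forall y \near x, forall I, A I y -> closure (A I) x.
Proof.
apply: filter_forall => I; have [cA|cA] := pselect (closure (A I) x).
  by apply: nearW.
have oA : open (~` closure (A I)) by apply: closed_openC; exact: closed_closure.
have H := open_nbhs_nbhs (conj oA cA).
by apply: filterS H => y nA /subset_closure.
Qed.

Lemma smooth_sec I x : smooth_at (sec I) x.
Proof.
by have /smooth_vmapP := @ks_smooth _ _ (achart K I); apply.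
Qed.

Lemma NN_sec r I (y : dom K J) : idx_sub I J -> NN r I J y ->
  sec J y \in limg (aphihat K I J).
Proof.
move=> IJ [_ [z [_ Uz] <-]]; rewrite sec_aphi//.
by apply: memv_img; exact: memvf.
Qed.

Lemma comparable_idx I H p : neighbourhood d r0 (piK I @` V I) p ->
  neighbourhood d r0 (piK H @` V H) p -> idx_sub I H || idx_sub H I.
Proof.
have up L : neighbourhood d r0 (piK L @` V L) p ->
    neighbourhood d (2 * delta) (piK L @` V L) p.
  by move=> [z Vz h]; exists z => //; exact: lt_le_trans h r0_le.
by move=> /up Ip /up Hp; case: delta_ok => _; apply; exists p.
Qed.

Lemma VV_neighbourhood r I z p : VV r I z -> d (piK I z) p < r0 - r ->
  neighbourhood d r0 (piK I @` V I) p.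
Proof.
move=> [v Vv zv] zp; exists (piK I v); first by exists v.
rewrite (le_lt_trans (d_trans d_adm _ (piK I z) _))// (d_sym d_adm).
by rewrite -(subrK r r0) ltrD.
Qed.

Lemma compat_sub H I x : idx_sub H I -> idx_psub I J ->
  VV r0 H x -> aU K H I x -> VV r0 I (aphi K H I x) ->
  mu I (aphi K H I x) = aphihat K H I (mu H x).
Proof.
case/idx_sub_eqVp => [<-|HI] *; last exact: mu_compat.
by rewrite aphi_id aphihat_id.
Qed.

Lemma closure_NN_dist r (s : R) I x : idx_sub I J -> 0 < s -> closure (NN r I J) x -> exists z,
  [/\ VV r I z, aU K I J z, NN r I J (aphi K I J z) & d (piK I z) (piK J x) < s].
Proof.
move=> IJ s0 cx; have [y yN xy] := closure_dist d_adm cx s0.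
have [_ [z [Vz Uz] zy]] := yN; exists z.
by rewrite -(piK_aphi IJ Uz) zy (d_sym d_adm).
Qed.

(** Let [Ia] be the chosen largest index. If the values at points near [x] are prescribed by I, then
    I and [Ia] are comparable and I is contained in [Ia] by maximality, so compatibility of [mu I]
    with [mu Ia] gives the prescribed value. If they are only required to lie in E_I, either [Ia] is
    contained in I and E_Ia in E_I, or I is strictly smaller and [mu Ia] itself has values in E_I
    there. *)
Lemma local_solution x : closure (VV r3 J) x ->
  exists f : dom K J -> obs K J,
    \forall y \near x, smooth_at f y /\ target y (f y).
Proof.
move=> cx.
pose S I := idx_psub I J /\ closure (NN r1 I J) x.
have nearS : \forall y \near x, forall I, NN r1 I J y -> closure (NN r1 I J) x.
  exact: near_closure.
have [[I0 SI0]|none] := pselect (exists I, S I); last first.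
  (* No value is prescribed near [x], and 0 lies in every E_I. *)
  exists (fun=> 0); apply: filterS nearS => y Hy.
  split; first exact: smooth_at_cst.
  split=> [I z IJ Vz Uz zy Vy|I IJ _|]; [|exact: mem0v|by rewrite nrm0].
  by case: none; exists I; split => //; apply: Hy; split => //; exists z.
have [Ia /asboolP[IaJ cIa] Imax] := @arg_maxnP _ I0 (fun I => `[< S I >])
  (fun I => size_idx I) (asboolT SI0).
have IaJ' := idx_psubW IaJ.
(* Although [x] is only in the closure of the image, it has a preimage, the image of phi being
   closed by tameness. *)
have [w0 Uw0 w0x] : exists2 w0, aU K Ia J w0 & aphi K Ia J w0 = x.
  apply: image_aphi => //; apply: closure_mem; first exact: smooth_sec.
  by apply: closure_subset cIa => y; exact: NN_sec.
have pw0 : piK Ia w0 = piK J x by rewrite -w0x piK_aphi.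
have Vw0 r : r1 < r -> VV r Ia w0.
  move=> r1r; have s0 : 0 < r - r1 by rewrite subr_gt0.
  have [z [Vz Uz _ zx]] := closure_NN_dist IaJ' s0 cIa.
  rewrite -pw0 in zx; apply: (VV_dist d_adm Vz (ltW zx)).
  by rewrite addrC subrK.
have sub_max I : idx_psub I J -> idx_sub I Ia \/ idx_psub Ia I ->
    closure (NN r1 I J) x -> idx_sub I Ia.
  move=> IJ [//|IaI] cI; have SI : S I by [].
  have := Imax I (asboolT SI); rewrite /geq /= leqNgt.
  by rewrite idx_psub_size.
have comp I r z : VV r I z -> d (piK I z) (piK J x) < r0 - r ->
    idx_sub I Ia \/ idx_psub Ia I.
  move=> Vz zx.
  have Ip := VV_neighbourhood Vz zx.
  have [v Vv vw] := Vw0 r0 r10.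
  have Iap : neighbourhood d r0 (piK Ia @` V Ia) (piK J x).
    by exists (piK Ia v); [exists v|rewrite -pw0].
  have /orP[|/idx_sub_eqVp[<-|]] := comparable_idx Ip Iap; [by left| |by right].
  by left; exact: idx_sub_refl.
have [sm _ _] : smooth_embedding (aU K Ia J) (aphi K Ia J).
  by have [[_ _ H _] _] := a_change _ _ _ _ _ IaJ.
have ker0 : lker (tangent_map (aphi K Ia J) w0) = 0%VS.
  by have [[_ _ [_ /(_ w0 Uw0) H _] _] _] := a_change _ _ _ _ _ IaJ.
have [rr [rx rc rK rsm]] := local_left_inverse sm Uw0 ker0.
rewrite w0x in rx rc rsm.
exists (fun y => aphihat K Ia J (mu Ia (rr y))).
have smf : smooth_at (fun y => aphihat K Ia J (mu Ia (rr y))) x.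
  by apply: smooth_at_lin; apply: (rsm _ (mu Ia)); apply: mu_smooth => //; exact: Vw0.
have N1 : \forall y \near x, VV r0 Ia (rr y).
  apply: (rc (VV r0 Ia)); rewrite /= rx.
  exact: (open_nbhs_nbhs (conj (VV_open _ d_adm _ _) (Vw0 _ r10))).
(* Points and their images under phi agree in |K|; so a preimage of a point near [x] is near [w0],
   where [rr] inverts phi. *)
have N2 : \forall y \near x, forall w, aU K Ia J w -> aphi K Ia J w = y ->
    rr y = w /\ VV r0 Ia w.
  have V0 := open_nbhs_nbhs (conj (VV_open V d_adm r0 Ia) (Vw0 _ r10)).
  have [e e0' He] := nbhs_dist d_adm (filterI rK V0).
  apply: filterS (near_dist d_adm x e0') => y xy w Uw wy.
  have : d (piK Ia w0) (piK Ia w) < e by rewrite pw0 -(piK_aphi _ Uw)// wy.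
  by move=> /He[]; rewrite wy.
have N3 := near_closure (fun I => nbhdU d e1 (NN r2 I J)) x.
have N4 : \forall y \near x, forall I, idx_psub I J ->
    nbhdU d e1 (NN r2 I J) y -> aphihat K Ia J (mu Ia (rr y)) \in limg (aphihat K I J).
  (* A point of N_JI near [x] comes from I and hence, if I is contained in [Ia], also from a point
     of [Ia] near [w0]. This places [w0] near N_(Ia,I), within the radii [e0] and [r0] of the
     induction hypothesis. *)
  have split_I I : idx_psub I J -> closure (nbhdU d e1 (NN r2 I J)) x ->
      idx_sub Ia I \/ idx_psub I Ia /\ nbhdU d e0 (NN r0 I Ia) w0.
    move=> IJ cI.
    have [s s0 [s1 s2]] : exists2 s : R, 0 < s &
        s <= e0 - e1 /\ r1 + e1 + s + s <= r0 := slack e10 re0.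
    have [y [z [Vz [u [Vu Uu] uz]] yz] xy] := closure_dist d_adm cI s0.
    have pu : piK I u = piK J z by rewrite -uz piK_aphi// idx_psubW.
    have xz : d (piK J x) (piK J z) < e1 + s.
      rewrite (le_lt_trans (d_trans d_adm _ (piK J y) _))//.
      by rewrite addrC ltrD// (d_sym d_adm).
    have := (r21, re0, e31, e3_gt0) => -[[[h1 h2] h3] h4].
    have ux : d (piK I u) (piK J x) < r0 - r2.
      rewrite pu (d_sym d_adm); apply: lt_le_trans xz _.
      lra.
    have [IIa|] := comp _ _ _ Vu ux; last by move=> /idx_psubW; left.
    case/idx_sub_eqVp: (IIa) => [E|pIIa].
      by left; rewrite E; exact: idx_sub_refl.
    right; split => //.
    have [w Uw wz] : exists2 w, aU K Ia J w & aphi K Ia J w = z.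
      apply: image_aphi => //; apply: (aphihat_limgS IIa IaJ').
      by rewrite -uz sec_aphi ?idx_psubW//; apply: memv_img; exact: memvf.
    have pw : piK Ia w = piK J z by rewrite -wz piK_aphi.
    have [Uu' uw] : aU K I Ia u /\ aphi K I Ia u = w.
      by apply: (piK_aphiP K_tame d_adm) => //; rewrite pu pw.
    have ww0 : d (piK Ia w0) (piK Ia w) < e1 + s by rewrite pw0 pw.
    exists w; last by apply: lt_le_trans ww0 _; lra.
    split.
      apply: (VV_dist d_adm (Vw0 (r1 + s) _) (ltW ww0)); first by lra.
      by lra.
    exists u => //; split => //; apply: VV_le Vu; lra.
  have nearI : \forall y \near x, forall I, idx_psub I J ->
      nbhdU d e0 (NN r0 I Ia) w0 -> nbhdU d e0 (NN r0 I Ia) (rr y).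
    apply: filter_forall => I; have [h|h] := pselect (nbhdU d e0 (NN r0 I Ia) w0).
      have h' : \forall y \near x, nbhdU d e0 (NN r0 I Ia) (rr y).
        by apply: (rc (nbhdU d e0 (NN r0 I Ia))); rewrite /= rx; exact: nbhdU_near.
      by apply: filterS h' => y ? _ _.
    by apply: nearW => y _ /h.
  near=> y => I IJ yN.
  have cI : closure (nbhdU d e1 (NN r2 I J)) x.
    have H : forall I, nbhdU d e1 (NN r2 I J) y -> closure (nbhdU d e1 (NN r2 I J)) x.
      by near: y.
    exact: H.
  have [IaI|[IIa w0N]] := split_I I IJ cI.
    apply: (aphihat_limgS IaI (idx_psubW IJ)).
    by apply: memv_img; exact: memvf.
  have Vy : VV r0 Ia (rr y) by near: y.
  have yN' : nbhdU d e0 (NN r0 I Ia) (rr y).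
    have H : forall I, idx_psub I J ->
      nbhdU d e0 (NN r0 I Ia) w0 -> nbhdU d e0 (NN r0 I Ia) (rr y) by near: y.
    exact: H.
  have /memv_imgP[v _ ->] := mu_image IIa IaJ Vy yN'.
  rewrite (aphihat_comp _ (idx_psubW IIa) IaJ').
  by apply: memv_img; exact: memvf.
have N5 := smooth_at_near smf.
near=> y.
have sy : smooth_at (fun y => aphihat K Ia J (mu Ia (rr y))) y by near: y.
split => //; split.
- move=> I z IJ Vz Uz zy Vy.
  have cI : closure (NN r1 I J) x.
    have H : forall I, NN r1 I J y -> closure (NN r1 I J) x by near: y.
    by apply: H; split => //; exists z.
  have s0 : 0 < r0 - r1 by rewrite subr_gt0.
  have [z' [Vz' _ _ zx']] := closure_NN_dist (idx_psubW IJ) s0 cI.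
  have IIa := sub_max I IJ (comp _ _ _ Vz' zx') cI.
  have [w Uw wy] : exists2 w, aU K Ia J w & aphi K Ia J w = y.
    apply: image_aphi => //; apply: (aphihat_limgS IIa IaJ').
    by rewrite -zy sec_aphi//; [apply: memv_img; exact: memvf|exact: idx_psubW].
  have H2 : forall w, aU K Ia J w -> aphi K Ia J w = y -> rr y = w /\ VV r0 Ia w.
    by near: y.
  have [-> Vw] := H2 w Uw wy.
  have [Uz' zw] : aU K I Ia z /\ aphi K I Ia z = w.
    apply: (piK_aphiP K_tame d_adm) => //.
    by rewrite -(piK_aphi (idx_psubW IJ) Uz) zy -wy piK_aphi.
  rewrite -(aphihat_comp _ IIa IaJ'); congr (aphihat K Ia J _).
  rewrite -zw; apply: compat_sub => //; last by rewrite zw.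
  by apply: VV_le Vz; exact: ltW.
- move=> I IJ; have H : forall I, idx_psub I J ->
    nbhdU d e1 (NN r2 I J) y -> aphihat K Ia J (mu Ia (rr y)) \in limg (aphihat K I J).
    by near: y.
  exact: H.
- have Vy : VV r0 Ia (rr y) by near: y.
  apply: le_trans (nrm_aphihat_le K_additive nrm_additive _ IaJ') _.
  exact: mu_bound.
Unshelve. all: by end_near. Qed.

Lemma closure_VV_compact : compact (closure (VV r3 J)).
Proof.
have [/(_ J)[cpt _] _] := delta_ok.
have r3d : r3 <= 2 * delta by move: r32 r21 r10 r0_le e31 e3_gt0 => *; lra.
apply: (subclosed_compact _ cpt); first exact: closed_closure.
by apply: closure_subset => y; exact: VV_le.
Qed.

Definition collar e r : set (dom K J) :=
  [set y | exists2 I, idx_psub I J & nbhdU d e (NN r I J) y].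

Lemma closure_collar x : closure (collar e3 r3) x -> collar e1 r2 x.
Proof.
move=> cx; have s0 : 0 < e1 - e3 by rewrite subr_gt0.
have [y [I IJ [z Nz yz]] xy] := closure_dist d_adm cx s0.
exists I => //; exists z; first by apply: NN_le Nz; exact: ltW.
rewrite /pull (le_lt_trans (d_trans d_adm _ (piK J y) _))//.
by rewrite -(subrK e3 e1) ltrD.
Qed.

Lemma NN_collar I y : idx_psub I J -> NN r3 I J y -> collar e3 r3 y.
Proof.
by move=> IJ yN; exists I => //; exists y => //; rewrite /pull (d_refl d_adm).
Qed.

Lemma VV21 I x : VV r2 I x -> VV r1 I x.
Proof. by apply: VV_le; move: r21 e31 e3_gt0 => *; lra. Qed.

Lemma perturbed_aphi I z : idx_sub I J -> aU K I J z ->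
  sec J (aphi K I J z) + aphihat K I J (mu I z) = aphihat K I J (perturbed mu I z).
Proof. by move=> IJ Uz; rewrite sec_aphi// /perturbed raddfD. Qed.

(** At such a zero s_J(y) = -e lies in E_I, hence [y] has a preimage z by tameness. As r2 + e1 <=
    r1, z is in the set where mu_I prescribes e, and injectivity of phihat_IJ transfers the zero to
    z. *)
Lemma target_zero I y e : idx_psub I J -> nbhdU d e1 (NN r2 I J) y ->
  VV r1 J y -> target y e -> sec J y + e = 0 ->
  exists z, [/\ aU K I J z, aphi K I J z = y, VV r1 I z & perturbed mu I z = 0].
Proof.
move=> IJ yN Vy [t1 t2 _] y0; have IJ' := idx_psubW IJ.
have [z Uz zy] : exists2 z, aU K I J z & aphi K I J z = y.
  apply: image_aphi => //.
  have -> : sec J y = - e by apply/eqP; rewrite -addr_eq0 y0.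
  by rewrite memvN; exact: t2.
have pz : piK I z = piK J y by rewrite -zy piK_aphi.
have Vz : VV r1 I z.
  have [y' [_ [u [Vu Uu] uy']] yy'] := yN.
  have pu : piK I u = piK J y' by rewrite -uy' piK_aphi.
  apply: (VV_dist d_adm Vu _ r21); rewrite pu pz (d_sym d_adm); exact: ltW.
exists z; split => //; apply: (aphihat_inj IJ').
by rewrite linear0 -perturbed_aphi// -(t1 I z IJ Vz Uz zy Vy) zy.
Qed.

(** Regularity of the zero of s_I + mu_I gives phihat_IJ(E_I) inside the image of d(s_J + f). Near
    [x] the values of f are in E_I, hence so are those of df, and the image of ds_J is contained in
    that of d(s_J + f) as well. By the index condition the image of ds_J and phihat_IJ(E_I) span
    E_J. *)
Lemma target_regular I f x : idx_psub I J -> nbhdU d e1 (NN r2 I J) x ->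
  VV r1 J x -> (\forall y \near x, smooth_at f y /\ target y (f y)) ->
  regular_at (fun y => sec J y + f y) x.
Proof.
move=> IJ xN Vx Hf x0; have IJ' := idx_psubW IJ.
have [sf tx] := nbhs_singleton Hf.
have [z [Uz zx Vz z0]] := target_zero IJ xN Vx tx x0; subst x.
have lt10 := ltW r10.
have reg := mu_regular IJ (VV_le lt10 Vz) z0.
have sF : smooth_at (fun y => sec J y + f y) (aphi K I J z).
  by apply: smooth_at_add => //; exact: smooth_sec.
have smu : smooth_at (perturbed mu I) z.
  apply: smooth_at_add; first exact: smooth_sec.
  by apply: mu_smooth => //; exact: VV_le Vz.
have [[_ _ [sm _ _] _] [_ _ _ index]] := a_change _ _ _ _ _ IJ.
have fE : \forall y \near aphi K I J z, f y \in limg (aphihat K I J).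
  have H := nbhdU_near d_adm xN.
  by apply: filterS (filterI H Hf) => y [yN [_ [_ t2 _]]]; exact: t2.
have df u : vdiff f (aphi K I J z) u \in limg (aphihat K I J) by exact: vdiff_mem.
have eqn : \forall z' \near z, aphihat K I J (perturbed mu I z') =
    ((fun y => sec J y + f y) \o aphi K I J) z'.
  have nU := open_nbhs_nbhs (conj (aU_open IJ') Uz).
  have nV := open_nbhs_nbhs (conj (VV_open V d_adm r1 I) Vz).
  have nVx := open_nbhs_nbhs (conj (VV_open V d_adm r1 J) Vx).
  have fc := aphi_continuous IJ' Uz.
  have nf : \forall z' \near z, (smooth_at f (aphi K I J z') /\
      target (aphi K I J z') (f (aphi K I J z'))) /\ VV r1 J (aphi K I J z').
    by apply: (fc (fun y => (smooth_at f y /\ target y (f y)) /\ VV r1 J y));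
      exact: (filterI Hf nVx).
  apply: filterS (filterI (filterI nU nV) nf) => z' [[Uz' Vz'] [[_ [t1 _ _]] Vz'J]].
  apply: (etrans (esym (perturbed_aphi IJ' Uz'))).
  by rewrite /= -(t1 I z' IJ).
pose F y := sec J y + f y.
have imE e' : aphihat K I J e' \in limg (vdiff F (aphi K I J z)).
  have : e' \in limg (vdiff (perturbed mu I) z) by rewrite reg memvf.
  move=> /memv_imgP[u _ ->].
  have sl := smooth_at_lin (aphihat K I J) smu.
  have E1 : aphihat K I J (vdiff (perturbed mu I) z u) =
      vdiff F (aphi K I J z) (tangent_map (aphi K I J) z u).
    apply: (etrans (esym (vdiff_lin (aphihat K I J) u smu))).
    apply: (etrans (esym (congr1 (fun L => fun_of_lfun L u) (vdiff_near_eq eqn sl)))).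
    exact: (vdiff_comp u sm Uz sF).
  by apply/memv_imgP; exists (tangent_map (aphi K I J) z u) => //; exact: memvf.
have imd u : vdiff (sec J) (aphi K I J z) u \in limg (vdiff F (aphi K I J z)).
  have E1 := vdiff_add u (smooth_sec (aphi K I J z)) sf.
  have E2 : vdiff (sec J) (aphi K I J z) u =
      vdiff F (aphi K I J z) u - vdiff f (aphi K I J z) u.
    by apply/eqP; rewrite eq_sym subr_eq; apply/eqP; exact: E1.
  rewrite E2; apply: memvB.
    by apply/memv_imgP; exists u => //; exact: memvf.
  by have /memv_imgP[v _ ->] := df u.
have ds : is_direct_sum (limg (vdiff (sec I) z)) (limg (vdiff (sec I) z))^C%VS.
  by split; [exact: addv_complf|exact: capv_compl].
have [full _] := index z Uz _ ds.
apply: subv_anti; rewrite subvf /= -full subv_add; apply/andP; split.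
  by apply/subvP => e /memv_imgP[u _ ->]; exact: imd.
by apply/subvP => e /memv_imgP[v _ ->]; exact: imE.
Qed.

Hypothesis C_open : forall I, open (C I).
Hypothesis sec_large : forall x, closure (VV r3 J) x -> ~ Ctilde C J x ->
  ~ collar e1 r2 x -> sigma <= nrm J (sec J x).

Lemma Ctilde_open : open (Ctilde C J).
Proof.
rewrite openE => x [L [JL UL CL]]; rewrite /interior.
have H1 := open_nbhs_nbhs (conj (aU_open JL) UL).
have H2 := aphi_continuous JL UL (open_nbhs_nbhs (conj (C_open L) CL)).
apply: filterS (filterI H1 H2) => y [Uy Cy].
by exists L; split.
Qed.

Lemma Ctilde_pi_family x : Ctilde C J x -> pi_family C (piK J x).
Proof.
by move=> [L [JL UL CL]]; exists L; exists (aphi K J L x) => //; exact: piK_aphi.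
Qed.

Lemma zero_Ctilde x e : closure (VV r3 J) x -> target x e -> sec J x + e = 0 ->
  ~ collar e1 r2 x -> Ctilde C J x.
Proof.
move=> cx [_ _ te] x0 nx; apply: contrapT => nC.
have := sec_large cx nC nx.
have -> : sec J x = - e by apply/eqP; rewrite -addr_eq0 x0.
apply/negP; rewrite -ltNge.
apply: le_lt_trans (nrm_opp_le K_additive nrm_additive e) _.
exact: le_lt_trans te sigma0_lt.
Qed.

(** The glued section has norm at most [sigma0] < [sigma]. The perturbation uses up at most half of
    the difference, which leaves the strict bound [sigma1]. *)
Lemma inductive_step : exists (f : dom K J -> obs K J) (sigma1 : R),
  sigma1 < sigma /\
  [/\ forall x, VV r3 J x -> smooth_at f x,
      forall H, idx_psub H J -> forall x, VV r3 H x -> aU K H J x ->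
        VV r3 J (aphi K H J x) -> f (aphi K H J x) = aphihat K H J (mu H x),
      forall x, VV r3 J x -> regular_at (fun y => sec J y + f y) x,
      forall H, idx_psub H J -> forall x, VV r3 J x ->
        nbhdU d e3 (NN r3 H J) x -> f x \in limg (aphihat K H J) &
      forall x, VV r3 J x ->
        (sec J x + f x = 0 -> pi_family C (piK J x)) /\ nrm J (f x) <= sigma1].
Proof.
have [nt Hnt] := convex_gluing closure_VV_compact target_convex local_solution.
pose F y := sec J y + nt y.
have ntP x : closure (VV r3 J) x -> smooth_at nt x /\ target x (nt x).
  by move=> /Hnt/nbhs_singleton.
have sF x : closure (VV r3 J) x -> smooth_at F x.
  by move=> /ntP[sx _]; apply: smooth_at_add => //; exact: smooth_sec.
have V1 x : closure (VV r3 J) x -> VV r1 J x.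
  by move=> /(closure_VV d_adm r32) /VV21.
(* Outside [W] the perturbation vanishes, so on the small collar the values stay prescribed and stay
   in E_I. The closure of the small collar lies in the large one, where zeros are regular
   already. *)
pose W := Ctilde C J `&` ~` closure (collar e3 r3).
have oW : open W.
  apply: openI; first exact: Ctilde_open.
  by apply: closed_openC; exact: closed_closure.
have regW x : closure (VV r3 J) x -> regular_at F x \/ W x.
  move=> cx; have [x0|nx0] := pselect (F x = 0); last by left => /nx0.
  have [[I IJ xI]|nx] := pselect (collar e1 r2 x).
    by left; apply: (target_regular IJ xI (V1 x cx)); exact: Hnt.
  right; split; first by have [_ tx] := ntP x cx; exact: zero_Ctilde tx x0 nx.
  by move=> /closure_collar.
have [c c0 nrmc] := nrm_bounded K_additive nrm_additive J.
pose e := (sigma - sigma0) / 2 / (c + 1).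
have egt0 : 0 < e by rewrite !divr_gt0 ?subr_gt0// ltr_wpDl.
have [g [sg gW ge reg]] :=
  transverse_perturbation closure_VV_compact oW sF regW egt0.
exists (fun y => nt y + g y), ((sigma + sigma0) / 2); split.
  by move: sigma0_lt => h; lra.
have sub x : VV r3 J x -> closure (VV r3 J) x by exact: subset_closure.
have g0 x : collar e3 r3 x -> g x = 0.
  by move=> xO; apply: gW => -[_]; apply; exact: subset_closure.
split.
- move=> x /sub/ntP[sx _]; exact: smooth_at_add.
- move=> H HJ x Vx Ux Vy; have [_ [t1 _ _]] := ntP _ (sub _ Vy).
  rewrite (g0 (aphi K H J x)); last first.
    by apply: (NN_collar HJ); split => //; exists x.
  rewrite addr0; apply: t1 => //; last exact: V1 (sub _ Vy).
  by apply: VV21; exact: VV_le (ltW r32) Vx.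
- move=> x /sub/reg; rewrite (_ : (fun y => F y + g y) = fun y => sec J y + (nt y + g y))//.
  by apply/funext => y; rewrite /F addrA.
- move=> H HJ x Vx xN; have [_ [_ t2 _]] := ntP _ (sub _ Vx).
  rewrite (g0 x); last by exists H.
  rewrite addr0; apply: (t2 H HJ).
  by apply: nbhdU_le xN; [exact: ltW|move=> y; apply: NN_le; exact: ltW].
- move=> x Vx; have [_ tx] := ntP _ (sub _ Vx); split.
    (* In [W] the point is in Ctilde_J. Outside, it is a zero of the unperturbed glued section,
       hence in Ctilde_J or the image of a zero of smaller index. *)
    move=> x0; have [xW|nW] := pselect (W x).
      by apply: Ctilde_pi_family; case: xW.
    rewrite (gW x nW) addr0 in x0.
    have [[I IJ xI]|nx] := pselect (collar e1 r2 x).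
      have [z [Uz zx Vz z0]] := target_zero IJ xI (V1 _ (sub _ Vx)) tx x0.
      rewrite -zx (piK_aphi (idx_psubW IJ) Uz).
      by apply: (mu_zero IJ) z0; exact: VV_le (ltW r10) Vz.
    by apply: Ctilde_pi_family; exact: zero_Ctilde (sub _ Vx) tx x0 nx.
  apply: le_trans (nrm_add_le K_additive nrm_additive _ _) _.
  have [_ _ t3] := tx.
  have ng : nrm J (g x) <= (sigma - sigma0) / 2.
    apply: le_trans (nrmc _) _; apply: le_trans (ler_wpM2l c0 (ge x)) _.
    rewrite /e mulrCA ger_pMr; last by rewrite divr_gt0// subr_gt0.
    by rewrite ler_pdivrMr ?mul1r ?lerDl// ltr_wpDl.
  lra.
Qed.

End Step.

Arguments collar {R X K} d V J e r.

(** * Construction of the perturbation *)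

Section Levels.
Context (R : realType) (delta : R).
Hypothesis delta0 : 0 < delta.

Let t : R := 2 `^ (- 4^-1).
Let w (k : R) : R := 2 `^ (- k) * delta.

Let t_gt0 : 0 < t. Proof. exact: powR_gt0. Qed.

Let t_lt1 : t < 1.
Proof.
rewrite /t -[ltRHS](powRr0 (2 : R)) /powR (gt_eqF (ltr0n _ 2)) ltr_expR.
have l0 : 0 < ln (2 : R) by apply: ln_gt0; rewrite ltr1n.
by rewrite (ltr_pM2r l0) oppr_lt0 invr_gt0 ltr0n.
Qed.

Lemma level_le (k l : R) : k <= l -> w l <= w k.
Proof.
by move=> kl; rewrite ler_wpM2r ?ler_powR ?ler1n ?lerN2// ltW.
Qed.

Lemma level_gt0 (k : R) : 0 < w k.
Proof. by rewrite mulr_gt0// powR_gt0. Qed.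

Lemma etaE (k : R) : eta delta k = w k * (1 - t).
Proof. by rewrite /eta /w mulrAC. Qed.

Lemma eta_le (k l : R) : k <= l -> eta delta l <= eta delta k.
Proof.
by move=> kl; rewrite !etaE ler_wpM2r ?level_le// subr_ge0 ltW.
Qed.

Lemma eta_gt0 (k : R) : 0 < eta delta k.
Proof. by rewrite etaE mulr_gt0 ?level_gt0// subr_gt0. Qed.

Let level_quarter (k : R) : w (k + 4^-1) = w k * t.
Proof.
rewrite /w opprD powRD; last by rewrite pnatr_eq0 implybT.
by rewrite -/t; ring.
Qed.

(** With t = 2^(-1/4) and W the radius at level k-1, the other radii are W t^2, W t^3, W t^4. The
    factor 1 - t in eta makes the second inequality an equality: t^3 + t^2 (1 - t) = t^2. The fourth
    holds since t^2 + t^2 (1 - t) = 1 - (1 - t)(1 + t - t^2). *)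
Lemma levels (k : R) :
  [/\ w (k - 2^-1) < w (k - 1), w (k - 4^-1) + eta delta (k - 2^-1) <= w (k - 2^-1),
      w k < w (k - 4^-1), w (k - 2^-1) + eta delta (k - 2^-1) < w (k - 1) &
      eta delta k < eta delta (k - 2^-1) /\ eta delta (k - 2^-1) < eta delta (k - 1)].
Proof.
have W0 := level_gt0 (k - 1); set W := w (k - 1) in W0 *.
have E1 : w (k - 2^-1) = W * t ^+ 2.
  have -> : k - 2^-1 = k - 1 + 4^-1 + 4^-1 by field.
  by rewrite !level_quarter -mulrA -expr2.
have E2 : w (k - 4^-1) = W * t ^+ 3.
  have -> : k - 4^-1 = k - 2^-1 + 4^-1 by field.
  by rewrite level_quarter E1 -mulrA -exprSr.
have E3 : w k = W * t ^+ 4.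
  have -> : k = k - 4^-1 + 4^-1 by ring.
  by rewrite level_quarter E2 -mulrA -exprSr.
have t0 := t_gt0; have t1 := t_lt1.
have h2 : 0 < 1 - t by rewrite subr_gt0.
have t20 : 0 < t ^+ 2 by exact: exprn_gt0.
have t21 : t ^+ 2 < 1 by rewrite exprn_ilt1// ltW.
have t32 : t ^+ 3 < t ^+ 2 by rewrite exprS gtr_pMl.
have t43 : t ^+ 4 < t ^+ 3 by rewrite exprS gtr_pMl// exprn_gt0.
split.
- by rewrite E1 gtr_pMr.
- rewrite etaE E1 E2 (_ : _ + _ = W * t ^+ 2)//; ring.
- by rewrite E2 E3 ltr_pM2l.
- rewrite etaE E1 -mulrA -mulrDr gtr_pMr//.
  have -> : t ^+ 2 + t ^+ 2 * (1 - t) = 1 - (1 - t) * (1 + t - t ^+ 2) by ring.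
  rewrite ltrBlDr ltrDl mulr_gt0// subr_gt0; lra.
- rewrite !etaE E1 E3 -/W; split; rewrite (ltr_pM2r h2) ?gtr_pMr//.
  by rewrite ltr_pM2l//; exact: lt_trans t43 t32.
Qed.

End Levels.

Section Induction.
Context (R : realType) (X : topologicalType) (K : atlas R X).
Context (d : realization K -> realization K -> R) (V C : chart_sets K).
Arguments V : clear implicits.
Arguments C : clear implicits.
Context (nrm : forall I : aidx K, obs K I -> R) (delta sigma : R).
Arguments nrm : clear implicits.
Hypotheses (K_tame : tame K) (d_adm : admissible_metric d)
  (nrm_additive : additive_norms nrm) (C_open : forall I, open (C I))
  (delta0 : 0 < delta) (delta_ok : delta_condition d V delta)
  (sigma_gt0 : 0 < sigma)
  (sigma_le : (sigma%:E <= sigma_max d V C nrm delta)%E).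
Implicit Types (I J H : aidx K) (mu : section_family K).

Let w (k : R) : R := 2 `^ (- k) * delta.
Notation lvl J := (w (size_idx J)%:R).

(* The conditions on [mu J] at the level [k = |J|] imply those at all [k >= |J|]. *)
Definition adapted_at mu J (f : dom K J -> obs K J) : Prop :=
  exists sigma1 : R, sigma1 < sigma /\
  [/\ forall x, VV d V (lvl J) J x -> smooth_at f x,
      forall H, idx_psub H J -> forall x, VV d V (lvl J) H x -> aU K H J x ->
        VV d V (lvl J) J (aphi K H J x) -> f (aphi K H J x) = aphihat K H J (mu H x),
      forall x, VV d V (lvl J) J x -> regular_at (fun y => sec J y + f y) x,
      forall H, idx_psub H J -> forall x, VV d V (lvl J) J x ->
        nbhdU d (eta delta (size_idx J)%:R) (NN d V (lvl J) H J) x ->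
        f x \in limg (aphihat K H J) &
      forall x, VV d V (lvl J) J x ->
        (sec J x + f x = 0 -> pi_family C (piK J x)) /\ nrm J (f x) <= sigma1].
Arguments adapted_at : clear implicits.

Lemma idx_size_gt0 J : (0 < size_idx J)%N.
Proof. by have /andP[] := valP J. Qed.

Lemma psub_level I J : idx_psub I J ->
  (size_idx I)%:R <= (size_idx J)%:R - 1 :> R.
Proof.
by move=> /idx_psub_size IJ; rewrite lerBrDr natr1 ler_nat.
Qed.

Lemma sigma_large J x : closure (VV d V (lvl J) J) x -> ~ Ctilde C J x ->
  ~ collar d V J (eta delta ((size_idx J)%:R - 2^-1)) (w ((size_idx J)%:R - 4^-1)) x ->
  sigma <= nrm J (sec J x).
Proof.
move=> cx nC nO; rewrite -lee_fin; apply: le_trans sigma_le _.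
apply: le_trans (bigmin_le _ J _) _; apply: ereal_inf_lbound.
by exists x => //; split => // -[].
Qed.

(** Finitely many bounds strictly below [sigma] have a common one, which can be taken nonnegative
    because [sigma] is positive. *)
Lemma bound_family (P : aidx K -> R -> Prop) :
  (forall I s s', s <= s' -> P I s -> P I s') ->
  (forall I, exists2 s, s < sigma & P I s) ->
  exists s, [/\ 0 <= s, s < sigma & forall I, P I s].
Proof.
move=> mono ex; have {}ex I : exists s, s < sigma /\ P I s.
  by have [s] := ex I; exists s.
pose s I := sval (cid (ex I)); have sP I : s I < sigma /\ P I (s I).
  exact: svalP (cid (ex I)).
exists (\big[Num.max/0]_I s I); split; first exact: bigmax_ge_id.
  by apply: bigmax_lt => // I _; have [] := sP I.
by move=> I; apply: mono (le_bigmax _ s I) _; have [] := sP I.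
Qed.

Lemma adapted_step mu J : (forall I, idx_psub I J -> adapted_at mu I (mu I)) ->
  exists f, adapted_at mu J f.
Proof.
move=> IH; set k : R := (size_idx J)%:R.
have [sigma0 [s0 s1 sP]] : exists s, [/\ 0 <= s, s < sigma &
    forall I, idx_psub I J -> forall x, VV d V (lvl I) I x -> nrm I (mu I x) <= s].
  apply: bound_family => [I s s' ss' H IJ x Vx|I].
    exact: le_trans (H IJ x Vx) ss'.
  have [IJ|nIJ] := boolP (idx_psub I J); last first.
    by exists 0 => // IJ; rewrite IJ in nIJ.
  have [s [ss [_ _ _ _ H]]] := IH I IJ.
  by exists s => // _ x Vx; have [] := H x Vx.
have [l1 l2 l3 l4 [l5 l6]] := levels delta0 k.
have lw I : idx_psub I J -> w (k - 1) <= lvl I.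
  by move=> IJ; apply: level_le => //; exact: psub_level.
have le I : idx_psub I J -> eta delta (k - 1) <= eta delta (size_idx I)%:R.
  by move=> IJ; apply: eta_le => //; exact: psub_level.
have Vl I x : idx_psub I J -> VV d V (w (k - 1)) I x -> VV d V (lvl I) I x.
  by move=> IJ; apply: VV_le; exact: lw.
have wd : w (k - 1) <= 2 * delta.
  have h : w (k - 1) <= w 0.
    by apply: level_le => //; rewrite subr_ge0 ler1n idx_size_gt0.
  by apply: le_trans h _; rewrite /w oppr0 powRr0 ler_wpM2r ?ler1n// ltW.
apply: (inductive_step K_tame d_adm nrm_additive s0 s1 l1 l2 l3 l4
  (eta_gt0 delta0 k) l5 l6 wd delta_ok) => //.
- by move=> I IJ x Vx; have [? [_ [+ _ _ _ _]]] := IH I IJ; apply; exact: Vl.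
- move=> H I HI IJ x Vx Ux Vy; have [? [_ [_ + _ _ _]]] := IH I IJ; apply => //.
    by apply: VV_le Vx; exact: lw.
  exact: Vl.
- by move=> I IJ x Vx; have [? [_ [_ _ + _ _]]] := IH I IJ; apply; exact: Vl.
- move=> H I HI IJ x Vx xN; have [? [_ [_ _ _ + _]]] := IH I IJ; apply => //.
    exact: Vl.
  apply: nbhdU_le xN; [exact: le|move=> y; apply: NN_le; exact: lw].
- move=> I IJ x Vx; have [? [_ [_ _ _ _ H]]] := IH I IJ.
  by have [+ _] := H x (Vl I x IJ Vx); apply.
- by move=> I IJ x /(Vl I x IJ); exact: sP.
- exact: sigma_large.
Qed.

Lemma adapted_at_eq mu mu' J f : (forall H, idx_psub H J -> mu H = mu' H) ->
  adapted_at mu J f -> adapted_at mu' J f.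
Proof.
move=> E [s [ss [h1 h2 h3 h4 h5]]]; exists s; split => //; split => //.
by move=> H HJ x Vx Ux Vy; rewrite -E//; exact: h2.
Qed.

Lemma exists_adapted : exists mu, forall J, adapted_at mu J (mu J).
Proof.
suff H n : exists mu, forall J, (size_idx J <= n)%N -> adapted_at mu J (mu J).
  have [mu muP] := H (\max_(J : aidx K) size_idx J)%N.
  by exists mu => J; apply: muP; exact: leq_bigmax.
elim: n => [|n [mu IH]].
  (* No index has size 0, so any family will do. *)
  exists (fun _ _ => 0) => J; rewrite leqn0 => /eqP J0.
  by have := idx_size_gt0 J; rewrite J0.
have step J : exists f, size_idx J = n.+1 -> adapted_at mu J f.
  have [E|ne] := eqVneq (size_idx J) n.+1; last by exists (mu J) => E; rewrite E eqxx in ne.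
  have [|f fP] := @adapted_step mu J; last by exists f.
  by move=> I /idx_psub_size; rewrite E ltnS; exact: IH.
(* All indices of size n+1 are treated at once: the conditions at J involve only J and its proper
   subsets, which have smaller size. *)
pose mu' : section_family K := fun J => if size_idx J == n.+1 then sval (cid (step J)) else mu J.
have old J : (size_idx J <= n)%N -> mu' J = mu J.
  by move=> Jn; rewrite /mu' (_ : (_ == _) = false)// ltn_eqF.
exists mu' => J; rewrite leq_eqVlt => /orP[/eqP E|]; last first.
  rewrite ltnS => Jn; rewrite (old J Jn); apply: adapted_at_eq (IH J Jn) => H HJ.
  by rewrite (old H)//; apply: leq_trans Jn; exact: ltnW (idx_psub_size HJ).
apply: (@adapted_at_eq mu) => [H HJ|].
  by rewrite (old H)// -ltnS -E; exact: idx_psub_size.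
by rewrite /mu' (_ : (_ == _) = true); [exact: (svalP (cid (step J)) E)|exact/eqP].
Qed.

End Induction.

(** * Compactness of the perturbed zero space *)

Section ZeroSpace.
Context (R : realType) (X : topologicalType) (K : atlas R X).
Context (d : realization K -> realization K -> R) (V C : chart_sets K)
  (mu : section_family K).
Arguments V : clear implicits.
Arguments C : clear implicits.
Arguments mu : clear implicits.
Hypotheses (K_tame : tame K) (d_adm : admissible_metric d)
  (CV_nested : nested_reduction C V).
Hypothesis mu_smooth : forall I x, V I x -> smooth_at (mu I) x.
Hypothesis mu_compat : forall I J, idx_psub I J -> forall x, V I x -> aU K I J x ->
  V J (aphi K I J x) -> mu J (aphi K I J x) = aphihat K I J (mu I x).
Hypothesis mu_zero : forall I x, V I x -> perturbed mu I x = 0 ->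
  pi_family C (piK I x).
Implicit Types (I J : aidx K).

Let C_compact J : compact (closure (C J)).
Proof. by case: CV_nested => _ _ /(_ J)[]. Qed.

Let CV J : closure (C J) `<=` V J.
Proof. by case: CV_nested => _ _ /(_ J)[]. Qed.

Lemma compact_set_val (T : topologicalType) (A S : set T) :
  compact S -> S `<=` A -> compact (set_val @^-1` S : set (set_type A)).
Proof.
move=> cS SA F FF FS.
have [p [Sp cp]] := cS (set_val @ F) _ FS.
exists (SigSub (mem_set (SA p Sp))); split => //.
move=> G N FG [B [[P oP PB] Bp BN]].
have FG' : F (set_val @^-1` (set_val @` G)) by apply: filterS FG => z Gz; exists z.
have nP : nbhs p P by apply: open_nbhs_nbhs; split => //; move: Bp; rewrite -PB.
have [_ [[z Gz <-] Pz]] := cp _ _ FG' nP.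
by exists z; split => //; apply: BN; rewrite -PB.
Qed.

Lemma perturbed_aphi_eq I J x : idx_psub I J -> V I x -> aU K I J x ->
  V J (aphi K I J x) -> perturbed mu J (aphi K I J x) = aphihat K I J (perturbed mu I x).
Proof.
move=> IJ Vx Ux Vy; rewrite /perturbed mu_compat// raddfD.
by rewrite sec_aphi// idx_psubW.
Qed.

Let zeros : set (disjoint_union K) :=
  [set p | perturbed_zeros V mu (projT1 p) (projT2 p)].

Let core J : set (dom K J) := [set x | closure (C J) x /\ perturbed mu J x = 0].
Arguments core : clear implicits.

(** The zero set is closed in the closure of C_J, because this closure lies in V_J, where the
    section is continuous. *)
Let core_compact J : compact (core J).
Proof.
have sub : core J `<=` closure (C J) by move=> x [].
apply: (subclosed_compact _ (@C_compact J) sub) => x cx.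
have Cx : closure (C J) x.
  by apply: (@closed_closure _ (C J)); exact: closure_subset cx.
split=> //; apply/eqP; rewrite -memv0; apply: closure_mem.
  by apply: smooth_at_add; [exact: smooth_sec|exact: mu_smooth (CV Cx)].
by apply: closure_subset cx => y [_ y0]; rewrite /= y0 memv0.
Qed.

(** The space is the image of the finite union of the compact sets [core J]. A zero (I, x) agrees in
    |K| with some (J, y), y in C_J. The quotient is generated inside the zero set, so a relation
    between zeros is needed: I and J are comparable since V is a reduction, whence one step joins
    the two points, and [y] is a zero by compatibility and, when J is the smaller index, injectivity
    of phihat_JI. *)
Lemma zero_space_compact : compact [set: perturbed_zero_space V mu].
Proof.
pose emb J : dom K J -> disjoint_union K := existT (fun I => dom K I) J.
pose S : set (disjoint_union K) := \big[setU/set0]_(J : aidx K) (emb J @` core J).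
have cS : compact S.
  apply: bigsetU_compact => J _; apply: continuous_compact (@core_compact J).
  exact/continuous_subspaceT/existT_continuous.
have SZ : S `<=` zeros.
  rewrite /S; elim/big_ind: _ => // [A B sA sB p [/sA|/sB]//|J _ _ [x [cx x0] <-]].
  by split => //; exact: CV.
have cB := compact_set_val cS SZ.
pose rel (p q : zeros_union R X K V mu) := step K (set_val p) (set_val q).
rewrite (_ : [set: _] = quotient_proj rel @` (set_val @^-1` S)).
  by apply: continuous_compact cB; apply: continuous_subspaceT; exact: pi_continuous.
rewrite predeqE => q; split => // _.
pose z := repr q; have qz : quotient_proj rel z = q by exact: reprK.
have [I [x [zE Vx x0]]] : exists I (x : dom K I),
    [/\ set_val z = emb I x, V I x & perturbed mu I x = 0].
  have : zeros (set_val z) by exact: set_valP.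
  by case: (set_val z) => I x [Vx x0]; exists I, x.
have [J [y Cy yx]] := mu_zero Vx x0.
have Vy : V J y by apply: CV; exact: subset_closure.
have SJ x' : core J x' -> S (emb J x').
  by move=> cx'; rewrite /S (bigD1 J)//; left; exists x'.
have comp : idx_sub I J || idx_sub J I.
  have [_ [_ _ + _] _] := CV_nested; apply; exists (piK J y).
  by split; [exists x => //; exact: subset_closure|exists y => //; exact: subset_closure].
suff [y0 yz] : perturbed mu J y = 0 /\ forall yZ : zeros (emb J y),
    quotient_proj rel (SigSub (mem_set yZ)) = quotient_proj rel z.
  have yZ : zeros (emb J y) by [].
  exists (SigSub (mem_set yZ)); last by rewrite yz.
  by apply: SJ; split => //; exact: subset_closure.
have quot_sym p p' : rel p p' -> quotient_proj rel p' = quotient_proj rel p.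
  by move=> pp; apply/eqmodP; apply/asboolP; apply: rst_sym; exact: rst_step.
have same (yZ : zeros (emb I x)) : SigSub (mem_set yZ) = z.
  by apply: val_inj; rewrite SubK -zE.
case/orP: comp => IJ.
  have [Ux xy] := piK_aphiP K_tame d_adm IJ (esym yx); subst y.
  case: (idx_sub_eqVp IJ) => [E|pIJ].
    subst J; move: Vy; rewrite aphi_id => Vy; split => // yZ.
    by rewrite same.
  split; first by rewrite perturbed_aphi_eq// x0 linear0.
  by move=> yZ; apply: quot_sym; split; rewrite /= zE.
have [Uy yx'] := piK_aphiP K_tame d_adm IJ yx; subst x.
case: (idx_sub_eqVp IJ) => [E|pJI].
  subst I; move: x0 same; rewrite aphi_id => x0 same; split => // yZ.
  by rewrite same.
split; last first.
  by move=> yZ; apply/esym; apply: quot_sym; split; rewrite /= zE.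
apply: (aphihat_inj IJ); rewrite linear0 -x0.
by rewrite perturbed_aphi_eq.
Qed.

End ZeroSpace.

Lemma delta_max_condition (R : realType) (X : topologicalType) (K : atlas R X)
    (d : realization K -> realization K -> R) (V : chart_sets K) (delta : R) :
  0 < delta < delta_max d V -> delta_condition d V delta.
Proof.
rewrite /delta_max; set A := [set c | _] => /andP[d0 dmax].
(* For an empty set of constants the supremum is 0, which cannot exceed [delta]. *)
have [A0|/nonemptyPn A0] := pselect (A !=set0); last first.
  by move: dmax; rewrite A0 sup0 => /(lt_trans d0); rewrite ltxx.
have [c [_ cP] dc] := sup_gt A0 dmax.
by apply: cP; rewrite d0.
Qed.

Theorem proposition7p3p7 (R : realType) (X : topologicalType) (K : atlas R X)
    (d : realization K -> realization K -> R) (V C : chart_sets K)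
    (nrm : forall I : aidx K, obs K I -> R) (delta sigma : R)
    (X_compact : compact [set: X]) (X_metrizable : metrizable R X)
    (K_tame : tame K) (d_admissible : admissible_metric d)
    (CV_nested : nested_reduction C V) (nrm_additive : additive_norms nrm)
    (delta_bounds : 0 < delta < delta_max d V)
    (sigma_gt0 : 0 < sigma)
    (sigma_le : (sigma%:E <= sigma_max d V C nrm delta)%E) :
  exists nu : section_family K,
    [/\ is_perturbation V nu,
        adapted d V C nrm delta sigma nu,
        [/\ admissible V nu, precompact_perturbation V nu & transverse V nu],
        compact [set: perturbed_zero_space V nu] &
        pi_family (perturbed_zeros V nu) `<=` pi_family C].
Proof.
have [delta0 _] := andP delta_bounds.
have dok := delta_max_condition delta_bounds.
have C_open I : open (C I) by case: CV_nested => -[/(_ I)[]].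
have V_open I : open (V I) by case: CV_nested => _ [/(_ I)[]].
have [mu muP] := exists_adapted K_tame d_admissible nrm_additive C_open delta0 dok
  sigma_gt0 sigma_le.
pose w k : R := 2 `^ (- k) * delta.
have VVV k I x : V I x -> VV d V (w k) I x.
  move=> Vx; exists x => //; rewrite /pull (d_refl d_admissible).
  exact: level_gt0.
have muS I x : VV d V (w (size_idx I)%:R) I x -> smooth_at (mu I) x.
  by have [s [_ [+ _ _ _ _]]] := muP I; apply.
have muC I J x : idx_psub I J -> VV d V (w (size_idx J)%:R) I x -> aU K I J x ->
    VV d V (w (size_idx J)%:R) J (aphi K I J x) ->
    mu J (aphi K I J x) = aphihat K I J (mu I x).
  by move=> IJ; have [s [_ [_ + _ _ _]]] := muP J; apply.
have muR I x : VV d V (w (size_idx I)%:R) I x -> regular_at (perturbed mu I) x.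
  by have [s [_ [_ _ + _ _]]] := muP I; apply.
have muI H I x : idx_psub H I -> VV d V (w (size_idx I)%:R) I x ->
    nbhdU d (eta delta (size_idx I)%:R) (NN d V (w (size_idx I)%:R) H I) x ->
    mu I x \in limg (aphihat K H I).
  by move=> HI; have [s [_ [_ _ _ + _]]] := muP I; apply.
have muZ I x : VV d V (w (size_idx I)%:R) I x -> perturbed mu I x = 0 ->
    pi_family C (piK I x).
  by move=> Vx; have [s [_ [_ _ _ _ H]]] := muP I; have [] := H x Vx.
have zeros_sub : pi_family (perturbed_zeros V mu) `<=` pi_family C.
  by move=> q [I [x [Vx x0] <-]]; apply: muZ => //; exact: VVV.
(* As total functions, the sections on the sets V_I^|I| serve both as the perturbation and as its
   extension. *)
exists mu; split => //.
- split; first by move=> I; apply/smooth_vmapP => x Vx; apply: muS; exact: VVV.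
  by move=> I J IJ x Vx Ux Vy; apply: muC => //; exact: VVV.
- exists mu; split => //; first by move=> I; apply/smooth_vmapP => x; exact: muS.
  move=> k _ I Ik.
  have lI : w k%:R <= w (size_idx I)%:R by apply: level_le => //; rewrite ler_nat.
  have eI : eta delta k%:R <= eta delta (size_idx I)%:R.
    by apply: eta_le => //; rewrite ler_nat.
  have up H x : VV d V (w k%:R) H x -> VV d V (w (size_idx I)%:R) H x.
    exact: VV_le.
  split.
  + by move=> H HI x Vx Ux Vy; apply: muC => //; exact: up.
  + by move=> x /up/muR.
  + move=> H HI x Vx xN; apply: muI => //.
    by apply: nbhdU_le xN => // y; exact: NN_le.
  + by move=> x /up; exact: muZ.
  + have [s [ss [_ _ _ _ H]]] := muP I.
    rewrite (@le_lt_trans _ _ s%:E) ?lte_fin//; apply: ge_ereal_sup.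
    by move=> _ [x /up Vx <-]; rewrite lee_fin; have [] := H x Vx.
- split.
  + move=> I J IJ y [Vy [x [Vx Ux] xy]].
    have yV := VVV (size_idx J)%:R J y Vy.
    (* Admissibility concerns the differential, so values in E_I are needed on a whole neighbourhood
       of [y]; the eta-neighbourhood of N_JI provides it. *)
    have yN : nbhdU d (eta delta (size_idx J)%:R) (NN d V (w (size_idx J)%:R) I J) y.
      exists y; last by rewrite /pull (d_refl d_admissible) eta_gt0.
      by split => //; exists x => //; split => //; exact: VVV.
    have N1 := open_nbhs_nbhs (conj (VV_open V d_admissible _ J) yV).
    have N2 := nbhdU_near d_admissible yN.
    apply/subvP => e /memv_imgP[u _ ->]; apply: vdiff_mem; first exact: muS.
    by apply: filterS (filterI N1 N2) => z [Vz zN]; exact: muI.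
  + by exists C; split.
  + by move=> I x Vx; apply: muR; exact: VVV.
- apply: (zero_space_compact K_tame d_admissible CV_nested).
  + by move=> I x Vx; apply: muS; exact: VVV.
  + by move=> I J IJ x Vx Ux Vy; apply: muC => //; exact: VVV.
  + by move=> I x Vx; apply: muZ; exact: VVV.
Qed.
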